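(* Let $A$ be a real $d\times d$ matrix, let $s,\sigma>0$ be such that $s+\sigma\ge 1$, and let $a\in\Gamma_{s,\sigma;0}^{\sigma,s}(\mathbf R^{2d})$. Then $\operatorname{Op}_A(a)$ is continuous on $\mathcal S_s^\sigma(\mathbf R^d)$ and on $(\mathcal S_s^\sigma)'(\mathbf R^d)$.
   Context: Gelfand–Shilov spaces. For $h>0$, $\mathcal S_{s;h}^\sigma(\mathbf R^d)$ is the Banach space of all $f\in C^\infty(\mathbf R^d)$ with finite norm $\sup_{\alpha,\beta\in\mathbf N^d}\sup_{x}\frac{|x^\alpha\partial^\beta f(x)|}{h^{|\alpha|+|\beta|}\alpha!^s\beta!^\sigma}$. $\mathcal S_s^\sigma(\mathbf R^d)=\bigcup_{h>0}\mathcal S_{s;h}^\sigma(\mathbf R^d)$ with the inductive limit topology, and $(\mathcal S_s^\sigma)'(\mathbf R^d)=\bigcap_{h>0}(\mathcal S_{s;h}^\sigma)'(\mathbf R^d)$ is its dual, with the projective limit topology. The space $\mathcal S_{s,\sigma}^{\sigma,s}(\mathbf R^{2d})$ consists of all $F\in C^\infty(\mathbf R^{2d})$ such that for some $h>0$ there is $C>0$ with $|x^{\alpha_1}\xi^{\alpha_2}\partial_x^{\beta_1}\partial_\xi^{\beta_2}F(x,\xi)|\le C h^{|\alpha_1+\alpha_2+\beta_1+\beta_2|}\alpha_1!^{s}\alpha_2!^{\sigma}\beta_1!^{\sigma}\beta_2!^{s}$ for all multi-indices and all $x,\xi\in\mathbf R^d$; its topology and dual are defined analogously. Symbol class. $\Gamma_{s,\sigma;0}^{\sigma,s}(\mathbf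 R^{2d})$ is the set of all $a\in C^\infty(\mathbf R^{2d})$ for which there is $h>0$ such that for every $r>0$ there is $C>0$ with $$|\partial_x^\alpha\partial_\xi^\beta a(x,\xi)|\le C h^{|\alpha+\beta|}\alpha!^\sigma\beta!^s e^{r(|x|^{1/s}+|\xi|^{1/\sigma})},\qquad \alpha,\beta\in\mathbf N^d,\ x,\xi\in\mathbf R^d.$$ It is contained in $(\mathcal S_{s,\sigma}^{\sigma,s})'(\mathbf R^{2d})$. Pseudo-differential operators. For nice $a$, $(\operatorname{Op}_A(a)f)(x)=(2\pi)^{-d}\iint a(x-A(x-y),\xi)f(y)e^{i\langle x-y,\xi\rangle}\,dy\,d\xi$. For $a\in(\mathcal S_{s,\sigma}^{\sigma,s})'(\mathbf R^{2d})$, $\operatorname{Op}_A(a)$ is the continuous operator from $\mathcal S_s^\sigma(\mathbf R^d)$ to $(\mathcal S_s^\sigma)'(\mathbf R^d)$ with distribution kernel $K_{a,A}(x,y)=(2\pi)^{-d/2}(\mathscr F_2^{-1}a)(x-A(x-y),x-y)$, where $\mathscr F_2$ is the partial Fourier transform in the second variable and $\mathscr Ff(\xi)=(2\pi)^{-d/2}\int f(x)e^{-i\langle x,\xi\rangle}dx$. Continuity on $\mathcal S_s^\sigma$ means it maps $\mathcal S_s^\sigma$ continuously into itself; continuity on the dual refers to the extension of $\operatorname{Op}_A(a)$ to $(\mathcal S_s^\sigma)'$ (by duality). *)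

(* Defs.v *)
From HB Require Import structures.
From mathcomp Require Import all_boot all_order all_algebra.
From mathcomp Require Import complex.
From mathcomp Require Import all_classical all_reals all_analysis.
Set Implicit Arguments.
Unset Strict Implicit.
Unset Printing Implicit Defensive.
Import Order.TTheory GRing.Theory Num.Theory.
Import numFieldNormedType.Exports.
Local Open Scope classical_set_scope.
Local Open Scope complex_scope.
Local Open Scope ring_scope.

Section MultiIndices.
Context (R : realType) (n : nat).
Implicit Types (alpha : 'I_n -> nat) (x y : 'rV[R]_n).

Definition mi_abs alpha : nat := (\sum_i alpha i)%N.
Definition mi_fact alpha : nat := (\prod_i (alpha i)`!)%N.
Definition mi_pow x alpha : R := \prod_i x 0 i ^+ alpha i.

Definition dotv x y : R := \sum_i x 0 i * y 0 i.
Definition enorm x : R := Num.sqrt (dotv x x).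

End MultiIndices.

Definition mi_pair (m n : nat) (alpha : 'I_m -> nat) (beta : 'I_n -> nat)
    (k : 'I_(m + n)) : nat :=
  match fintype.split k with inl i => alpha i | inr j => beta j end.

Section Derivatives.
Context (R : realType) (n : nat).
Implicit Types (f g : 'rV[R]_n -> R) (F G : 'rV[R]_n -> R[i]).

Definition partial (i : 'I_n) f : 'rV[R]_n -> R :=
  fun x => 'D_(delta_mx 0 i : 'rV[R]_n) f x.

Definition partials (l : seq 'I_n) f : 'rV[R]_n -> R := foldr partial f l.

Definition rsmooth f : Prop := forall l : seq 'I_n,
  continuous (partials l f) /\
  forall i x, derivable (partials l f) x (delta_mx 0 i : 'rV[R]_n).

Definition rderiv (alpha : 'I_n -> nat) f : 'rV[R]_n -> R :=
  partials (flatten [seq nseq (alpha i) i | i <- enum 'I_n]) f.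

(* The complex numbers are not a normed space over R in the library, hence
   differentiation goes through real and imaginary parts. *)
Definition smooth F : Prop :=
  rsmooth (fun x => complex.Re (F x)) /\ rsmooth (fun x => complex.Im (F x)).

Definition mderiv (alpha : 'I_n -> nat) F : 'rV[R]_n -> R[i] := fun x =>
  rderiv alpha (fun y => complex.Re (F y)) x +i*
  rderiv alpha (fun y => complex.Im (F y)) x.

Lemma partials_comb (a b : R) f g : rsmooth f -> rsmooth g -> forall l,
  partials l (fun x => a * f x + b * g x) =
  (fun x => a * partials l f x + b * partials l g x).
Proof.
move=> sf sg; elim=> [//|i l IHl]; rewrite [LHS]/= IHl.
apply/funext => x; rewrite /= /partial.
have df := (sf l).2 i x; have dg := (sg l).2 i x.
have -> : (fun y => a * partials l f y + b * partials l g y) =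
  a *: partials l f + b *: partials l g by [].
by rewrite deriveD ?deriveZ //; exact: derivableZ.
Qed.

Lemma rsmooth_comb (a b : R) f g : rsmooth f -> rsmooth g ->
  rsmooth (fun x => a * f x + b * g x).
Proof.
move=> sf sg l; rewrite partials_comb //; split=> [x|i x].
  apply: (@continuousD R _ _ (fun y => a * partials l f y)
                             (fun y => b * partials l g y)).
    exact: (@continuousM R _ _ (partials l f) x (@cst_continuous _ _ a x)
      ((sf l).1 x)).
  exact: continuousM (@cst_continuous _ _ b x) ((sg l).1 x).
have -> : (fun y => a * partials l f y + b * partials l g y) =
  a *: partials l f + b *: partials l g by [].
by apply: derivableD; apply: derivableZ; [exact: (sf l).2|exact: (sg l).2].
Qed.

Lemma partials0 l : partials l (fun=> 0) = (fun=> 0).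
Proof.
elim: l => //= i l ->; apply/funext => x.
by rewrite /partial (derive_cst (0 : R)).
Qed.

Lemma rsmooth0 : rsmooth (fun=> 0).
Proof.
move=> l; rewrite partials0; split=> [x|i x]; first exact: cst_continuous.
exact: (derivable_cst (0 : R)).
Qed.

Lemma Re_comb (c : R[i]) F : (fun x => complex.Re (c * F x)) =
  (fun x => complex.Re c * complex.Re (F x) +
            (- complex.Im c) * complex.Im (F x)).
Proof.
by apply/funext => x; case: c (F x) => a b [u v]; rewrite /= mulNr.
Qed.

Lemma Im_comb (c : R[i]) F : (fun x => complex.Im (c * F x)) =
  (fun x => complex.Re c * complex.Im (F x) +
            complex.Im c * complex.Re (F x)).
Proof. by apply/funext => x; case: c (F x) => a b [u v]. Qed.

Lemma Re_add F G : (fun x => complex.Re (F x + G x)) =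
  (fun x => 1 * complex.Re (F x) + 1 * complex.Re (G x)).
Proof.
by apply/funext => x; rewrite !mul1r; case: (F x) (G x) => a b [u v].
Qed.

Lemma Im_add F G : (fun x => complex.Im (F x + G x)) =
  (fun x => 1 * complex.Im (F x) + 1 * complex.Im (G x)).
Proof.
by apply/funext => x; rewrite !mul1r; case: (F x) (G x) => a b [u v].
Qed.

Lemma smoothZ (c : R[i]) F : smooth F -> smooth (fun x => c * F x).
Proof.
by move=> [r i]; split; rewrite (Re_comb, Im_comb); exact: rsmooth_comb.
Qed.

Lemma smoothD F G : smooth F -> smooth G -> smooth (fun x => F x + G x).
Proof.
by move=> [? ?] [? ?]; split; rewrite (Re_add, Im_add); exact: rsmooth_comb.
Qed.

Lemma smooth0 : smooth (fun=> 0).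
Proof. by split; exact: rsmooth0. Qed.

Lemma mderivZ alpha (c : R[i]) F x : smooth F ->
  mderiv alpha (fun x => c * F x) x = c * mderiv alpha F x.
Proof.
move=> [sr si]; rewrite /mderiv Re_comb Im_comb /rderiv !partials_comb//.
by case: c => a b /=; rewrite mulNr.
Qed.

Lemma mderivD alpha F G x : smooth F -> smooth G ->
  mderiv alpha (fun x => F x + G x) x = mderiv alpha F x + mderiv alpha G x.
Proof.
move=> [? ?] [? ?]; rewrite /mderiv Re_add Im_add /rderiv !partials_comb//.
by rewrite !mul1r.
Qed.

Lemma mderiv0 alpha x : mderiv alpha (fun=> 0 : R[i]) x = 0.
Proof. by rewrite /mderiv /rderiv partials0. Qed.

End Derivatives.

Section GelfandShilov.
Context (R : realType) (s sigma : R) (n : nat).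
Implicit Types F G : 'rV[R]_n -> R[i].

Definition gs_quot (h : R) F (alpha beta : 'I_n -> nat) (x : 'rV[R]_n) : R :=
  `|mi_pow x alpha| * Normc.normc (mderiv beta F x) /
  (h ^+ (mi_abs alpha + mi_abs beta) *
   (mi_fact alpha)%:R `^ s * (mi_fact beta)%:R `^ sigma).

Definition gs_norm (h : R) F : \bar R :=
  ereal_sup [set e | exists alpha beta x, e = (gs_quot h F alpha beta x)%:E].

Definition gs_pred : {pred 'rV[R]_n -> R[i]} :=
  [pred F | `[< smooth F /\ exists2 h : R, 0 < h & (gs_norm h F < +oo)%E >]].

Lemma gs_quot_ge0 h F alpha beta x : 0 < h -> 0 <= gs_quot h F alpha beta x.
Proof.
move=> h0; rewrite /gs_quot; apply: divr_ge0.
  by rewrite mulr_ge0//; case: mderiv => u v; rewrite sqrtr_ge0.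
by rewrite !mulr_ge0 ?powR_ge0// exprn_ge0// ltW.
Qed.

Lemma gs_norm_ltP h F : (gs_norm h F < +oo)%E <->
  exists M : R, forall alpha beta x, gs_quot h F alpha beta x <= M.
Proof.
split=> [|[M HM]]; last first.
  apply: (@le_lt_trans _ _ M%:E); last by rewrite ltry.
  by apply: ge_ereal_sup => _ [al [be [x ->]]]; rewrite lee_fin.
have ub al be x : ((gs_quot h F al be x)%:E <= gs_norm h F)%E.
  by apply: ereal_sup_ubound; exists al, be, x.
case: (gs_norm h F) ub => [M| |] ub.
- by move=> _; exists M => al be x; have := ub al be x; rewrite lee_fin.
- by rewrite ltxx.
- move=> _; exists 0 => al be x.
  by have := ub al be x; rewrite leeNy_eq.
Qed.

Lemma gs_quot_le h h' F alpha beta x : 0 < h -> h <= h' ->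
  gs_quot h' F alpha beta x <= gs_quot h F alpha beta x.
Proof.
move=> h0 hh; have h'0 := lt_le_trans h0 hh.
have f0 (k : nat) (t : R) : (0 < k)%N -> 0 < (k%:R : R) `^ t.
  by move=> k0; rewrite powR_gt0// ltr0n.
have mf0 (al : 'I_n -> nat) : (0 < mi_fact al)%N.
  by apply: prodn_gt0 => i; exact: fact_gt0.
rewrite /gs_quot ler_wpM2l//.
  by rewrite mulr_ge0//; case: mderiv => u v; rewrite sqrtr_ge0.
rewrite lef_pV2 ?posrE ?mulr_gt0 ?f0 ?exprn_gt0//.
by rewrite !ler_wpM2r ?powR_ge0// lerXn2r// nnegrE ltW.
Qed.

Lemma gs_submod_closed : submod_closed gs_pred.
Proof.
split=> [|c F G /asboolP[sF [h h0 /gs_norm_ltP[M HM]]]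
                /asboolP[sG [k k0 /gs_norm_ltP[N HN]]]].
  apply/asboolP; split; first exact: smooth0.
  exists 1; first by [].
  apply/gs_norm_ltP; exists 0 => al be x.
  by rewrite /gs_quot mderiv0 Normc.normc0 mulr0 mul0r.
apply/asboolP; split; first exact: smoothD (smoothZ c sF) sG.
exists (Num.max h k); first by rewrite lt_max h0.
apply/gs_norm_ltP; exists (Normc.normc c * M + N) => al be x.
have {HM} := le_trans (gs_quot_le F al be x h0 _) (HM al be x).
move=> /(_ (Num.max h k)); rewrite le_max lexx => /(_ isT) HM.
have {HN} := le_trans (gs_quot_le G al be x k0 _) (HN al be x).
move=> /(_ (Num.max h k)); rewrite le_max lexx orbT => /(_ isT) HN.
set H := Num.max h k in HM HN *; have H0 : 0 < H by rewrite lt_max h0.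
have c0 : 0 <= Normc.normc c by case: (c) => u v; rewrite sqrtr_ge0.
apply: le_trans (lerD (ler_wpM2l c0 HM) HN); rewrite /gs_quot.
rewrite (mderivD _ _ (smoothZ c sF) sG) mderivZ//.
set D := (X in _ / X); have D0 : 0 <= D^-1.
  by rewrite invr_ge0 /D !mulr_ge0 ?powR_ge0// exprn_ge0// ltW.
rewrite mulrA -mulrDl ler_wpM2r// mulrCA -mulrDr ler_wpM2l//.
by rewrite -Normc.normcM le_normcD.
Qed.

HB.instance Definition _ := GRing.isSubmodClosed.Build _ _ gs_pred
  gs_submod_closed.

Record gs := GS { gs_fun :> 'rV[R]_n -> R[i]; gsP : gs_fun \in gs_pred }.

HB.instance Definition _ := [isSub for gs_fun].
HB.instance Definition _ := [Choice of gs by <:].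
HB.instance Definition _ := [SubChoice_isSubLmodule of gs by <:].

Definition abs_convex (U : set gs) : Prop := forall (a b : R[i]) (f g : gs),
  Normc.normc a + Normc.normc b <= 1 -> U f -> U g -> U (a *: f + b *: g).

Definition meets_steps (U : set gs) : Prop := forall h : R, 0 < h ->
  exists2 e : R, 0 < e & forall f : gs, (gs_norm h f < e%:E)%E -> U f.

(* Inductive limit in the category of locally convex spaces: the finest
   locally convex topology for which all the inclusions of the Banach spaces
   [gs_norm h f < +oo] are continuous.  The neighbourhoods of 0 are the sets
   that contain an absolutely convex set whose trace on every step is a
   neighbourhood of 0. *)
Definition gs_open (W : set gs) : Prop := forall f, W f ->
  exists U : set gs, [/\ abs_convex U, meets_steps U &
    forall g, U g -> W (f + g)].

Lemma gs_openT : gs_open setT.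
Proof.
move=> f _; exists setT; split => // h _.
by exists 1; first exact: ltr01.
Qed.

Lemma gs_openI : setI_closed gs_open.
Proof.
move=> V W oV oW f [/oV[U [cU mU UV]] /oW[U' [cU' mU' UW]]].
exists (U `&` U'); split.
- by move=> a b f1 f2 ab [? ?] [? ?]; split; [exact: cU|exact: cU'].
- move=> h h0; have [e e0 eU] := mU h h0; have [k k0 kU'] := mU' h h0.
  exists (Num.min e k); first by rewrite lt_min e0.
  move=> g gek; split; [apply: eU|apply: kU']; apply: (lt_le_trans gek);
    by rewrite lee_fin ge_min lexx ?orbT.
- by move=> g [/UV ? /UW ?].
Qed.

Lemma gs_open_bigU (I : Type) (W : I -> set gs) :
  (forall i, gs_open (W i)) -> gs_open (\bigcup_i W i).
Proof.
move=> oW f [i _ /oW[U [cU mU UW]]]; exists U; split => // g Ug.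
by exists i => //; exact: UW.
Qed.

HB.instance Definition _ := isOpenTopological.Build gs
  gs_openT gs_openI gs_open_bigU.

Definition dual_norm (h : R) (u : gs -> R[i]) : \bar R :=
  ereal_sup [set (Normc.normc (u f))%:E | f in
    [set f : gs | (gs_norm h f <= 1)%E]].

Record gs_dual := GSDual { dual_fun :> {scalar gs};
  dualP : forall h : R, 0 < h -> (dual_norm h dual_fun < +oo)%E }.

HB.instance Definition _ := gen_eqMixin gs_dual.
HB.instance Definition _ := gen_choiceMixin gs_dual.

(* Projective limit: the coarsest topology for which the restrictions to the
   Banach duals of the steps are continuous. *)
Definition dual_open (W : set gs_dual) : Prop := forall u, W u ->
  exists (hs : seq R) (e : R), [/\ {in hs, forall h, 0 < h}, 0 < e &
    forall v : gs_dual,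
      {in hs, forall h, (dual_norm h (fun f => (v f - u f)%R) < e%:E)%E} -> W v].

Lemma dual_openT : dual_open setT.
Proof. by move=> u _; exists [::], 1; split. Qed.

Lemma dual_openI : setI_closed dual_open.
Proof.
move=> V W oV oW u [/oV[hs [e [h0 e0 hV]]] /oW[ks [k [h0' k0 kW]]]].
exists (hs ++ ks), (Num.min e k); split.
- by move=> h; rewrite mem_cat => /orP[/h0|/h0'].
- by rewrite lt_min e0.
- move=> v vu; split; [apply: hV|apply: kW] => h hin.
  + apply: lt_le_trans (vu h _) _; first by rewrite mem_cat hin.
    by rewrite lee_fin ge_min lexx.
  + apply: lt_le_trans (vu h _) _; first by rewrite mem_cat hin orbT.
    by rewrite lee_fin ge_min lexx orbT.
Qed.

Lemma dual_open_bigU (I : Type) (W : I -> set gs_dual) :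
  (forall i, dual_open (W i)) -> dual_open (\bigcup_i W i).
Proof.
move=> oW u [i _ /oW[hs [e [h0 e0 hW]]]]; exists hs, e; split => // v vu.
by exists i => //; exact: hW.
Qed.

HB.instance Definition _ := isOpenTopological.Build gs_dual
  dual_openT dual_openI dual_open_bigU.

End GelfandShilov.

Section Integration.
Context (R : realType).

(* Lebesgue integral on R^n as an iterated integral: the library has no
   Lebesgue measure on row vectors.  By Fubini the two agree on integrable
   functions, and below only continuous integrable functions matter. *)
Fixpoint rint (n : nat) : ('rV[R]_n -> R) -> R :=
  match n with
  | 0 => fun f => f 0
  | m.+1 => fun f => \int[@lebesgue_measure R]_t
      rint (fun y : 'rV[R]_m => f (row_mx (const_mx t : 'rV[R]_1) y))
  end.

Definition cint (n : nat) (F : 'rV[R]_n -> R[i]) : R[i] :=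
  rint (fun x => complex.Re (F x)) +i* rint (fun x => complex.Im (F x)).

Definition expi (t : R) : R[i] := cos t +i* sin t.

(* Distributions on R^n are given by their (bilinear) action on test
   functions; values outside the relevant test space play no role. *)
Definition functional (n : nat) : Type := ('rV[R]_n -> R[i]) -> R[i].

Definition distr (n : nat) (F : 'rV[R]_n -> R[i]) : functional n :=
  fun phi => cint (fun x => F x * phi x).

Definition pull (n : nat) (M : 'M[R]_n) (u : functional n) : functional n :=
  fun phi => (`|\det M|^-1)%:C * u (fun w => phi (w *m invmx M)).

Definition two_pi_pow (t : R) : R[i] := ((2 * pi) `^ t)%:C.

Section Operators.
Context (d : nat).

Definition invF2 (phi : 'rV[R]_(d + d) -> R[i]) : 'rV[R]_(d + d) -> R[i] :=
  fun w => two_pi_pow (- (d%:R / 2)) * cint (fun t : 'rV[R]_d =>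
    phi (row_mx (lsubmx w) t) * expi (dotv t (rsubmx w))).

Definition distr_invF2 (u : functional (d + d)) : functional (d + d) :=
  fun phi => u (invF2 phi).

(* Row vectors: (x, y) *m quant_mx A = (x - A (x - y), x - y). *)
Definition quant_mx (A : 'M[R]_d) : 'M[R]_(d + d) :=
  block_mx (1%:M - A^T) 1%:M A^T (- 1%:M).

Definition kernel (A : 'M[R]_d) (a : functional (d + d)) : functional (d + d) :=
  fun phi => two_pi_pow (- (d%:R / 2)) * pull (quant_mx A) (distr_invF2 a) phi.

Definition tensor (g f : 'rV[R]_d -> R[i]) : 'rV[R]_(d + d) -> R[i] :=
  fun w => g (lsubmx w) * f (rsubmx w).

Definition Op (A : 'M[R]_d) (a : functional (d + d))
    (f : 'rV[R]_d -> R[i]) : functional d :=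
  fun g => kernel A a (tensor g f).

Definition Gamma0 (s sigma : R) (a : 'rV[R]_(d + d) -> R[i]) : Prop :=
  smooth a /\
  exists2 h : R, 0 < h & forall r : R, 0 < r -> exists2 C : R, 0 < C &
    forall (alpha beta : 'I_d -> nat) (x xi : 'rV[R]_d),
      Normc.normc (mderiv (mi_pair alpha beta) a (row_mx x xi)) <=
      C * h ^+ (mi_abs alpha + mi_abs beta) *
      (mi_fact alpha)%:R `^ sigma * (mi_fact beta)%:R `^ s *
      expR (r * (enorm x `^ s^-1 + enorm xi `^ sigma^-1)).

Definition continuous_on_gs (s sigma : R)
    (P : ('rV[R]_d -> R[i]) -> functional d) : Prop :=
  exists T : {linear gs s sigma d -> gs s sigma d},
    continuous T /\
    forall f g : gs s sigma d, P f g = distr (T f) g.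

(* [Pt] is the transpose of [P]. *)
Definition continuous_on_dual (s sigma : R)
    (P : ('rV[R]_d -> R[i]) -> functional d) : Prop :=
  exists (Pt : {linear gs s sigma d -> gs s sigma d})
         (T : gs_dual s sigma d -> gs_dual s sigma d),
    [/\ forall f g : gs s sigma d, P f g = distr f (Pt g),
        forall (u : gs_dual s sigma d) (g : gs s sigma d), T u g = u (Pt g),
        forall (f : gs s sigma d) (u : gs_dual s sigma d),
          (forall g : gs s sigma d, u g = distr f g) ->
          forall g : gs s sigma d, T u g = P f g &
        continuous T].

End Operators.
End Integration.

(* Main.v *)
Require Import Defs.
From HB Require Import structures.
From mathcomp Require Import all_boot all_order all_algebra.
From mathcomp Require Import complex.
From mathcomp Require Import all_classical all_reals all_analysis measurable_realfun.
From mathcomp Require Import ring lra zify.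
Set Implicit Arguments.
Unset Strict Implicit.
Unset Printing Implicit Defensive.
Import Order.TTheory GRing.Theory Num.Theory.
Import numFieldNormedType.Exports.
Local Open Scope classical_set_scope.
Local Open Scope ring_scope.

(** The operator and its transpose belong to one family.  For a matrix [B] and a
    sign [eps] let

      T f x = (2 pi)^-d INT_xi INT_z a(x - z B, xi) f(x - eps z) e^(i <z, xi>).

    The form attached to the operator is
    (2 pi)^-d INT_(u, xi) a(u, xi) INT_t g(u + t A^T) f(u + t A^T - t) e^(i <t, xi>).
    Moving the argument of [g] to [x = u + t A^T] shows that it equals the integral
    of [T f] against [g] for [(B, eps) = (A^T, 1)]; moving the argument of [f]
    instead shows that the transpose is [T] for [(B, eps) = (A^T - 1, -1)].  So it
    is enough to study [T] on test functions ([opT_form], [Op_opT],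
    [Op_opT_transpose]), and continuity on the dual follows by transposition
    ([dual_transpose]).

    [T] is estimated on the real pieces [Iint th b x] = INT_xi INT_z
    cos(<z, xi> + th) b(x, xi, z), where the amplitude is
    b = a(x - z B, xi) f(x - eps z).  Both [x - z B] and [z] are controlled by [x]
    and [x - eps z], hence the decay of [f] turns the growth of [a] into a factor
    e^(r |x|^(1/s)) with [r] as small as desired, times integrable decay in [z];
    this is where the quantifier over all [r] in the symbol class is spent
    ([mono_amplitude_admissible]).  Integration by parts in [z] gives decay
    e^(-c |xi|^(1/sigma)) ([Jint_decay]), so the integrals converge absolutely and
    may be differentiated in [x].  Decay in [x] comes from the identity
    x_j = (x_j - eps z_j) + eps z_j: the first term is absorbed by [f], and [z_j] is
    the derivative of the phase in [xi_j], so an integration by parts in [xi] moves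
    it onto the amplitude ([Iint_mulx]).  After [k] steps there are 2^k terms, each
    at most C^k k!^s e^(r |x|^(1/s)): the powers of [x - eps z] by the decay of [f]
    and the [xi]-derivatives by the Gevrey order [s] of [a] in [xi].  Such a bound
    for all [k] is the same as decay e^(-c |x|^(1/s)) ([moment_le],
    [exp_of_moments]), and it beats the small exponential left over.  The hypothesis
    1 <= s + sigma enters when a power y^k is differentiated [m] times, through
    k! / (k - m)! <= 2^k m! <= 2^k m!^sigma m!^s ([gevrey_monomial]).

    All functions under an integral sign are continuous and dominated by multiples
    of the product weight [rho] = PROD_i 1 / (1 + x_i^2), which is preserved by
    slicing and by unit translations up to a constant.  This reduces dominated
    convergence, Fubini, translation invariance and integration by parts for the
    iterated integral to the line. *)

(** * Continuity of elementary maps *)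

Lemma continuous_idfun (T : topologicalType) : continuous (fun x : T => x).
Proof. by move=> x; exact: cvg_id. Qed.

Lemma continuous_fst (S T : topologicalType) : continuous (fun z : S * T => z.1).
Proof. by move=> z; exact: cvg_fst. Qed.

Lemma continuous_snd (S T : topologicalType) : continuous (fun z : S * T => z.2).
Proof. by move=> z; exact: cvg_snd. Qed.

Lemma continuous_compose (S T U : topologicalType) (f : S -> T) (g : T -> U) :
  continuous f -> continuous g -> continuous (fun x => g (f x)).
Proof. by move=> cf cg x; exact: (continuous_comp (cf x) (cg (f x))). Qed.

Lemma continuous_pair (S T U : topologicalType) (f : S -> T) (g : S -> U) :
  continuous f -> continuous g -> continuous (fun x => (f x, g x)).
Proof. by move=> cf cg x; apply: cvg_pair; [exact: cf|exact: cg]. Qed.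

Lemma continuous_slicel (S T U : topologicalType) (F : S * T -> U) s :
  continuous F -> continuous (fun t => F (s, t)).
Proof.
move=> cF; apply: (continuous_compose _ cF); apply: continuous_pair.
  exact: cst_continuous.
exact: continuous_idfun.
Qed.

Lemma continuous_slicer (S T U : topologicalType) (F : S * T -> U) t :
  continuous F -> continuous (fun s => F (s, t)).
Proof.
move=> cF; apply: (continuous_compose _ cF); apply: continuous_pair.
  exact: continuous_idfun.
exact: cst_continuous.
Qed.

Lemma continuous_mul (R : realType) (T : topologicalType) (f g : T -> R) :
  continuous f -> continuous g -> continuous (fun z => f z * g z).
Proof. by move=> cf cg z; exact: (@continuousM R T f g z (cf z) (cg z)). Qed.

Lemma continuous_add (R : realType) (T : topologicalType) (f g : T -> R) :
  continuous f -> continuous g -> continuous (fun z => f z + g z).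
Proof. by move=> cf cg z; exact: (@continuousD R R T f g z (cf z) (cg z)). Qed.

Lemma eq_ler (R : numDomainType) (x y : R) : x = y -> x <= y.
Proof. by move->. Qed.

(** * Integrals on the line dominated by 1 / (1 + t^2) *)

Section OneDim.
Context (R : realType).
Local Notation mu := (@lebesgue_measure R).
Implicit Types (f g : R -> R).

(** Every integral below is dominated by this weight; its shape makes it
    integrable, bounded by 1 and stable under translations. *)
Definition lorentz (t : R) : R := (1 + t ^+ 2)^-1.

Lemma lorentz_gt0 t : 0 < lorentz t.
Proof. by rewrite invr_gt0 ltr_pwDl// sqr_ge0. Qed.

Lemma lorentz_ge0 t : 0 <= lorentz t. Proof. exact: ltW (lorentz_gt0 t). Qed.

Lemma lorentz_le1 t : lorentz t <= 1.
Proof. by rewrite invf_le1 ?ltr_pwDl ?sqr_ge0// lerDl sqr_ge0. Qed.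

Lemma continuous_lorentz : continuous lorentz.
Proof. exact: (@continuous_oneDsqrV R). Qed.

Lemma integral_lorentz : (\int[mu]_t (lorentz t)%:E = (pi)%:E)%E.
Proof.
rewrite ge0_symfun_integralT//=.
- rewrite (_ : [set x | _] = `[0, +oo[%classic); last first.
    by apply/seteqP; split => x/=; rewrite in_itv/= andbT.
  by rewrite (@integral0y_oneDsqr R) -EFinM mulrCA divff// mulr1.
- by move=> x; exact: lorentz_ge0.
- exact: continuous_lorentz.
- by move=> x/=; rewrite /lorentz sqrrN.
Qed.

Lemma integrable_lorentz : mu.-integrable setT (fun t => (lorentz t)%:E).
Proof.
have mw : measurable_fun setT (fun t => (lorentz t)%:E).
  by apply/measurable_EFinP; apply: continuous_measurable_fun; exact: continuous_lorentz.
apply/integrableP; split => //.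
rewrite (_ : (\int[mu]_x _)%E = pi%:E) ?ltry// -integral_lorentz.
by apply: eq_integral => x _ /=; rewrite ger0_norm// lorentz_ge0.
Qed.

Lemma Rintegral_lorentz : \int[mu]_t lorentz t = pi.
Proof. by rewrite /Rintegral integral_lorentz. Qed.

(** Domination by the weight packages integrability, so that no
    measure-theoretic side condition is left in the applications. *)
Definition tame (C : R) f := continuous f /\ forall t, `|f t| <= C * lorentz t.

Lemma integrable_Clorentz (C : R) : mu.-integrable setT (fun t => (C * lorentz t)%:E).
Proof. by have := @integrableZl _ _ R mu setT measurableT C _ integrable_lorentz. Qed.

Lemma tame_integrable C f : tame C f -> mu.-integrable setT (fun t => (f t)%:E).
Proof.
move=> [cf fC]; apply: (le_integrable _ _ _ (integrable_Clorentz C)) => //.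
- by apply/measurable_EFinP; exact: continuous_measurable_fun.
- move=> x _ /=; rewrite lee_fin (le_trans (fC x))//.
  by rewrite ler_norm.
Qed.

Lemma tame_bound C f : tame C f -> `|\int[mu]_t f t| <= C * pi.
Proof.
move=> tf; have intf := tame_integrable tf; case: (tf) => cf fC.
apply: (le_trans (le_normr_Rintegral _ intf)) => //.
rewrite -Rintegral_lorentz -RintegralZl//; last exact: integrable_lorentz.
apply: le_Rintegral => //; first exact: integrable_norm.
by have := @integrableZl _ _ R mu setT measurableT C _ integrable_lorentz.
Qed.

Lemma tame_dct C (F : nat -> R -> R) f :
  (forall k, tame C (F k)) -> continuous f ->
  (forall t, F ^~ t @ \oo --> f t) ->
  (fun k => \int[mu]_t F k t) @ \oo --> \int[mu]_t f t.
Proof.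
move=> tF cf Ff.
have mF k : measurable_fun setT (fun t => (F k t)%:E).
  by apply/measurable_EFinP; apply: continuous_measurable_fun; case: (tF k).
have mf : measurable_fun setT (fun t => (f t)%:E).
  by apply/measurable_EFinP; apply: continuous_measurable_fun.
have FfE : {ae mu, forall t, setT t -> (fun k => (F k t)%:E) @ \oo --> (f t)%:E}.
  apply/aeW => t _; apply/fine_cvgP; split; first exact: nearW.
  exact: Ff.
have FC : {ae mu, forall t k, setT t -> (`|(F k t)%:E| <= (C * lorentz t)%:E)%E}.
  by apply/aeW => t n _ /=; rewrite lee_fin; have [_] := tF n; apply.
have [intf _ h] := @dominated_convergence _ _ R mu setT measurableT _ _ _ mF mf
  FfE (integrable_Clorentz C) FC.
apply: fine_cvg; rewrite fineK; first exact: h.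
exact: integrable_fin_num intf.
Qed.

Lemma tame_lin C D (a b : R) f g : tame C f -> tame D g ->
  \int[mu]_t (a * f t + b * g t) = a * \int[mu]_t f t + b * \int[mu]_t g t.
Proof.
move=> tf tg; have itf := tame_integrable tf; have itg := tame_integrable tg.
rewrite RintegralD//; last 2 first.
- by have := @integrableZl _ _ R mu setT measurableT a _ itf.
- by have := @integrableZl _ _ R mu setT measurableT b _ itg.
by rewrite !RintegralZl.
Qed.

(** Substitution is available for nonnegative integrands only, hence it is
    applied to [f + C lorentz] and to [C lorentz]. *)
Lemma tame_translate C f (c : R) : tame C f ->
  \int[mu]_t f (t + c) = \int[mu]_t f t.
Proof.
move=> tf; have [cf fC] := tf.
have key (G : R -> R) : continuous G -> (forall t, 0 <= G t) ->
    (\int[mu]_t (G t)%:E = \int[mu]_t (G (t + c))%:E)%E.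
  move=> cG G0; pose F (t : R) := t + c.
  have dF : forall x, is_derive x (1 : R) F 1.
    by move=> x; apply: is_derive_eq; rewrite addr0.
  have F' : derive1 F = cst 1.
    by apply/funext => x; rewrite derive1E; have := dF x => /@derive_val ->.
  rewrite (@increasing_ge0_integration_by_substitutionT R F G)//.
  - by apply: eq_integral => x _; rewrite F' /= !fctE mulr1.
  - by move=> x y xy; rewrite ltrD2r.
  - by rewrite F'; exact: cst_continuous.
  - by rewrite F'; exact: is_cvg_cst.
  - by rewrite F'; exact: is_cvg_cst.
  - apply/cvgrNyPle => A; near=> x; rewrite /F -lerBrDr.
    by near: x; apply: nbhs_ninfty_le; rewrite num_real.
  - apply/cvgryPge => A; near=> x; rewrite /F -lerBlDr.
    by near: x; apply: nbhs_pinfty_ge; rewrite num_real.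
have tw : tame C (fun t => C * lorentz t).
  split=> [|t].
    by apply: continuous_mul; [exact: cst_continuous|exact: continuous_lorentz].
  rewrite ger0_norm// mulr_ge0 ?lorentz_ge0//.
  by have := le_trans (normr_ge0 _) (fC t); rewrite pmulr_lge0 ?lorentz_gt0.
have C0 : 0 <= C.
  by have := le_trans (normr_ge0 _) (fC 0); rewrite pmulr_lge0 ?lorentz_gt0.
have [cw wC] := tw.
have Cf0 t : 0 <= 1 * f t + 1 * (C * lorentz t).
  by have := fC t; rewrite ler_norml !mul1r -lerBlDr sub0r => /andP[].
have trc g : continuous g -> continuous (fun t => g (t + c)).
  move=> cg; apply: (continuous_compose _ cg).
  by apply: continuous_add; [exact: continuous_idfun|exact: cst_continuous].
have cCf : continuous (fun t => 1 * f t + 1 * (C * lorentz t)).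
  move=> t; under [X in continuous_at _ X]eq_fun do rewrite !mul1r.
  by apply: (@continuousD R _ _ f (fun t => C * lorentz t)); [exact: cf|exact: cw].
have := key _ cCf Cf0; have := key _ cw (fun t => mulr_ge0 C0 (lorentz_ge0 t)).
move=> /(congr1 fine) e1 /(congr1 fine) e2.
have itwc : mu.-integrable setT (fun t => (C * lorentz (t + c))%:E).
  have /integrableP[_ fin] := tame_integrable tw.
  have m1 : measurable_fun setT (fun t : R => (C * lorentz (t + c))%:E).
    by apply/measurable_EFinP; apply: continuous_measurable_fun; exact: (trc _ cw).
  apply/integrableP; split=> //.
  under eq_integral do rewrite gee0_abs ?lee_fin ?mulr_ge0 ?lorentz_ge0//.
  rewrite -(key _ cw) => [|t]; last by rewrite mulr_ge0 ?lorentz_ge0.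
  by under eq_integral do rewrite -[_%:E]gee0_abs ?lee_fin ?mulr_ge0 ?lorentz_ge0//.
have itfc : mu.-integrable setT (fun t => (f (t + c))%:E).
  apply: (le_integrable _ _ _ itwc) => //.
  - by apply/measurable_EFinP; apply: continuous_measurable_fun; exact: (trc _ cf).
  - move=> t _ /=; rewrite lee_fin (le_trans (fC _))//.
    by rewrite ler_norm.
have e3 : \int[mu]_t (1 * f t + 1 * (C * lorentz t)) =
          \int[mu]_t (1 * f (t + c) + 1 * (C * lorentz (t + c))) by exact: e2.
have e4 : \int[mu]_t (C * lorentz t) = \int[mu]_t (C * lorentz (t + c)) by exact: e1.
move: e3; rewrite (tame_lin _ _ tf tw) !mul1r e4 => e3; apply: esym; apply: (@addIr _ (\int[mu]_t (C * lorentz (t + c)))).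
rewrite e3.
have -> : \int[mu]_t (1 * f (t + c) + 1 * (C * lorentz (t + c))) =
          \int[mu]_t (f (t + c) + C * lorentz (t + c)).
  by apply: eq_Rintegral => t _; rewrite !mul1r.
by rewrite RintegralD.
Unshelve. all: end_near. Qed.

(** An open set of the plane is a countable union of products of balls with
    rational centres, hence measurable for the product sigma-algebra. *)
Lemma open_measurable2 (U : set (R * R)) : open U -> measurable U.
Proof.
move=> oU.
pose B (q : rat * rat * nat) : set (R * R) :=
  ball (ratr q.1.1 : R) (q.2.+1%:R^-1) `*` ball (ratr q.1.2 : R) (q.2.+1%:R^-1).
have -> : U = \bigcup_(q in [set q | B q `<=` U]) B q.
  apply/seteqP; split=> [[x y] Uxy|p [q qU]]; last exact: qU.
  have : nbhs (x, y) U by exact: open_nbhs_nbhs.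
  move=> /nbhs_ballP[e /= e0 eU].
  have e20 : 0 < e / 2 by rewrite divr_gt0.
  have [n] := ltr_add_invr e20; rewrite add0r => n1.
  have n0 : 0 < n.+1%:R^-1 :> R by rewrite invr_gt0.
  have rex (z : R) : exists q : rat, ball (ratr q : R) (n.+1%:R^-1) z.
    have [||r [zr [q _ qr]]] := @dense_rat R (ball z (n.+1%:R^-1)).
    - by exists z; exact: ballxx.
    - exact: ball_open.
    - by exists q; rewrite qr; exact: ball_sym.
  have [q1 xq1] := rex x; have [q2 yq2] := rex y.
  have tri (z w r : R) : ball r (n.+1%:R^-1) z -> ball r (n.+1%:R^-1) w -> ball z e w.
    move=> zr wr; have : ball z (n.+1%:R^-1 + n.+1%:R^-1) w.
      by apply: ball_triangle wr; exact: ball_sym.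
    by apply: le_ball; rewrite (splitr e) lerD// ltW.
  exists (q1, q2, n) => //= -[u v] [/= uq vq]; apply: eU.
  by split => /=; [exact: tri xq1 uq|exact: tri yq2 vq].
rewrite bigcup_mkcond; apply: countable_bigcupT_measurable => // q.
case: ifP => _ //; apply: measurableX; apply: open_measurable; exact: ball_open.
Qed.

Lemma continuous_measurable2 (F : R * R -> R) : continuous F ->
  measurable_fun setT F.
Proof.
move=> /continuousP cF; apply: (measurability _ (RGenOpens.measurableE R)).
move=> _ [_ [a [b ->] <-]]; rewrite setTI; apply: open_measurable2.
by apply: cF; exact: interval_open.
Qed.

(** Joint continuity supplies joint measurability, and the product bound
    supplies integrability. *)
Lemma tame_fubini C (F : R * R -> R) : continuous F ->
  (forall t u, `|F (t, u)| <= C * lorentz t * lorentz u) ->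
  \int[mu]_t \int[mu]_u F (t, u) = \int[mu]_u \int[mu]_t F (t, u).
Proof.
move=> cF FC.
have t1 t : tame (C * lorentz t) (fun u => F (t, u)).
  by split=> [|u]; [exact: continuous_slicel|exact: FC].
have t2 u : tame (C * lorentz u) (fun t => F (t, u)).
  by split=> [|t]; [exact: continuous_slicer|rewrite mulrAC].
have mF : measurable_fun setT (fun p : R * R => (F p)%:E).
  by apply/measurable_EFinP; exact: continuous_measurable2.
have e1 t : (\int[mu]_u (F (t, u))%:E)%E = (\int[mu]_u F (t, u))%:E.
  by rewrite fineK//; apply: (integrable_fin_num _ (tame_integrable (t1 t))).
have e2 u : (\int[mu]_t (F (t, u))%:E)%E = (\int[mu]_t F (t, u))%:E.
  by rewrite fineK//; apply: (integrable_fin_num _ (tame_integrable (t2 u))).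
rewrite /Rintegral; congr fine.
under eq_integral do rewrite -e1.
under [RHS]eq_integral do rewrite -e2.
apply: (@Fubini _ _ _ _ R mu mu (fun p => (F p)%:E)).
apply/integrable12ltyP => //.
apply: (@le_lt_trans _ _ (\int[mu]_t (C * pi * lorentz t)%:E)%E); last first.
  have /integrableP[_] := integrable_Clorentz (C * pi).
  apply: le_lt_trans; apply: ge0_le_integral => //.
  - move=> t _; rewrite lee_fin.
    have := le_trans (normr_ge0 _) (FC t t); rewrite pmulr_lge0 ?lorentz_gt0// pmulr_lge0 ?lorentz_gt0// => C0.
    by rewrite !mulr_ge0 ?pi_ge0 ?lorentz_ge0.
  - by have /integrableP[] := integrable_Clorentz (C * pi).
  - by apply: measurableT_comp => //; have /integrableP[] := integrable_Clorentz (C * pi).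
  - by move=> t _; rewrite lee_fin /= ler_norm.
apply: ge0_le_integral => //.
- by move=> t _; apply: integral_ge0 => u _; rewrite abse_ge0.
- apply: (@measurable_fun_fubini_tonelli_F _ _ _ _ R mu (fun p => `|(F p)%:E|%E)) => //.
  exact: measurableT_comp.
- by have /integrableP[] := integrable_Clorentz (C * pi).
move=> t _; have tn : tame (C * lorentz t) (fun u => `|F (t, u)|).
  have [ct Ct] := t1 t; split=> [|u]; last by rewrite normr_id.
  exact: (continuous_compose ct (@norm_continuous R R)).
rewrite (_ : (\int[mu]_u _)%E = (\int[mu]_u `|F (t, u)|)%:E); last first.
  by rewrite fineK//; apply: (integrable_fin_num _ (tame_integrable tn)).
rewrite lee_fin; have := tame_bound tn; rewrite ger0_norm; first by rewrite mulrAC.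
by apply: Rintegral_ge0.
Qed.
End OneDim.

(** * Sequential limits *)

Section Sequential.
Context (R : realType).

(** Reduces limits along a filter to sequences, which is what dominated
    convergence speaks about. *)
Lemma seq_cvg (T : pseudoMetricType R) (f : T -> R) (p : T) (l : R) :
  (forall u : nat -> T, u @ \oo --> p -> (fun k => f (u k)) @ \oo --> l) ->
  f x @[x --> p] --> l.
Proof.
move=> H; apply: contrapT => fpl; move: H; apply/existsNP.
suff: exists2 u : nat -> T, u @ \oo --> p & ~ (fun k => f (u k)) @ \oo --> l.
  by move=> [u up ful]; exists u; exact/not_implyP.
have [e e0 He] : exists2 e : R, 0 < e & forall k : nat, exists x, ball p (k.+1%:R^-1) x /\ e <= `|l - f x|.
  apply: contrapT => /forall2NP h; apply: fpl; apply/cvgrPdist_lt => e e0.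
  have [//|/existsNP[k /forallNP hk]] := h e.
  apply/nbhs_ballP; exists k.+1%:R^-1; first by rewrite /= invr_gt0.
  by move=> x px; have /not_andP[//|/negP] := hk x; rewrite -ltNge.
exists (fun k => sval (cid (He k))).
  apply/cvg_ballP => r r0; have [N] := ltr_add_invr r0; rewrite add0r => Nr.
  exists N => // k /= Nk; case: cid => x [/= px _].
  apply: le_ball px; apply: le_trans (ltW Nr).
  by rewrite lef_pV2 ?posrE// ler_nat.
move=> /cvgrPdist_lt/(_ e e0)[N _ /(_ N (leqnn _))].
by rewrite /=; case: cid => x [/= _]; rewrite leNgt => /negP.
Qed.

(** The norm of a row vector is a maximum over finitely many coordinates. *)
Lemma continuous_rV (T : topologicalType) n (f : T -> 'rV[R]_n) :
  (forall i, continuous (fun p => f p 0 i)) -> continuous f.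
Proof.
move=> cf p; apply/cvg_ballP => e e0.
have : \forall q \near p, forall i : 'I_n, ball (f p 0 i) e (f q 0 i).
  apply: filter_forall => i.
  by have /cvg_ballP/(_ _ e0) := cf i p.
apply: filterS => q H; split => // i j.
by rewrite (ord1 i).
Qed.

End Sequential.

(** * Iterated integrals dominated by the product weight *)

Section IteratedIntegral.
Context (R : realType).
Local Notation mu := (@lebesgue_measure R).

(** A product weight rather than a power of a norm: it restricts to slices and
    splits over [row_mx], so that inductions on the dimension go through. *)
Definition rho n (x : 'rV[R]_n) : R := \prod_i lorentz (x 0 i).

Definition cons_rv n (t : R) (y : 'rV[R]_n) : 'rV[R]_n.+1 :=
  row_mx (const_mx t : 'rV[R]_1) y.

Lemma rintS n (F : 'rV[R]_n.+1 -> R) :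
  rint F = \int[mu]_t rint (fun y => F (cons_rv t y)).
Proof. by []. Qed.

Lemma rho_gt0 n (x : 'rV[R]_n) : 0 < rho x.
Proof. by apply: prodr_gt0 => i _; exact: lorentz_gt0. Qed.

Lemma rho_ge0 n (x : 'rV[R]_n) : 0 <= rho x.
Proof. exact: ltW (rho_gt0 x). Qed.

Lemma rho_row_mx m n (x : 'rV[R]_m) (y : 'rV[R]_n) :
  rho (row_mx x y) = rho x * rho y.
Proof.
rewrite /rho big_split_ord /=.
by congr (_ * _); apply: eq_bigr => i _; rewrite (row_mxEl, row_mxEr).
Qed.

Lemma rho_cons n t (y : 'rV[R]_n) : rho (cons_rv t y) = lorentz t * rho y.
Proof.
apply: (etrans (rho_row_mx (const_mx t : 'rV[R]_1) y)).
by rewrite {1}/rho big_ord1 mxE.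
Qed.

Lemma continuous_row_mx (T : topologicalType) m n (f : T -> 'rV[R]_m) (g : T -> 'rV[R]_n) :
  continuous f -> continuous g -> continuous (fun p => row_mx (f p) (g p)).
Proof.
move=> cf cg; apply: continuous_rV => i.
case: (split_ordP i) => j ->.
  have -> : (fun p => row_mx (f p) (g p) 0 (lshift n j)) = (fun p => f p 0 j).
    by apply/funext => q; rewrite row_mxEl.
  exact: (continuous_compose cf (@coord_continuous _ _ _ 0 j)).
have -> : (fun p => row_mx (f p) (g p) 0 (rshift m j)) = (fun p => g p 0 j).
  by apply/funext => q; rewrite row_mxEr.
exact: (continuous_compose cg (@coord_continuous _ _ _ 0 j)).
Qed.

Lemma continuous_cons_rv (T : topologicalType) n (f : T -> R) (g : T -> 'rV[R]_n) :
  continuous f -> continuous g -> continuous (fun p => cons_rv (f p) (g p)).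
Proof.
move=> cf cg; apply: (@continuous_row_mx T 1 n (fun p => const_mx (f p)) g) => //.
apply: continuous_rV => i.
by have -> : (fun p => (const_mx (f p) : 'rV[R]_1) 0 i) = f by apply/funext => q; rewrite mxE.
Qed.

Definition dom n (C : R) (F : 'rV[R]_n -> R) :=
  continuous F /\ forall x, `|F x| <= C * rho x.

Lemma dom_ge0 n C (F : 'rV[R]_n -> R) : dom C F -> 0 <= C.
Proof.
by move=> [_ FC]; have := le_trans (normr_ge0 _) (FC 0); rewrite pmulr_lge0 ?rho_gt0.
Qed.

Lemma dom_le n C D (F : 'rV[R]_n -> R) : C <= D -> dom C F -> dom D F.
Proof.
move=> CD [cF FC]; split=> // x; apply: le_trans (FC x) _.
by rewrite ler_wpM2r ?rho_ge0.
Qed.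

Lemma dom_cons n C (F : 'rV[R]_n.+1 -> R) t : dom C F ->
  dom (C * lorentz t) (fun y => F (cons_rv t y)).
Proof.
move=> [cF FC]; split=> [|y].
  apply: (continuous_compose _ cF).
  by apply: continuous_cons_rv; [exact: cst_continuous|exact: continuous_idfun].
by rewrite -mulrA -rho_cons.
Qed.

Lemma dom_cons_le n C (F : 'rV[R]_n.+1 -> R) t : dom C F ->
  dom C (fun y => F (cons_rv t y)).
Proof.
move=> tF; apply: dom_le (dom_cons t tF).
by rewrite ler_piMr ?lorentz_le1// (dom_ge0 tF).
Qed.

Let dctP n := forall C (F : nat -> 'rV[R]_n -> R) f,
  (forall k, dom C (F k)) -> continuous f -> (forall y, F ^~ y @ \oo --> f y) ->
  (fun k => rint (F k)) @ \oo --> rint f.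
Let bndP n := forall C (F : 'rV[R]_n -> R), dom C F -> `|rint F| <= C * pi ^+ n.

Let tame_slice_aux n C (F : 'rV[R]_n.+1 -> R) : dctP n -> bndP n -> dom C F ->
  tame (C * pi ^+ n) (fun t => rint (fun y => F (cons_rv t y))).
Proof.
move=> dct bnd dF; split=> [t|t]; last first.
  by have := bnd _ _ (dom_cons t dF); rewrite mulrAC.
apply: seq_cvg => u ut; apply: (dct C) => [k||y].
- exact: dom_cons_le.
- by case: (dom_cons_le t dF).
have [cF _] := dF.
have cFy : continuous (fun t => F (cons_rv t y)).
  apply: (continuous_compose _ cF).
  by apply: continuous_cons_rv; [exact: continuous_idfun|exact: cst_continuous].
exact: (cvg_comp u (fun t => F (cons_rv t y)) ut (cFy t)).
Qed.

(** Dominated convergence and the bound by [C pi^n] are proved together by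
    induction on the dimension: the bound keeps the slices tame, and convergence
    keeps them continuous. *)
Let dct_bnd n : dctP n /\ bndP n.
Proof.
elim: n => [|n [dct bnd]].
  split=> [C F f _ _|C F [_]]; first by apply.
  by move=> /(_ 0); rewrite /rho big_ord0 expr0.
split=> [C F f dF cf Ff|C F dF]; last first.
  rewrite rintS exprSr mulrA; apply: tame_bound; exact: tame_slice_aux.
have df : dom C f.
  split=> // x; rewrite leNgt; apply/negP => lt.
  have [N _ /(_ N (leqnn _))] := cvgr_gt _ (cvg_norm (Ff x)) _ lt.
  by rewrite ltNge; have [_ ->] := dF N.
rewrite rintS; apply: (tame_dct (C := C * pi ^+ n)) => [k||t].
- exact: tame_slice_aux.
- by have [] := tame_slice_aux dct bnd df.
apply: (dct C) => [k||y]; [exact: dom_cons_le| |exact: Ff].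
by have [] := dom_cons_le t df.
Qed.

Lemma rint_dct n C (F : nat -> 'rV[R]_n -> R) f :
  (forall k, dom C (F k)) -> continuous f -> (forall y, F ^~ y @ \oo --> f y) ->
  (fun k => rint (F k)) @ \oo --> rint f.
Proof. exact: (dct_bnd n).1. Qed.

Lemma rint_bound n C (F : 'rV[R]_n -> R) : dom C F -> `|rint F| <= C * pi ^+ n.
Proof. exact: (dct_bnd n).2. Qed.

Lemma tame_slice n C (F : 'rV[R]_n.+1 -> R) : dom C F ->
  tame (C * pi ^+ n) (fun t => rint (fun y => F (cons_rv t y))).
Proof. exact: tame_slice_aux (dct_bnd n).1 (dct_bnd n).2. Qed.

Lemma eq_rint n (F G : 'rV[R]_n -> R) : F =1 G -> rint F = rint G.
Proof. by move=> /funext ->. Qed.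

Lemma rint_lin n C D (a b : R) (F G : 'rV[R]_n -> R) : dom C F -> dom D G ->
  rint (fun y => a * F y + b * G y) = a * rint F + b * rint G.
Proof.
elim: n C D F G => [//|n IH] C D F G dF dG.
rewrite !rintS -(tame_lin a b (tame_slice dF) (tame_slice dG)).
apply: eq_Rintegral => t _; exact: (IH _ _ _ _ (dom_cons_le t dF) (dom_cons_le t dG)).
Qed.

Lemma dom_lin n C D (a b : R) (F G : 'rV[R]_n -> R) : dom C F -> dom D G ->
  dom (`|a| * C + `|b| * D) (fun y => a * F y + b * G y).
Proof.
move=> [cF FC] [cG GD]; split=> [|y].
  by apply: continuous_add; apply: continuous_mul => //; exact: cst_continuous.
rewrite mulrDl; apply: (le_trans (ler_normD _ _)).
by rewrite !normrM lerD// -mulrA ler_wpM2l.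
Qed.

Lemma rintZ n C (a : R) (F : 'rV[R]_n -> R) : dom C F ->
  rint (fun y => a * F y) = a * rint F.
Proof.
move=> dF; have := rint_lin a 0 dF dF; rewrite mul0r addr0 => <-.
by apply: eq_rint => y; rewrite mul0r addr0.
Qed.

Lemma row_mx_cons m n t (x : 'rV[R]_m) (y : 'rV[R]_n) :
  row_mx (cons_rv t x) y = cons_rv t (row_mx x y) :> 'rV[R]_(m + n).+1.
Proof.
have E : row_mx (const_mx t) (row_mx x y) = castmx (erefl, esym (addnA 1 m n))
  (row_mx (row_mx (const_mx t : 'M[R]_(1, 1)) x) y) by exact: row_mxA.
by rewrite (eq_irrelevance (esym (addnA 1 m n)) erefl) castmx_id in E.
Qed.

(** The recursion of [rint] peels off coordinates one by one, so grouping them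
    into two blocks is associativity of [row_mx]. *)
Lemma rint_row_mx m n (F : 'rV[R]_(m + n) -> R) :
  rint F = rint (fun x : 'rV[R]_m => rint (fun y : 'rV[R]_n => F (row_mx x y))).
Proof.
elim: m F => [|m IH] F.
  apply: (eq_rint (n := n)) => y; congr F.
  by apply/rowP => i; rewrite -[in RHS](_ : rshift 0 i = i) ?row_mxEr//; exact/val_inj.
rewrite [LHS](@rintS (m + n)) [RHS]rintS; apply: eq_Rintegral => t _.
rewrite IH; apply: eq_rint => x; apply: eq_rint => y.
by rewrite row_mx_cons.
Qed.

(** Dominated convergence along sequences of parameters. *)
Lemma rint_continuous (T : pseudoMetricType R) n (F : T -> 'rV[R]_n -> R) (p : T) C :
  (\forall q \near p, dom C (F q)) -> (forall y, F ^~ y @ p --> F p y) ->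
  rint (F q) @[q --> p] --> rint (F p).
Proof.
move=> dF Fp; apply: seq_cvg => u up.
have [N _ uN] := up _ dF.
rewrite -(cvg_shiftn N); apply: (rint_dct (C := C)) => [k||y].
- by apply: uN => /=; exact: leq_addl.
- by have [] := nbhs_singleton dF.
- rewrite (cvg_shiftn N (fun k => F (u k) y)).
  exact: (cvg_comp u (fun q => F q y) up (Fp y)).
Qed.

Lemma rint_continuousT (T : pseudoMetricType R) n (F : T -> 'rV[R]_n -> R) C :
  (forall q, dom C (F q)) -> (forall y, continuous (F ^~ y)) ->
  continuous (fun q => rint (F q)).
Proof.
move=> dF cF p; apply: (@rint_continuous _ _ _ _ C) => [|y]; last exact: cF.
exact: nearW.
Qed.

(** Moves one real variable past the [n] variables of an iterated integral, one
    planar Fubini step at a time. *)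
Lemma rint_swap1 n C (F : R * 'rV[R]_n -> R) : continuous F ->
  (forall t y, `|F (t, y)| <= C * lorentz t * rho y) ->
  \int[mu]_t rint (fun y => F (t, y)) = rint (fun y => \int[mu]_t F (t, y)).
Proof.
elim: n F => [//|n IH] F cF FC.
have C0 : 0 <= C.
  have := le_trans (normr_ge0 _) (FC 0 0).
  by rewrite pmulr_lge0 ?rho_gt0// pmulr_lge0 ?lorentz_gt0.
have dF t : dom (C * lorentz t) (fun y => F (t, y)).
  by split=> [|y]; [exact: continuous_slicel|exact: FC].
pose G (p : R * R) := rint (fun y => F (p.1, cons_rv p.2 y)).
have cG : continuous G.
  apply: (@rint_continuousT _ _ (fun (p : R * R) y => F (p.1, cons_rv p.2 y)) C) => [q|y].
    apply: dom_le (dom_cons_le q.2 (dF q.1)).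
    by rewrite ler_piMr ?lorentz_le1.
  apply: (continuous_compose _ cF); apply: continuous_pair; first exact: continuous_fst.
  by apply: continuous_cons_rv; [exact: continuous_snd|exact: cst_continuous].
have GC t u : `|G (t, u)| <= C * pi ^+ n * lorentz t * lorentz u.
  apply: (le_trans (rint_bound (dom_cons u (dF t)))).
  by apply: eq_ler; ring.
rewrite rintS; transitivity (\int[mu]_t \int[mu]_u G (t, u)); first by [].
rewrite (tame_fubini cG GC); apply: eq_Rintegral => u _.
rewrite -(IH (fun p => F (p.1, cons_rv u p.2)))//.
  apply: (continuous_compose _ cF); apply: continuous_pair; first exact: continuous_fst.
  by apply: continuous_cons_rv; [exact: cst_continuous|exact: continuous_snd].
move=> t y /=; apply: le_trans (FC _ _) _; rewrite ler_wpM2l ?mulr_ge0 ?lorentz_ge0//.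
by rewrite rho_cons ler_piMl ?rho_ge0 ?lorentz_le1.
Qed.

(** Fubini for two blocks of variables, by induction on the size of the first
    one. *)
Lemma rint_swap m n C (F : 'rV[R]_m * 'rV[R]_n -> R) : continuous F ->
  (forall x y, `|F (x, y)| <= C * rho x * rho y) ->
  rint (fun x => rint (fun y => F (x, y))) = rint (fun y => rint (fun x => F (x, y))).
Proof.
elim: m F => [//|m IH] F cF FC.
have C0 : 0 <= C.
  have := le_trans (normr_ge0 _) (FC 0 0).
  by rewrite pmulr_lge0 ?rho_gt0// pmulr_lge0 ?rho_gt0.
have dF y : dom (C * rho y) (fun x => F (x, y)).
  by split=> [|x]; [exact: continuous_slicer|rewrite mulrAC].
have r1 k (y : 'rV[R]_k) : rho y <= 1.
  by apply: prodr_ile1 => i _; rewrite lorentz_ge0 lorentz_le1.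
pose G (p : R * 'rV[R]_n) := rint (fun x => F (cons_rv p.1 x, p.2)).
have cG : continuous G.
  apply: (@rint_continuousT _ _ (fun (p : R * 'rV[R]_n) x => F (cons_rv p.1 x, p.2)) C) => [q|x].
    apply: dom_le (dom_cons_le q.1 (dF q.2)).
    by rewrite ler_piMr ?r1.
  apply: (continuous_compose _ cF); apply: continuous_pair; last exact: continuous_snd.
  by apply: continuous_cons_rv; [exact: continuous_fst|exact: cst_continuous].
have GC t y : `|G (t, y)| <= C * pi ^+ m * lorentz t * rho y.
  apply: (le_trans (rint_bound (dom_cons t (dF y)))).
  by apply: eq_ler; ring.
rewrite rintS -[RHS](rint_swap1 cG GC); apply: eq_Rintegral => t _.
rewrite (IH (fun p => F (cons_rv t p.1, p.2)))//.
  apply: (continuous_compose _ cF); apply: continuous_pair; last exact: continuous_snd.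
  by apply: continuous_cons_rv; [exact: cst_continuous|exact: continuous_fst].
move=> x y /=; apply: le_trans (FC _ _) _; rewrite ler_wpM2r ?rho_ge0// ler_wpM2l//.
by rewrite rho_cons ler_piMl ?rho_ge0 ?lorentz_le1.
Qed.

Lemma cons_rvD n t u (x y : 'rV[R]_n) :
  cons_rv (t + u) (x + y) = cons_rv t x + cons_rv u y.
Proof.
apply: (etrans _ (esym (add_row_mx (const_mx t : 'M[R]_(1, 1)) _ _ _))).
congr (row_mx _ _); by apply/rowP => i; rewrite !mxE.
Qed.

Lemma cons_rv_surj n (v : 'rV[R]_n.+1) : exists t y, v = cons_rv t y.
Proof.
exists ((lsubmx (v : 'rV_(1 + n)) : 'rV_1) 0 0), (rsubmx (v : 'rV_(1 + n))).
apply: (etrans (esym (@hsubmxK R 1 1 n v))); congr (row_mx _ _).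
by apply/rowP => i; rewrite (ord1 i) [RHS]mxE.
Qed.

(** Translation invariance of each one-dimensional integral. *)
Lemma rint_translate n C (F : 'rV[R]_n -> R) v : dom C F ->
  rint (fun y => F (y + v)) = rint F.
Proof.
elim: n C F v => [|n IH] C F v dF; first by congr F; apply/rowP => -[].
have [c [w ->]] := cons_rv_surj v.
rewrite !rintS -[RHS](tame_translate c (tame_slice dF)).
apply: eq_Rintegral => t _; rewrite -(IH _ _ w (dom_cons_le (t + c) dF)).
by apply: eq_rint => y; rewrite -cons_rvD.
Qed.

(** The mean value theorem from the base point 0 without a case distinction on
    the sign of [t]. *)
Lemma mvt0 (f df : R -> R) t : (forall h, is_derive h (1 : R) f (df h)) ->
  exists2 c, `|c| <= `|t| & f t - f 0 = df c * t.
Proof.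
move=> dfd.
have cf : continuous f.
  move=> x; apply/differentiable_continuous/derivable1_diffP.
  by have [] := dfd x.
have [t0|t0] := leP 0 t.
  have [c] := MVT_segment t0 (fun x _ => dfd x) (continuous_subspaceT cf).
  by rewrite in_itv/= subr0 => /andP[c0 ct] ->; exists c; rewrite ?ger0_norm.
have [c] := MVT_segment (ltW t0) (fun x _ => dfd x) (continuous_subspaceT cf).
rewrite in_itv/= sub0r => /andP[tc c0] e; exists c; last by rewrite -opprB e mulrN opprK.
by rewrite !ler0_norm ?(ltW t0)// lerN2.
Qed.

(** Difference quotients are dominated by the derivative at an intermediate
    point, so dominated convergence applies along every sequence. *)
Lemma rint_derive n (F F' : R -> 'rV[R]_n -> R) C D :
  (forall h y, is_derive h (1 : R) (F ^~ y) (F' h y)) ->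
  (forall h, `|h| <= 1 -> dom C (F h)) ->
  (forall h, `|h| <= 1 -> dom D (F' h)) ->
  is_derive 0 (1 : R) (fun h => rint (F h)) (rint (F' 0)).
Proof.
move=> dF cF cF'.
have n01 : `|0 : R| <= 1 by rewrite normr0.
suff h : (fun h : R => h^-1 *: (rint (F (h *: (1 : R) + 0)) - rint (F 0))) @ 0^' --> rint (F' 0).
  by apply: DeriveDef; [apply/cvg_ex; exists (rint (F' 0))|exact/cvg_lim].
apply/cvgr_dnbhsP => t [t0 tc].
have [N _ tN] := cvgr0_norm_le _ tc _ ltr01.
rewrite -(cvg_shiftn N).
have -> : (fun k => (t (k + N)%N)^-1 *: (rint (F (t (k + N)%N *: 1 + 0)) - rint (F 0))) =
  (fun k => rint (fun y => (t (k + N)%N)^-1 * F (t (k + N)%N) y + (- (t (k + N)%N)^-1) * F 0 y)).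
  apply/funext => k; rewrite (rint_lin _ _ (cF _ (tN _ _)) (cF _ n01)) /=; last exact: leq_addl.
  by rewrite scaler1 addr0 mulNr -mulrBr.
apply: (rint_dct (C := D)) => [k||y].
- have tk : `|t (k + N)%N| <= 1 by apply: tN => /=; exact: leq_addl.
  split; first by have [] := dom_lin (t (k + N)%N)^-1 (- (t (k + N)%N)^-1) (cF _ tk) (cF _ n01).
  move=> y; have [c ct e] := mvt0 (t (k + N)%N) (dF ^~ y).
  rewrite mulNr -mulrBr e mulrCA mulVf// mulr1.
  by have [_] := cF' _ (le_trans ct tk); apply.
- by have [] := cF' _ n01.
- have [/cvg_ex[l /= lF] dl] := dF 0 y.
  have ll : F' 0 y = l by rewrite -dl; exact/cvg_lim.
  rewrite ll.
  move/cvgr_dnbhsP: lF => /(_ (fun k => t (k + N)%N)).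
  rewrite (cvg_shiftn N t) => /(_ (conj (fun k => t0 _) tc)).
  have -> : (fun k => (t (k + N)%N)^-1 * F (t (k + N)%N) y + - (t (k + N)%N)^-1 * F 0 y) =
    (fun k => (t (k + N)%N)^-1 *: (F (t (k + N)%N *: 1 + 0) y - F 0 y)).
    by apply/funext => k; rewrite scaler1 addr0 mulNr -mulrBr.
  by [].
Qed.

Lemma lorentz_translate (t h : R) : `|h| <= 1 -> lorentz (t + h) <= 3 * lorentz t.
Proof.
move=> h1; rewrite /lorentz ler_pdivlMr ?ltr_pwDl ?sqr_ge0// ler_pdivrMl ?ltr_pwDl ?sqr_ge0//.
have : h ^+ 2 <= 1 by rewrite -real_normK ?num_real// exprn_ile1.
by have := sqr_ge0 (t + 2 * h); nra.
Qed.

(** Unit translations cost a constant factor only; this keeps the difference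
    quotients of [rint_partial] dominated. *)
Lemma rho_translate n (y : 'rV[R]_n) j (h : R) : `|h| <= 1 ->
  rho (y + h *: delta_mx 0 j) <= 3 * rho y.
Proof.
move=> h1; rewrite /rho (bigD1 j)//= [in leRHS](bigD1 j)//= mulrA.
rewrite (eq_bigr (fun i => lorentz (y 0 i))).
  rewrite ler_wpM2r ?prodr_ge0// => [i _|]; first exact: lorentz_ge0.
  by rewrite !mxE !eqxx mulr1; exact: lorentz_translate.
by move=> i ij; rewrite !mxE (negbTE ij) andbF mulr0 addr0.
Qed.

Lemma is_derive_line n (G : 'rV[R]_n -> R) (v y : 'rV[R]_n) (h : R) :
  (forall x, derivable G x v) ->
  is_derive h (1 : R) (fun h => G (y + h *: v)) ('D_v G (y + h *: v)).
Proof.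
move=> der.
have e : (fun k : R => k^-1 *: (G (y + (k *: (1 : R) + h) *: v) - G (y + h *: v))) =
  (fun k : R => k^-1 *: (G (k *: v + (y + h *: v)) - G (y + h *: v))).
  by apply/funext => k; rewrite scaler1 scalerDl addrCA.
have := der (y + h *: v); rewrite /derivable -e => c.
by apply: DeriveDef => //; rewrite /derive -e.
Qed.

(** The integral of a translate does not depend on the translation;
    differentiating under the integral sign gives the claim.  This is
    integration by parts without boundary terms. *)
Lemma rint_partial n C D (G : 'rV[R]_n -> R) j : dom C G -> dom D (partial j G) ->
  (forall x, derivable G x (delta_mx 0 j : 'rV[R]_n)) -> rint (partial j G) = 0.
Proof.
move=> dG dG' der; pose F h (y : 'rV[R]_n) := G (y + h *: delta_mx 0 j).
pose F' h (y : 'rV[R]_n) := partial j G (y + h *: delta_mx 0 j).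
have dF h y : is_derive h (1 : R) (F ^~ y) (F' h y).
  exact: is_derive_line.
have dom_tr H E h : `|h| <= 1 -> dom E H -> dom (3 * E) (fun y : 'rV[R]_n => H (y + h *: delta_mx 0 j)).
  move=> h1 dH; have [cH HE] := dH; split=> [|y].
    apply: (continuous_compose _ cH) => y.
    by apply: (@continuousD R _ _ id (fun=> _)); [exact: continuous_idfun|exact: cst_continuous].
  apply: (le_trans (HE _)); rewrite mulrAC [leRHS]mulrC.
  by rewrite ler_wpM2l ?(dom_ge0 dH)// rho_translate.
have := @rint_derive n F F' _ _ dF (fun h h1 => dom_tr G C h h1 dG)
  (fun h h1 => dom_tr _ D h h1 dG').
have -> : (fun h => rint (F h)) = cst (rint G).
  by apply/funext => h; rewrite /F (rint_translate _ dG).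
move=> /@derive_val; rewrite derive_cst => e.
by rewrite [RHS]e; apply/esym; exact: rint_translate dG'.
Qed.
End IteratedIntegral.

(** * Calculus of iterated partial derivatives *)

Section SmoothCalculus.
Context (R : realType).
Local Notation ee n i := (delta_mx 0 i : 'rV[R]_n).

Lemma partial_of_is_derive n (f : 'rV[R]_n -> R) i x df :
  is_derive x (ee n i) f df -> partial i f x = df.
Proof. by move=> h; rewrite /partial derive_val. Qed.

Lemma partials_cat n (f : 'rV[R]_n -> R) l l' :
  partials (l ++ l') f = partials l (partials l' f).
Proof. by rewrite /partials foldr_cat. Qed.

Lemma rsmooth_partials n (f : 'rV[R]_n -> R) l : rsmooth f -> rsmooth (partials l f).
Proof. by move=> sf l'; rewrite -partials_cat; exact: sf. Qed.

Lemma rsmooth_partial n (f : 'rV[R]_n -> R) i : rsmooth f -> rsmooth (partial i f).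
Proof. by move=> sf; exact: (rsmooth_partials [:: i]). Qed.

Lemma rsmooth_continuous n (f : 'rV[R]_n -> R) : rsmooth f -> continuous f.
Proof. by move=> /(_ [::])[]. Qed.

Lemma rsmooth_derivable n (f : 'rV[R]_n -> R) x i : rsmooth f -> derivable f x (ee n i).
Proof. by move=> /(_ [::])[_]; apply. Qed.

Lemma partials_cst n (c : R) i l : partials (i :: l) (fun _ : 'rV[R]_n => c) = fun=> 0.
Proof.
apply/funext => x; elim: l i x => [|j l IH] i x; first exact: derive_cst.
rewrite [LHS]/= (_ : partial j _ = fun=> 0); first exact: derive_cst.
by apply/funext => y; exact: IH.
Qed.

Lemma rsmooth_cst n (c : R) : rsmooth (fun _ : 'rV[R]_n => c).
Proof.
move=> [|j l]; first by split=> [x|i x]; [exact: cst_continuous|exact: derivable_cst].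
by rewrite partials_cst; split=> [x|i x]; [exact: cst_continuous|exact: derivable_cst].
Qed.

(** Smoothness by coinduction: a class of differentiable functions that is
    stable under partial derivatives consists of smooth functions. *)
Lemma rsmooth_closed n (P : ('rV[R]_n -> R) -> Prop) :
  (forall f, P f -> continuous f /\ (forall i x, derivable f x (ee n i)) /\
     forall i, P (partial i f)) ->
  forall f, P f -> rsmooth f.
Proof.
move=> H f Pf l.
have Pl : P (partials l f) by elim: l => //= i l /H[_ [_]]; apply.
by have [? [? _]] := H _ Pl.
Qed.

(** The uniformity in both increments is what the mean value arguments below
    need. *)
Lemma continuous_line2 n (g : 'rV[R]_n -> R) x u v e : continuous g -> 0 < e ->
  exists2 dlt : R, 0 < dlt & forall a b, `|a| <= dlt -> `|b| <= dlt ->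
    `|g x - g (x + a *: u + b *: v)| < e.
Proof.
move=> cg e0.
have /cvgrPdist_lt/(_ e e0) := cg x.
move=> /nbhs_normP[r /= r0 rg].
have N0 : 0 < `|u| + `|v| + 1 by rewrite ltr_wpDl// addr_ge0.
exists (r / (`|u| + `|v| + 1)); first by rewrite divr_gt0.
move=> a b ar br; apply: rg => /=.
rewrite -addrA opprD addNKr normrN.
apply: (le_lt_trans (ler_normD _ _)); rewrite !normrZ.
apply: (@le_lt_trans _ _ (r / (`|u| + `|v| + 1) * (`|u| + `|v|))).
  by rewrite mulrDr lerD// ler_wpM2r.
by rewrite mulrAC ltr_pdivrMr// ltr_pM2l// ltrDl.
Qed.

Lemma is_derive_shift n (f : 'rV[R]_n -> R) (y w v : 'rV[R]_n) : derivable f (y + w) v ->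
  is_derive y v (fun y => f (y + w)) ('D_v f (y + w)).
Proof.
move=> df.
have e : (fun k : R => k^-1 *: (f ((k *: v + y) + w) - f (y + w))) =
  (fun k : R => k^-1 *: (f (k *: v + (y + w)) - f (y + w))).
  by apply/funext => k; rewrite addrA.
move: (df); rewrite /derivable -e => c.
by apply: DeriveDef => //; rewrite /derive -e.
Qed.

Lemma mvt_line n (f : 'rV[R]_n -> R) v x t : (forall y, derivable f y v) ->
  exists2 c, `|c| <= `|t| & f (x + t *: v) - f x = 'D_v f (x + c *: v) * t.
Proof.
move=> df; have [c ct] := mvt0 t (fun h => is_derive_line x h df).
by rewrite scale0r addr0; exists c.
Qed.

Lemma dist_half (a b c e : R) : `|a - b| < e / 2 -> `|c - b| < e / 2 -> `|a - c| < e.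
Proof.
move=> ab cb; rewrite (splitr e) -[a](subrK b) -addrA.
by apply: le_lt_trans (ler_normD _ _) _; rewrite ltrD// distrC.
Qed.

(** The second difference quotient of [f] in two directions can be evaluated by
    the mean value theorem in either order; if the mixed derivatives differed at
    [x], they would stay apart at the nearby intermediate points. *)
Lemma partialC n (f : 'rV[R]_n -> R) i j : rsmooth f ->
  partial i (partial j f) = partial j (partial i f).
Proof.
move=> sf; apply/funext => x; apply/eqP; rewrite -subr_eq0 -normr_le0 leNgt; apply/negP => e0.
set e := (X in 0 < X) in e0.
have e20 : 0 < e / 2 by rewrite divr_gt0.
pose g1 := partial i (partial j f); pose g2 := partial j (partial i f).
have c1 : continuous g1 by apply/rsmooth_continuous/rsmooth_partial/rsmooth_partial.
have c2 : continuous g2 by apply/rsmooth_continuous/rsmooth_partial/rsmooth_partial.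
have [d1 d10 H1] := continuous_line2 x (ee n i) (ee n j) c1 e20.
have [d2 d20 H2] := continuous_line2 x (ee n i) (ee n j) c2 e20.
pose t := Num.min d1 d2.
have t0 : 0 < t by rewrite lt_min d10.
have tt : `|t| = t by rewrite gtr0_norm.
have der k g y : rsmooth g -> derivable g y (ee n k) by move=> sg; exact: rsmooth_derivable.
pose D := f (x + t *: ee n i + t *: ee n j) - f (x + t *: ee n i) - (f (x + t *: ee n j) - f x).
(* The increment of [f] over a parallelogram, read as an iterated increment in
   the directions [k], then [l]. *)
have key k l : exists a b, [/\ `|a| <= t, `|b| <= t &
   f (x + t *: ee n k + t *: ee n l) - f (x + t *: ee n k) - (f (x + t *: ee n l) - f x) =
   partial l (partial k f) (x + a *: ee n k + b *: ee n l) * t * t].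
  pose ph y := f (y + t *: ee n l) - f y.
  have dph y : is_derive y (ee n k) ph (partial k f (y + t *: ee n l) - partial k f y).
    apply: is_deriveB.
      by apply: is_derive_shift; exact: der.
    by apply: DeriveDef; first exact: der.
  have [a at_ e1] := @mvt_line n ph (ee n k) x t (fun y => @ex_derive _ _ _ _ _ _ _ (dph y)).
  have [b bt e2] := @mvt_line n (partial k f) (ee n l) (x + a *: ee n k) t (fun y => der l _ y (rsmooth_partial k sf)).
  exists a, b; rewrite -tt; split=> //.
  rewrite -/(ph x) tt -/(ph (x + t *: ee n k)) e1.
  by have := dph (x + a *: ee n k) => /@derive_val ->; rewrite e2.
have [a [b [aT bT E]]] := key i j; have [b' [a' [bT' aT' E']]] := key j i.
have : g2 (x + a *: ee n i + b *: ee n j) = g1 (x + a' *: ee n i + b' *: ee n j).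
  have t1 : t != 0 by rewrite gt_eqF.
  apply: (mulIf t1); apply: (mulIf t1).
  rewrite (addrAC x (t *: ee n j)) (addrAC x (b' *: ee n j)) in E'.
  apply: etrans (esym E) _; apply: etrans _ E'.
  have ac (p q r u : R) : p - q - (r - u) = p - r - (q - u) by ring.
  exact: ac.
have t12 (c : R) : `|c| <= t -> `|c| <= d1 /\ `|c| <= d2.
  by move=> ct; split; apply: le_trans ct _; rewrite ge_min lexx ?orbT.
have := H1 a' b' (t12 _ aT').1 (t12 _ bT').1.
have := H2 a b (t12 _ aT).2 (t12 _ bT).2.
move=> h2 h1 h12; rewrite h12 in h2.
by have := dist_half h1 h2; rewrite ltxx.
Qed.

(** Additivity of the directional derivative in the direction.  Continuity of
    one of the two derivatives suffices, by the mean value theorem along the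
    second direction. *)
Lemma derive_addZ n (f : 'rV[R]_n -> R) u v x a :
  (forall y, derivable f y u) -> continuous ('D_u f) -> derivable f x v ->
  is_derive x (v + a *: u) f ('D_v f x + a * 'D_u f x).
Proof.
move=> du cu dv.
suff h : (fun t : R => t^-1 *: (f (t *: (v + a *: u) + x) - f x)) @ 0^' -->
    'D_v f x + a * 'D_u f x.
  by apply: DeriveDef; [apply/cvg_ex; eexists; exact: h|exact/cvg_lim].
have -> : (fun t : R => t^-1 *: (f (t *: (v + a *: u) + x) - f x)) =
  (fun t : R => t^-1 *: (f (t *: v + x) - f x) +
     t^-1 *: (f (x + t *: v + (t * a) *: u) - f (x + t *: v))).
  apply/funext => t; rewrite -scalerDr; congr (_ *: _).
  rewrite scalerDr scalerA (addrC (t *: v) x) addrC addrA /=.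
  by rewrite (addrAC (t *: v) ((t * a) *: u) x); ring.
apply: cvgD; first exact: dv.
apply/cvgrPdist_lt => e e0.
have a1 : 0 < `|a| + 1 by rewrite ltr_wpDl.
have [dl dl0 H] := continuous_line2 x v u cu (divr_gt0 e0 a1).
have adl : 0 < dl / (`|a| + 1) by rewrite divr_gt0.
near=> t.
have t0 : t != 0 by near: t; exact: nbhs_dnbhs_neq.
have [c ct ->] := mvt_line (x + t *: v) (t * a) du.
have -> : t^-1 *: ('D_u f (x + t *: v + c *: u) * (t * a)) = a * 'D_u f (x + t *: v + c *: u).
  by rewrite [LHS]/GRing.scale/= mulrCA mulKf// mulrC.
rewrite -mulrBr normrM.
have tdl : `|t| <= dl.
  by near: t; apply: dnbhs0_le.
have tadl : `|t * a| <= dl.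
  have : `|t| <= dl / (`|a| + 1) by near: t; apply: dnbhs0_le.
  rewrite ler_pdivlMr// normrM; apply: le_trans.
  by rewrite ler_wpM2l// lerDl.
have := H t c tdl (le_trans ct tadl); rewrite ltr_pdivlMr//.
by apply: le_lt_trans; rewrite mulrC ler_wpM2l// lerDl.
Unshelve. all: end_near. Qed.

(** Transpositions generate all reorderings. *)
Lemma perm_partials n (f : 'rV[R]_n -> R) l l' : rsmooth f -> perm_eq l l' ->
  partials l f = partials l' f.
Proof.
move=> sf; elim: l l' => [|i l IH] l'; first by rewrite perm_sym => /perm_nilP ->.
move=> ll'; have il' : i \in l' by rewrite -(perm_mem ll') mem_head.
case/splitPr: il' ll' => l1 l2 ll'.
have e : partials (l1 ++ i :: l2) f = partials (i :: l1 ++ l2) f.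
  rewrite [RHS]/= !partials_cat /=.
  move: (rsmooth_partials l2 sf); move: (partials l2 f) => g sg.
  elim: l1 {ll'} => //= k l1 ->; exact: partialC (rsmooth_partials l1 sg).
rewrite e /= (IH (l1 ++ l2))//.
have : perm_eq (i :: l) (i :: l1 ++ l2).
  by rewrite (perm_trans ll')// -cat1s perm_catCA.
by rewrite perm_cons.
Qed.

Lemma derive_sum n (f : 'rV[R]_n -> R) x (r : seq 'I_n) (v : 'I_n -> R) : rsmooth f ->
  is_derive x (\sum_(k <- r) v k *: ee n k) f (\sum_(k <- r) v k * partial k f x).
Proof.
move=> sf; elim: r => [|k r IH].
  by rewrite !big_nil; exact: is_derive0.
rewrite !big_cons addrC (addrC (v k * _)).
have [dr <-] := IH.
apply: derive_addZ dr; first by move=> y; exact: rsmooth_derivable.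
exact: rsmooth_continuous (rsmooth_partial k sf).
Qed.

(** The chain rule for [x *m L + c]: the [i]-th partial derivative becomes this
    combination. *)
Definition affine_partial m n (L : 'M[R]_(m, n)) i (f : 'rV[R]_n -> R) : 'rV[R]_n -> R :=
  fun x => \sum_k L i k * partial k f x.

Lemma partials_sum n (I : Type) (r : seq I) (c : I -> R) (F : I -> 'rV[R]_n -> R) :
  (forall k, rsmooth (F k)) ->
  rsmooth (fun x => \sum_(k <- r) c k * F k x) /\
  forall l, partials l (fun x => \sum_(k <- r) c k * F k x) =
   (fun x => \sum_(k <- r) c k * partials l (F k) x).
Proof.
move=> sF; elim: r => [|k r [sr IH]].
  have -> : (fun x : 'rV[R]_n => \sum_(k <- [::]) c k * F k x) = (fun=> 0).
    by apply/funext => x; rewrite big_nil.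
  split=> [|l]; first exact: rsmooth0.
  by rewrite partials0; apply/funext => x; rewrite big_nil.
have -> : (fun x => \sum_(j <- k :: r) c j * F j x) =
  (fun x => c k * F k x + 1 * (\sum_(j <- r) c j * F j x)).
  by apply/funext => x; rewrite big_cons mul1r.
split=> [|l]; first exact: rsmooth_comb.
rewrite partials_comb// IH.
by apply/funext => x; rewrite big_cons mul1r.
Qed.

Lemma rsmooth_affine_partial m n (L : 'M[R]_(m, n)) i f : rsmooth f -> rsmooth (affine_partial L i f).
Proof.
move=> sf; apply: (partials_sum _ (L i) (F := fun k => partial k f) _).1 => k.
exact: rsmooth_partial.
Qed.

Lemma partials_affine_partial m n (L : 'M[R]_(m, n)) i f l : rsmooth f ->
  partials l (affine_partial L i f) = fun x => \sum_k L i k * partials (rcons l k) f x.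
Proof.
move=> sf.
rewrite (partials_sum _ (L i) (F := fun k => partial k f) _).2 => [|k]; last exact: rsmooth_partial.
by apply/funext => x; apply: eq_bigr => k _; rewrite -cats1 partials_cat.
Qed.

Lemma continuous_sum (T : topologicalType) (I : Type) (r : seq I) (F : I -> T -> R) :
  (forall i, continuous (F i)) -> continuous (fun x => \sum_(i <- r) F i x).
Proof.
move=> cF; elim: r => [|i r IH].
  have -> : (fun x => \sum_(i <- [::]) F i x) = (fun=> 0).
    by apply/funext => x; rewrite big_nil.
  exact: cst_continuous.
have -> : (fun x => \sum_(i <- i :: r) F i x) = (fun x => F i x + \sum_(i <- r) F i x).
  by apply/funext => x; rewrite big_cons.
exact: continuous_add (cF i) IH.
Qed.

Section Affine.
Variables (m n : nat) (L : 'M[R]_(m, n)) (c : 'rV[R]_n).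

Lemma is_derive_affine f w i : rsmooth f ->
  is_derive w (ee m i) (fun w => f (w *m L + c)) (affine_partial L i f (w *m L + c)).
Proof.
move=> sf.
have [] := derive_sum (w *m L + c) (index_enum 'I_n) (L i) sf.
have -> : \sum_k L i k *: ee n k = row i L.
  by rewrite [RHS]row_sum_delta; apply: eq_bigr => k _; rewrite mxE.
have e : (fun t : R => t^-1 *: (f ((t *: ee m i + w) *m L + c) - f (w *m L + c))) =
  (fun t : R => t^-1 *: (f (t *: row i L + (w *m L + c)) - f (w *m L + c))).
  by apply/funext => t; rewrite mulmxDl -scalemxAl -rowE addrA.
rewrite /derivable /derive -e => dd dE.
by apply: DeriveDef => //; rewrite /derive dE.
Qed.

Lemma continuous_affine : continuous (fun w : 'rV[R]_m => w *m L + c).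
Proof.
apply: continuous_rV => i.
have -> : (fun w : 'rV[R]_m => (w *m L + c) 0 i) =
  (fun w => \sum_j w 0 j * L j i + c 0 i) by apply/funext => w; rewrite !mxE.
apply: continuous_add; last exact: cst_continuous.
apply: continuous_sum => j; apply: continuous_mul; last exact: cst_continuous.
exact: coord_continuous.
Qed.

Lemma rsmooth_affine f : rsmooth f -> rsmooth (fun w => f (w *m L + c)).
Proof.
move=> sf; apply: (@rsmooth_closed m (fun g => exists2 f, rsmooth f & g = fun w => f (w *m L + c))); last by exists f.
move=> _ [{sf}f sf ->]; split; [|split=> [i x|i]].
- exact: (continuous_compose continuous_affine (rsmooth_continuous sf)).
- by have [] := is_derive_affine x i sf.
- exists (affine_partial L i f); first exact: rsmooth_affine_partial.
  by apply/funext => w; rewrite (partial_of_is_derive (is_derive_affine w i sf)).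
Qed.

Lemma partial_affine f i : rsmooth f ->
  partial i (fun w => f (w *m L + c)) = fun w => affine_partial L i f (w *m L + c).
Proof.
move=> sf; apply/funext => w.
by rewrite (partial_of_is_derive (is_derive_affine w i sf)).
Qed.

(** Each derivative of the composite splits into derivatives of [f] with total
    weight at most [La].  The predicates [a] and [b] split the directions into
    two classes; since [L] respects the classes, the number of derivatives of
    each class is preserved, which keeps separate Gevrey orders apart. *)
Lemma partials_affine_le (a : pred 'I_m) (b : pred 'I_n) (La : R) f l w M :
  (forall i k, L i k != 0 -> a i = b k) -> (forall i, \sum_k `|L i k| <= La) ->
  rsmooth f -> 0 <= M ->
  (forall l', size l' = size l -> count b l' = count a l ->
     `|partials l' f (w *m L + c)| <= M) ->
  `|partials l (fun w => f (w *m L + c)) w| <= La ^+ size l * M.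
Proof.
move=> ab LLa; elim/last_ind: l f M => [|l i IH] f M sf M0 H.
  by rewrite expr0 mul1r; exact: (H [::]).
rewrite -cats1 partials_cat /= partial_affine//.
have La0 : 0 <= La by apply: le_trans (LLa i); exact: sumr_ge0.
rewrite size_cat addn1 exprSr -mulrA; apply: IH; first exact: rsmooth_affine_partial.
  by rewrite mulr_ge0.
move=> l' sl' cl'; rewrite partials_affine_partial//.
apply: (le_trans (ler_norm_sum _ _ _)).
apply: (@le_trans _ _ (\sum_k `|L i k| * M)); last by rewrite -mulr_suml ler_wpM2r.
apply: ler_sum => k _; rewrite normrM.
have [->|Lik] := eqVneq (L i k) 0; first by rewrite normr0 !mul0r.
rewrite ler_wpM2l//; apply: H; first by rewrite !size_rcons sl'.
by rewrite -!cats1 !count_cat /= cl' (ab _ _ Lik).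
Qed.
End Affine.

(** The Leibniz rule for a list of directions sums over all ways of distributing
    it between two factors. *)
Fixpoint splits (T : Type) (l : seq T) : seq (seq T * seq T) :=
  if l is i :: l' then
    [seq (i :: p.1, p.2) | p <- splits l'] ++ [seq (p.1, i :: p.2) | p <- splits l']
  else [:: ([::], [::])].

(** The shape of functions produced by the Leibniz rule; it is stable under
    partial derivatives. *)
Definition prod_sum n (s : seq (('rV[R]_n -> R) * ('rV[R]_n -> R))) : 'rV[R]_n -> R :=
  fun x => \sum_(p <- s) p.1 x * p.2 x.

Lemma prod_sum_derive n s : (forall p, List.In p s -> rsmooth p.1 /\ rsmooth p.2) -> forall i x,
  is_derive x (ee n i) (prod_sum s)
    (prod_sum ([seq (partial i p.1, p.2) | p <- s] ++ [seq (p.1, partial i p.2) | p <- s]) x).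
Proof.
elim: s => [|p s IH] sm i x.
  rewrite /prod_sum /= big_nil.
  have -> : (fun x : 'rV[R]_n => \sum_(p <- [::]) p.1 x * p.2 x) = (fun=> 0 : R).
    by apply/funext => y; rewrite big_nil.
  exact: is_derive_cst.
have {IH} := IH (fun q qs => sm q (or_intror qs)) i x.
have [s1 s2] := sm p (or_introl erefl).
rewrite /prod_sum /= !big_cat /= !big_cons !big_map /= => IH.
have -> : (fun x : 'rV[R]_n => \sum_(p <- p :: s) p.1 x * p.2 x) =
  (fun x => p.1 x * p.2 x) + prod_sum s by apply/funext => y; rewrite big_cons.
rewrite big_cat /= big_cons !big_map /= in IH *.
have d1 := DeriveDef (@rsmooth_derivable _ _ x i s1) erefl.
have d2 := DeriveDef (@rsmooth_derivable _ _ x i s2) erefl.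
have d12 := is_deriveM d1 d2.
have D := is_deriveD d12 IH; apply: (is_derive_eq D).
by rewrite /partial /GRing.scale /=; ring.
Qed.

Lemma prod_sum_partial n s i : (forall p, List.In p s -> rsmooth p.1 /\ rsmooth p.2) ->
  partial i (prod_sum s) =
    @prod_sum n ([seq (partial i p.1, p.2) | p <- s] ++ [seq (p.1, partial i p.2) | p <- s]).
Proof.
move=> sm; apply/funext => x.
by rewrite (partial_of_is_derive (prod_sum_derive sm i x)).
Qed.

Lemma prod_sum_smooth n s : (forall p, List.In p s -> rsmooth p.1 /\ rsmooth p.2) ->
  rsmooth (@prod_sum n s).
Proof.
move=> sm; apply: (@rsmooth_closed n (fun g => exists2 s, (forall p, List.In p s -> rsmooth p.1 /\ rsmooth p.2) & g = prod_sum s)); last by exists s.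
move=> _ [{sm}s sm ->]; split; [|split=> [i x|i]].
- elim: s sm => [|p s IH] sm.
    have -> : @prod_sum n [::] = (fun=> 0) by apply/funext => y; rewrite /prod_sum big_nil.
    exact: cst_continuous.
  have -> : prod_sum (p :: s) = (fun x => p.1 x * p.2 x + prod_sum s x).
    by apply/funext => y; rewrite /prod_sum big_cons.
  have [s1 s2] := sm p (or_introl erefl).
  apply: continuous_add; first by apply: continuous_mul; exact: rsmooth_continuous.
  by apply: IH => q qs; apply: sm; right.
- by have [] := prod_sum_derive sm i x.
- rewrite (prod_sum_partial i sm); eexists; last reflexivity.
  move=> p /List.in_app_iff[|] /List.in_map_iff[q [<- /sm[sq1 sq2]]]; split.
  + exact: (rsmooth_partial i sq1).
  + exact: sq2.
  + exact: sq1.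
  + exact: (rsmooth_partial i sq2).
Qed.

Lemma rsmoothM n (f g : 'rV[R]_n -> R) : rsmooth f -> rsmooth g -> rsmooth (fun x => f x * g x).
Proof.
move=> sf sg; have -> : (fun x => f x * g x) = prod_sum [:: (f, g)].
  by apply/funext => x; rewrite /prod_sum big_seq1.
by apply: prod_sum_smooth => p /= [<-|].
Qed.

Lemma partials_mul n (f g : 'rV[R]_n -> R) l : rsmooth f -> rsmooth g ->
  partials l (fun x => f x * g x) =
  fun x => \sum_(p <- splits l) partials p.1 f x * partials p.2 g x.
Proof.
move=> sf sg.
suff -> : partials l (fun x => f x * g x) = prod_sum [seq (partials p.1 f, partials p.2 g) | p <- splits l].
  by apply/funext => x; rewrite /prod_sum big_map.
elim: l => [|i l IH].
  by apply/funext => x; rewrite /prod_sum /= big_seq1.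
rewrite [LHS]/= IH prod_sum_partial.
  by rewrite /= map_cat -!map_comp; congr (prod_sum (_ ++ _)).
move=> p /List.in_map_iff[q [<- _]].
by split; exact: rsmooth_partials.
Qed.

Lemma partialM n (f g : 'rV[R]_n -> R) i : rsmooth f -> rsmooth g ->
  partial i (fun x => f x * g x) = fun x => partial i f x * g x + f x * partial i g x.
Proof.
move=> sf sg; apply: (etrans (partials_mul [:: i] sf sg)).
by apply/funext => x; rewrite /= big_cons big_seq1.
Qed.
End SmoothCalculus.

Section SplitsTheory.
Context (T : Type).
Implicit Types l : seq T.

Lemma splits_count (a : pred T) l p : List.In p (splits l) ->
  (count a p.1 + count a p.2)%N = count a l.
Proof.
elim: l p => [|i l IH] p /=; first by case=> // <-.
by move=> /List.in_app_iff[|] /List.in_map_iff[q [<- /IH <-]] /=; lia.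
Qed.

Lemma splits_binomial (R : realType) (h k : R) l :
  \sum_(p <- splits l) h ^+ size p.1 * k ^+ size p.2 = (h + k) ^+ size l.
Proof.
elim: l => [|i l IH] /=; first by rewrite big_seq1 mul1r.
rewrite big_cat /= !big_map /= exprS -IH mulrDl !mulr_sumr; congr (_ + _).
  by apply: eq_bigr => p _; rewrite exprS mulrA.
by apply: eq_bigr => p _; rewrite exprS mulrCA.
Qed.

Lemma ler_sum_in (R : realType) (s : seq T) (f g : T -> R) :
  (forall p, List.In p s -> f p <= g p) -> \sum_(p <- s) f p <= \sum_(p <- s) g p.
Proof.
elim: s => [|p s IH] H; first by rewrite !big_nil.
rewrite !big_cons lerD ?H//; first by left.
by apply: IH => q qs; apply: H; right.
Qed.
End SplitsTheory.

(** * Gevrey bounds *)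

Lemma fact_mul_le (j k : nat) : (j`! * k`! <= (j + k)`!)%N.
Proof. by rewrite -(bin_fact (leq_addr k j)) addKn leq_pmull// bin_gt0 leq_addr. Qed.

Section FactorialPower.
Context (R : realType).
Definition factpow (t : R) (k : nat) : R := (k`!%:R) `^ t.

Lemma factpow_gt0 t k : 0 < factpow t k.
Proof. by rewrite powR_gt0// ltr0n fact_gt0. Qed.

Lemma factpow_ge0 t k : 0 <= factpow t k. Proof. exact: ltW (factpow_gt0 t k). Qed.

Lemma factpow0 t : factpow t 0 = 1. Proof. by rewrite /factpow fact0 powR1. Qed.

Lemma ler_powR_nat (t : R) (j k : nat) : 0 <= t -> (j <= k)%N -> (j%:R : R) `^ t <= k%:R `^ t.
Proof. by move=> t0 jk; apply: ge0_ler_powR => //; rewrite ?nnegrE ?ler_nat ?ler0n. Qed.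

Lemma factpow_mul t j k : 0 <= t -> factpow t j * factpow t k <= factpow t (j + k).
Proof.
move=> t0; rewrite /factpow -powRM ?ler0n// -natrM; apply: ler_powR_nat => //.
exact: fact_mul_le.
Qed.

(** A binomial coefficient is at most the sum 2^n of its row. *)
Lemma fact_add_le j k : ((j + k)`! <= 2 ^ (j + k) * (j`! * k`!))%N.
Proof.
rewrite -(bin_fact (leq_addr k j)) addKn leq_mul2r.
have -> : (2 = 1 + 1)%N by [].
rewrite expnDn (bigD1 (inord j)) //= !exp1n !muln1 inordK ?ltnS ?leq_addr//.
by rewrite ?leq_addr ?orbT.
Qed.

Lemma factpow_add t j k : 0 <= t -> factpow t (j + k) <= (2 `^ t) ^+ (j + k) * (factpow t j * factpow t k).
Proof.
move=> t0; rewrite /factpow -powRM ?ler0n// -natrM.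
have -> : (2 `^ t) ^+ (j + k) = ((2 ^ (j + k))%N%:R : R) `^ t.
  by rewrite -powR_mulrn ?powR_ge0// -powRrM (mulrC t) powRrM powR_mulrn// natrX.
rewrite -powRM ?ler0n// -natrM.
by apply: ler_powR_nat => //; exact: fact_add_le.
Qed.
End FactorialPower.

Lemma count_predC_eq (S T : Type) (a : pred S) (b : pred T) l l' :
  size l' = size l -> count b l' = count a l -> count (predC b) l' = count (predC a) l.
Proof. by have := count_predC a l; have := count_predC b l'; lia. Qed.

Section GevreyBounds.
Context (R : realType) (s1 s2 : R).
Hypotheses (s1_ge0 : 0 <= s1) (s2_ge0 : 0 <= s2).

Definition gevrey_fact n (cls : pred 'I_n) (l : seq 'I_n) : R :=
  factpow s1 (count cls l) * factpow s2 (count (predC cls) l).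

(** The directions in [cls] carry the Gevrey order [s1], the others [s2].
    Derivatives are listed by directions rather than by multi-indices; the count
    of a list in a class replaces the order of the multi-index, which makes the
    factorials insensitive to the way derivatives are distributed over
    coordinates. *)
Definition gevrey n (cls : pred 'I_n) (h : R) (W : 'rV[R]_n -> R) (F : 'rV[R]_n -> R) : Prop :=
  rsmooth F /\ forall l w, `|partials l F w| <= W w * (h ^+ size l * gevrey_fact cls l).

Lemma gevrey_fact_gt0 n (cls : pred 'I_n) l : 0 < gevrey_fact cls l.
Proof. by rewrite mulr_gt0 ?factpow_gt0. Qed.

Lemma gevrey_fact_ge0 n (cls : pred 'I_n) l : 0 <= gevrey_fact cls l.
Proof. exact: ltW (gevrey_fact_gt0 cls l). Qed.

Lemma gevrey_fact_nil n (cls : pred 'I_n) : gevrey_fact cls [::] = 1.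
Proof. by rewrite /gevrey_fact !factpow0 mulr1. Qed.

Lemma gevrey_factT n (l : seq 'I_n) : gevrey_fact predT l = factpow s1 (size l).
Proof.
by rewrite /gevrey_fact count_predT (eq_count (a2 := pred0))// count_pred0 factpow0 mulr1.
Qed.

Lemma gevrey_norm_le n cls h (W : 'rV[R]_n -> R) F w : gevrey cls h W F -> `|F w| <= W w.
Proof. by move=> [_ /(_ [::] w)]; rewrite /= gevrey_fact_nil !mulr1. Qed.

Lemma gevrey_bound_ge0 n cls h (W : 'rV[R]_n -> R) F w : gevrey cls h W F -> 0 <= W w.
Proof. by move=> /gevrey_norm_le -/(_ w); exact: le_trans. Qed.

Lemma gevrey_le n cls h k (W V : 'rV[R]_n -> R) F : 0 <= h -> h <= k -> (forall w, W w <= V w) ->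
  gevrey cls h W F -> gevrey cls k V F.
Proof.
move=> h0 hk WV gF; have [sF FW] := gF; split=> // l w; apply: le_trans (FW l w) _.
apply: ler_pM => //; first exact: gevrey_bound_ge0 gF.
  by rewrite mulr_ge0 ?exprn_ge0 ?gevrey_fact_ge0.
by rewrite ler_wpM2r ?gevrey_fact_ge0// lerXn2r// nnegrE// (le_trans h0).
Qed.

(** The constants add because the sum of [h^j k^(n-j)] over all distributions of
    [n] derivatives is [(h + k)^n]. *)
Lemma gevrey_mul n cls h k (W V : 'rV[R]_n -> R) F G : 0 <= h -> 0 <= k ->
  gevrey cls h W F -> gevrey cls k V G -> gevrey cls (h + k) (fun w => W w * V w) (fun w => F w * G w).
Proof.
move=> h0 k0 gF gG; have [sF FW] := gF; have [sG GV] := gG.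
split=> [|l w]; first exact: rsmoothM.
rewrite partials_mul//; apply: (le_trans (ler_norm_sum _ _ _)).
rewrite -splits_binomial mulr_suml mulr_sumr; apply: ler_sum_in => p pl.
rewrite normrM; apply: (le_trans (ler_pM _ _ (FW _ _) (GV _ _))) => //.
rewrite mulrACA ler_wpM2l ?mulr_ge0 ?(gevrey_bound_ge0 _ gF) ?(gevrey_bound_ge0 _ gG)//.
rewrite mulrACA ler_wpM2l ?mulr_ge0 ?exprn_ge0//.
rewrite /gevrey_fact mulrACA -(splits_count cls pl) -(splits_count (predC cls) pl).
by rewrite ler_pM ?mulr_ge0 ?factpow_ge0 ?factpow_mul.
Qed.

Lemma gevrey_lin n cls h (W V : 'rV[R]_n -> R) a b F G :
  gevrey cls h W F -> gevrey cls h V G ->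
  gevrey cls h (fun w => `|a| * W w + `|b| * V w) (fun w => a * F w + b * G w).
Proof.
move=> [sF FW] [sG GV]; split=> [|l w]; first exact: rsmooth_comb.
rewrite partials_comb//; apply: (le_trans (ler_normD _ _)).
by rewrite !normrM mulrDl lerD// -mulrA ler_wpM2l.
Qed.

(** A factorial of a sum is at most the product of the factorials up to a
    geometric factor, which is absorbed into the constant [H]. *)
Lemma gevrey_partials n cls h (W : 'rV[R]_n -> R) F l : 0 <= h -> gevrey cls h W F ->
  let H := 2 `^ s1 * 2 `^ s2 * h in
  gevrey cls H (fun w => H ^+ size l * gevrey_fact cls l * W w) (partials l F).
Proof.
move=> h0 gF H; have [sF FW] := gF; split=> [|l' w]; first exact: rsmooth_partials.
rewrite -partials_cat; apply: (le_trans (FW _ _)).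
rewrite [leRHS](_ : _ = W w * (H ^+ size (l' ++ l) * (gevrey_fact cls l' * gevrey_fact cls l))); last first.
  by rewrite size_cat exprD; ring.
apply: ler_wpM2l; first exact: gevrey_bound_ge0 gF.
have -> : H ^+ size (l' ++ l) * (gevrey_fact cls l' * gevrey_fact cls l) = h ^+ size (l' ++ l) *
  ((2 `^ s1) ^+ size (l' ++ l) * (2 `^ s2) ^+ size (l' ++ l) * (gevrey_fact cls l' * gevrey_fact cls l)).
  by rewrite /H !exprMn; ring.
apply: ler_wpM2l; first by rewrite exprn_ge0.
rewrite /gevrey_fact !count_cat.
have p1 (t : R) (k N : nat) : 0 <= t -> (k <= N)%N -> (2 `^ t) ^+ k <= (2 `^ t) ^+ N.
  by move=> t0 kN; rewrite ler_weXn2l// -[leLHS](powRr0 2) ler_powR// ler1n.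
have c1 : (count cls l' + count cls l <= size (l' ++ l))%N.
  by rewrite -count_cat count_size.
have c2 : (count (predC cls) l' + count (predC cls) l <= size (l' ++ l))%N.
  by rewrite -count_cat count_size.
apply: (@le_trans _ _ (((2 `^ s1) ^+ size (l' ++ l) * (factpow s1 (count cls l') * factpow s1 (count cls l))) *
  ((2 `^ s2) ^+ size (l' ++ l) * (factpow s2 (count (predC cls) l') * factpow s2 (count (predC cls) l))))).
  apply: ler_pM; rewrite ?factpow_ge0//.
    apply: (le_trans (factpow_add _ _ s1_ge0)); apply: ler_wpM2r; last exact: p1.
    by rewrite mulr_ge0 ?factpow_ge0.
  apply: (le_trans (factpow_add _ _ s2_ge0)); apply: ler_wpM2r; last exact: p1.
  by rewrite mulr_ge0 ?factpow_ge0.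
by apply: eq_ler; ring.
Qed.

Lemma gevrey_affine m n (cm : pred 'I_m) (cn : pred 'I_n) (L : 'M[R]_(m, n)) c La h W F :
  (forall i k, L i k != 0 -> cm i = cn k) -> (forall i, \sum_k `|L i k| <= La) -> 0 <= h -> 0 <= La ->
  gevrey cn h W F -> gevrey cm (La * h) (fun w => W (w *m L + c)) (fun w => F (w *m L + c)).
Proof.
move=> Lc LLa h0 La0 gF; have [sF FW] := gF; split=> [|l w]; first exact: rsmooth_affine.
rewrite exprMn -mulrA mulrCA.
apply: (partials_affine_le Lc LLa sF).
  by rewrite mulr_ge0 ?(gevrey_bound_ge0 _ gF)// mulr_ge0 ?exprn_ge0 ?gevrey_fact_ge0.
move=> l' sl cl; apply: (le_trans (FW _ _)); rewrite sl /gevrey_fact cl.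
by rewrite (count_predC_eq sl cl).
Qed.
End GevreyBounds.

(** * Factorial moments and exponential decay *)

Section ExponentialMoments.
Context (R : realType).
Implicit Types (s t u v p c r : R).

Lemma expR_powR r s : expR r `^ s = expR (s * r).
Proof. by rewrite /powR gt_eqF ?expR_gt0// expRK. Qed.

Lemma powRVK s t : 0 < s -> 0 <= t -> (t `^ s^-1) `^ s = t.
Proof. by move=> s0 t0; rewrite -powRrM mulVf ?gt_eqF// powRr1. Qed.

Lemma powRKV s t : 0 < s -> 0 <= t -> (t `^ s) `^ s^-1 = t.
Proof. by move=> s0 t0; rewrite -powRrM mulfV ?gt_eqF// powRr1. Qed.

Lemma powR_exprn t s k : 0 <= t -> (t ^+ k) `^ s = (t `^ s) ^+ k.
Proof.
move=> t0; rewrite -(powR_mulrn k t0) -(powR_mulrn k (powR_ge0 t s)).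
exact: powRAC.
Qed.

Lemma powR_le s t u : 0 <= s -> 0 <= t -> t <= u -> t `^ s <= u `^ s.
Proof.
by move=> s0 t0 tu; apply: ge0_ler_powR => //; rewrite nnegrE// (le_trans t0).
Qed.

Lemma powRD_le p u v : 0 <= p -> 0 <= u -> 0 <= v ->
  (u + v) `^ p <= 2 `^ p * (u `^ p + v `^ p).
Proof.
move=> p0 u0 v0.
have [uv|vu] := leP u v.
  apply: (@le_trans _ _ ((2 * v) `^ p)).
    by apply: powR_le; rewrite ?addr_ge0// mulr_natl mulr2n lerD2r.
  by rewrite powRM// ler_wpM2l ?powR_ge0// lerDr powR_ge0.
apply: (@le_trans _ _ ((2 * u) `^ p)).
  by apply: powR_le; rewrite ?addr_ge0// mulr_natl mulr2n lerD2l ltW.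
by rewrite powRM// ler_wpM2l ?powR_ge0// lerDl powR_ge0.
Qed.

Lemma exp_coeff_sum_le t k : 0 <= t -> \sum_(0 <= i < k) t ^+ i / i`!%:R <= expR t.
Proof.
move=> t0.
have := @nondecreasing_cvgn_le R (series (exp_coeff t)) _ (is_cvg_series_exp_coeff t) k.
apply; apply: nondecreasing_series => n _ _.
by rewrite /exp_coeff /= divr_ge0// exprn_ge0.
Qed.

Lemma expr_le_expR t k : 0 <= t -> t ^+ k <= k`!%:R * expR t.
Proof.
move=> t0; rewrite mulrC -ler_pdivrMr ?ltr0n ?fact_gt0//.
apply: le_trans (exp_coeff_sum_le k.+1 t0); rewrite big_nat_recr//= lerDr.
by apply: sumr_ge0 => i _; rewrite divr_ge0// exprn_ge0.
Qed.

(** The [k]-th term of the exponential series of [y = (r / s) t^(1/s)], raised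
    to the power [s]. *)
Lemma moment_le s r t k : 0 < s -> 0 < r -> 0 <= t ->
  t ^+ k <= ((s / r) `^ s) ^+ k * factpow s k * expR (r * t `^ s^-1).
Proof.
move=> s0 r0 t0.
pose y := r / s * t `^ s^-1.
have y0 : 0 <= y by rewrite mulr_ge0 ?powR_ge0// divr_ge0// ltW.
have := powR_le (ltW s0) (exprn_ge0 k y0) (expr_le_expR k y0).
rewrite powRM ?ler0n ?expR_ge0// expR_powR powR_exprn// -/(factpow s k).
have -> : y `^ s = (r / s) `^ s * t.
  have rs : 0 <= r / s by rewrite divr_ge0// ltW.
  by rewrite (powRM _ rs (powR_ge0 _ _)) powRVK.
have -> : s * y = r * t `^ s^-1 by rewrite /y mulrA mulrCA divff ?mulr1// gt_eqF.
have q0 : 0 < (r / s) `^ s by rewrite powR_gt0// divr_gt0.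
rewrite exprMn -ler_pdivlMl ?exprn_gt0//.
suff -> : ((r / s) `^ s ^+ k)^-1 = (s / r) `^ s ^+ k by rewrite mulrA.
rewrite -exprVn; congr (_ ^+ _).
apply: (mulfI (lt0r_neq0 q0)); rewrite mulfV ?gt_eqF//.
have rs : 0 <= r / s by rewrite divr_ge0// ltW.
have sr : 0 <= s / r by rewrite divr_ge0// ltW.
have rs1 : r / s * (s / r) = 1 by field; rewrite !gt_eqF.
by rewrite -(powRM _ rs sr) rs1 powR1.
Qed.

Lemma limr_le_expR t C : 0 <= t ->
  (forall N, \sum_(0 <= i < N) t ^+ i / i`!%:R <= C) -> expR t <= C.
Proof.
move=> t0 H; rewrite /expR; apply: limr_le; first exact: is_cvg_series_exp_coeff.
by apply: nearW => N; exact: H.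
Qed.

(** Raising the moment bounds to the power [1/s] and dividing by [k!] makes them
    summable: with the argument halved, the series is geometric and sums to an
    exponential, which is then raised to the power [s]. *)
Lemma exp_of_moments s t M C H : 0 < s -> 0 <= t -> 0 <= M -> 0 <= C -> 0 < H ->
  (forall k, t ^+ k * M <= C * H ^+ k * factpow s k) ->
  M <= 2 `^ s * C * expR (- (s / (2 * H `^ s^-1) * t `^ s^-1)).
Proof.
move=> s0 t0 M0 C0 H0 mom.
pose y := t `^ s^-1 / (2 * H `^ s^-1).
have Hs : 0 < H `^ s^-1 by rewrite powR_gt0.
have y0 : 0 <= y by rewrite divr_ge0 ?powR_ge0// mulr_ge0 ?powR_ge0.
have si0 : 0 <= s^-1 by rewrite invr_ge0 ltW.
(* The factor 2 in [y] is what makes the terms geometric of ratio 1 / 2. *)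
have term k : M `^ s^-1 * (y ^+ k / k`!%:R) <= C `^ s^-1 * (2^-1) ^+ k.
  have := powR_le si0 (mulr_ge0 (exprn_ge0 k t0) M0) (mom k).
  rewrite !powRM ?exprn_ge0 ?factpow_ge0 ?mulr_ge0 ?exprn_ge0//; try exact: ltW.
  rewrite !powR_exprn ?(ltW H0)//.
  rewrite /factpow powRKV//.
  move=> le; rewrite /y expr_div_n exprMn exprVn.
  rewrite mulrA ler_pdivrMr ?ltr0n ?fact_gt0// mulrA ler_pdivrMr ?mulr_gt0 ?exprn_gt0//.
  rewrite [M `^ _ * _]mulrC; apply: (le_trans le).
  apply: eq_ler; field.
  by rewrite expf_neq0// pnatr_eq0.
have sumle : M `^ s^-1 * expR y <= 2 * C `^ s^-1.
  have [M0'|Mn0] := eqVneq M 0.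
    rewrite M0' powR0 ?mul0r ?mulr_ge0 ?powR_ge0//.
    by rewrite invr_neq0// gt_eqF.
  have Mp : 0 < M `^ s^-1 by rewrite powR_gt0// lt_def Mn0.
  rewrite -ler_pdivlMl//; apply: limr_le_expR => // N.
  rewrite ler_pdivlMl// big_distrr /=.
  apply: (@le_trans _ _ (\sum_(0 <= k < N) C `^ s^-1 * (2^-1) ^+ k)).
    by apply: ler_sum => k _; exact: term.
  rewrite -big_distrr /= mulrC ler_wpM2r ?powR_ge0//.
  suff -> : \sum_(0 <= k < N) (2^-1 : R) ^+ k = 2 - 2 * (2^-1) ^+ N.
    by rewrite lerBlDr lerDl mulr_ge0// exprn_ge0// invr_ge0.
  elim: N => [|N IH]; first by rewrite big_geq// expr0 mulr1 subrr.
  by rewrite big_nat_recr//= IH exprS; field.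
have := powR_le (ltW s0) (mulr_ge0 (powR_ge0 _ _) (expR_ge0 _)) sumle.
rewrite !powRM ?powR_ge0 ?expR_ge0// !powRVK// expR_powR.
rewrite expRN -ler_pdivlMr ?expR_gt0//.
suff -> : s * y = s / (2 * H `^ s^-1) * t `^ s^-1 by [].
by rewrite /y; ring.
Qed.
End ExponentialMoments.

(** * Norms and the product weight *)

Section Norms.
Context (R : realType).

Lemma coord_le_norm n (x : 'rV[R]_n) i : `|x 0 i| <= `|x|.
Proof.
rewrite [leRHS]/Num.norm /= mx_normrE.
by apply/bigmax_geP; right; exists (0, i).
Qed.

Lemma norm_le n (x : 'rV[R]_n) M : 0 <= M -> (forall i, `|x 0 i| <= M) -> `|x| <= M.
Proof.
move=> M0 H; rewrite [leLHS]/Num.norm /= mx_normrE.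
by apply/bigmax_leP; split => // -[i j] _ /=; rewrite (ord1 i).
Qed.

Lemma norm_mulmx_le m n (x : 'rV[R]_m) (L : 'M[R]_(m, n)) :
  `|x *m L| <= (\sum_i \sum_j `|L i j|) * `|x|.
Proof.
apply: norm_le => [|j].
  by rewrite mulr_ge0//; apply: sumr_ge0 => i _; apply: sumr_ge0.
rewrite mxE mulr_suml; apply: (le_trans (ler_norm_sum _ _ _)); apply: ler_sum => i _.
rewrite normrM mulrC; apply: ler_pM => //; last exact: coord_le_norm.
by rewrite (bigD1 j)//= lerDl sumr_ge0.
Qed.

Lemma enorm_le n (x : 'rV[R]_n) : enorm x <= n%:R * `|x|.
Proof.
rewrite /enorm -[leRHS]ger0_norm ?mulr_ge0// -sqrtr_sqr; apply: ler_wsqrtr.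
rewrite exprMn /dotv.
apply: (@le_trans _ _ (\sum_(i < n) `|x| ^+ 2)).
  apply: ler_sum => i _; rewrite -expr2 -[leLHS]real_normK ?num_real//.
  by rewrite lerXn2r ?nnegrE//; exact: coord_le_norm.
rewrite sumr_const card_ord -[leLHS]mulr_natl ler_wpM2r ?exprn_ge0//.
by rewrite -natrX ler_nat; case: n {x} => // n; rewrite leq_pmulr.
Qed.

Lemma norm_row_mxl m n (x : 'rV[R]_m) (y : 'rV[R]_n) : `|x| <= `|row_mx x y|.
Proof. by apply: norm_le => // i; rewrite -(row_mxEl x y); exact: coord_le_norm. Qed.

Lemma norm_row_mxr m n (x : 'rV[R]_m) (y : 'rV[R]_n) : `|y| <= `|row_mx x y|.
Proof. by apply: norm_le => // i; rewrite -(row_mxEr x y); exact: coord_le_norm. Qed.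

Lemma rho_norm n (x : 'rV[R]_n) : 1 <= (1 + `|x|) ^+ (2 * n) * rho x.
Proof.
rewrite /rho exprM -[n in _ ^+ n]card_ord -prodr_const -big_split /=.
have e : 1 = \prod_(i < n) (1 : R) by rewrite big1.
rewrite {1}e; apply: ler_prod => i _; rewrite ler01 /lorentz ler_pdivlMr ?mul1r; last first.
  by rewrite ltr_pwDl// sqr_ge0.
have := coord_le_norm x i; have := normr_ge0 (x 0 i).
rewrite -[x 0 i ^+ 2]real_normK ?num_real//.
by move: `|x 0 i| `|x| => u v; nra.
Qed.

(** Stretched exponentials decay faster than any power, and [rho] only decays
    like a power of the norm. *)
Lemma exp_le_rho n (s c : R) : 0 < s -> 0 < c ->
  exists2 K, 0 < K & forall x : 'rV[R]_n, expR (- (c * `|x| `^ s^-1)) <= K * rho x.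
Proof.
move=> s0 c0.
pose K0 := ((s / c) `^ s) ^+ (2 * n) * factpow s (2 * n).
have K00 : 0 < K0 by rewrite mulr_gt0 ?factpow_gt0// exprn_gt0// powR_gt0// divr_gt0.
exists (2 ^+ (2 * n) * (1 + K0)); first by rewrite mulr_gt0 ?exprn_gt0// ltr_wpDr// ltW.
move=> x; rewrite expRN -[leLHS]mul1r ler_pdivrMr ?expR_gt0//.
apply: (le_trans (rho_norm x)); rewrite mulrAC ler_wpM2r ?rho_ge0// -mulrA.
have m := @moment_le R s c `|x| (2 * n) s0 c0 (normr_ge0 x).
have e1 : 1 <= expR (c * `|x| `^ s^-1).
  by rewrite -expR0 ler_expR mulr_ge0 ?powR_ge0// ltW.
apply: (@le_trans _ _ (2 ^+ (2 * n) * (1 + `|x| ^+ (2 * n)))).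
  have [x1|x1] := leP 1 `|x|.
    apply: (@le_trans _ _ ((2 * `|x|) ^+ (2 * n))).
      by rewrite lerXn2r ?nnegrE ?addr_ge0 ?mulr_ge0// mulr_natl mulr2n lerD2r.
    by rewrite exprMn ler_wpM2l ?exprn_ge0// lerDr.
  apply: (@le_trans _ _ (2 ^+ (2 * n))).
    rewrite lerXn2r ?nnegrE ?addr_ge0//; lra.
  by rewrite ler_peMr ?exprn_ge0// lerDl exprn_ge0.
rewrite ler_wpM2l ?exprn_ge0// mulrDl mul1r lerD//.
Qed.
End Norms.

(** * Multi-indices and lists of directions *)

Section MultiIndexFactorials.
Context (R : realType) (n : nat).
Implicit Types (l : seq 'I_n) (al : 'I_n -> nat).

Lemma mi_fact_le al : (mi_fact al <= (mi_abs al)`!)%N.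
Proof.
rewrite /mi_fact /mi_abs; elim/big_rec2 : _ => // i u v _ le.
by apply: leq_trans (fact_mul_le _ _); rewrite leq_mul2l le orbT.
Qed.

(** The multinomial coefficient is at most exponential in the order; together
    with [mi_fact_le] this makes products of factorials and factorials of orders
    interchangeable. *)
Lemma fact_abs_le al : ((mi_abs al)`! <= (2 ^ n) ^ mi_abs al * mi_fact al)%N.
Proof.
suff H (r : seq 'I_n) : ((\sum_(i <- r) al i)`! <=
    (2 ^ size r) ^ (\sum_(i <- r) al i) * \prod_(i <- r) (al i)`!)%N.
  by have := H (enum 'I_n); rewrite size_enum_ord !big_enum.
elim: r => [|i r IH]; first by rewrite !big_nil.
rewrite !big_cons; set S := (\sum_(_ <- r) _)%N in IH *; set P := (\prod_(_ <- r) _)%N in IH *.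
apply: leq_trans (fact_add_le _ _) _.
rewrite /= expnS expnMn -!mulnA leq_mul2l; apply/orP; right.
rewrite mulnCA leq_mul2l; apply/orP; right.
apply: (leq_trans IH); rewrite leq_mul2r; apply/orP; right.
by rewrite leq_pexp2l ?expn_gt0// leq_addl.
Qed.

(** The multi-index of a list of directions; by symmetry of mixed derivatives
    only this count matters. *)
Definition mi_of l : 'I_n -> nat := fun i => count_mem i l.

Lemma mi_abs_of l : mi_abs (mi_of l) = size l.
Proof.
rewrite /mi_abs /mi_of; elim: l => [|i l IH] /=; first by rewrite big1.
rewrite big_split /= IH (bigD1 i)//= eqxx big1 ?addn0// => j ji.
by rewrite eq_sym (negbTE ji).
Qed.

Lemma perm_rderiv l : perm_eq l (flatten [seq nseq (mi_of l i) i | i <- enum 'I_n]).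
Proof.
apply/allP => i _ /=; apply/eqP; rewrite count_flatten -map_comp sumnE big_map big_enum /=.
rewrite (bigD1 i)//= big1 ?addn0 => [|j ji]; last first.
  by rewrite /= count_nseq /= (negbTE ji).
by rewrite count_nseq /= eqxx mul1n.
Qed.

Lemma partials_rderiv (f : 'rV[R]_n -> R) l : rsmooth f -> partials l f = rderiv (mi_of l) f.
Proof. by move=> sf; apply: perm_partials => //; exact: perm_rderiv. Qed.
End MultiIndexFactorials.

(** * Integrals depending on parameters *)

Section Lines.
Context (R : realType).

(** Lets facts about one real variable, such as [rint_derive], be used for
    partial derivatives. *)
Lemma is_derive_lineP k (f : 'rV[R]_k -> R) x v df :
  is_derive x v f df <-> is_derive 0 (1 : R) (fun h : R => f (x + h *: v)) df.
Proof.
have e : (fun h : R => h^-1 *: (f (x + (h *: (1 : R) + 0) *: v) - f (x + 0 *: v))) =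
  (fun h : R => h^-1 *: (f (h *: v + x) - f x)).
  by apply/funext => h; rewrite scaler1 addr0 scale0r addr0 (addrC x).
by split=> -[d <-]; apply: DeriveDef; rewrite ?/derivable ?/derive ?e //;
  move: d; rewrite /derivable ?e.
Qed.

End Lines.

Section ParametricIntegrals.
Context (R : realType) (m n : nat).
Implicit Types (F : 'rV[R]_(m + n) -> R).

Definition pint F : 'rV[R]_m -> R := fun p => rint (fun y : 'rV[R]_n => F (row_mx p y)).

(** Domination by the weight in the integration variables, locally uniformly in
    the parameter: exactly what continuity in the parameter requires. *)
Definition ldom F := continuous F /\
  forall r : R, exists C, forall p : 'rV[R]_m, `|p| <= r -> forall y : 'rV[R]_n,
    `|F (row_mx p y)| <= C * rho y.

Lemma ldom_dom F p : ldom F -> exists C, forall q : 'rV[R]_m, `|q - p| <= 1 ->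
  dom C (fun y : 'rV[R]_n => F (row_mx q y)).
Proof.
move=> [cF /(_ (`|p| + 1))[C HC]]; exists C => q qp; split=> [|y].
  apply: (continuous_compose _ cF).
  by apply: continuous_row_mx; [exact: cst_continuous|exact: continuous_idfun].
apply: HC; rewrite -[q](subrK p) addrC.
by apply: (le_trans (ler_normD _ _)); rewrite lerD2l.
Qed.

Lemma ldom_dom1 F p : ldom F -> exists C, dom C (fun y : 'rV[R]_n => F (row_mx p y)).
Proof. by move=> /(ldom_dom p)[C H]; exists C; apply: H; rewrite subrr normr0. Qed.

Lemma pint_continuous F : ldom F -> continuous (pint F).
Proof.
move=> lF p; have [C HC] := ldom_dom p lF.
apply: (@rint_continuous _ _ _ (fun q y => F (row_mx q y)) p C) => [|y].
  apply/nbhs_normP; exists 1; first by rewrite /=.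
  by move=> q /= pq; apply: HC; rewrite distrC ltW.
suff cFy : continuous (fun q => F (row_mx q y)) by exact: cFy.
apply: (continuous_compose _ lF.1).
by apply: continuous_row_mx; [exact: continuous_idfun|exact: cst_continuous].
Qed.

(** An application of [rint_derive] on the line through [p]. *)
Lemma pint_derive F i p : ldom F -> ldom (partial (lshift n i) F) ->
  (forall w, derivable F w (delta_mx 0 (lshift n i) : 'rV[R]_(m + n))) ->
  is_derive p (delta_mx 0 i : 'rV[R]_m) (pint F) (pint (partial (lshift n i) F) p).
Proof.
move=> lF lF' der; apply/is_derive_lineP.
have [C HC] := ldom_dom p lF; have [D HD] := ldom_dom p lF'.
pose Phi (h : R) (y : 'rV[R]_n) := F (row_mx (p + h *: delta_mx 0 i) y).
pose Phi' (h : R) (y : 'rV[R]_n) := partial (lshift n i) F (row_mx (p + h *: delta_mx 0 i) y).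
have e h (y : 'rV[R]_n) : row_mx (p + h *: delta_mx 0 i) y =
    row_mx p y + h *: delta_mx 0 (lshift n i).
  apply/rowP => k; rewrite [RHS]mxE; case: (split_ordP k) => j ->.
    rewrite !row_mxEl [LHS]mxE; congr (_ + _).
    by rewrite !mxE (inj_eq (@lshift_inj _ _)).
  by rewrite !row_mxEr !mxE eq_rlshift andbF mulr0 addr0.
have nrm (h : R) : `|h| <= 1 -> `|p + h *: (delta_mx 0 i : 'rV[R]_m) - p| <= 1.
  move=> h1; rewrite addrAC subrr add0r; apply: norm_le => // j.
  rewrite !mxE normrM; apply: le_trans h1; rewrite ler_piMr//.
  by case: (_ && _); rewrite ?normr1 ?normr0.
have dPhi h y : is_derive h (1 : R) (Phi ^~ y) (Phi' h y).
  rewrite /Phi /Phi'; under eq_fun do rewrite e; rewrite e.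
  exact: is_derive_line.
have := @rint_derive R n Phi Phi' C D dPhi (fun h h1 => HC _ (nrm h h1)) (fun h h1 => HD _ (nrm h h1)).
by rewrite /Phi' scale0r addr0.
Qed.

Lemma pint_partial F j p : ldom F -> ldom (partial (rshift m j) F) ->
  (forall w, derivable F w (delta_mx 0 (rshift m j) : 'rV[R]_(m + n))) ->
  pint (partial (rshift m j) F) p = 0.
Proof.
move=> lF lF' der.
have [C HC] := ldom_dom1 p lF; have [D HD] := ldom_dom1 p lF'.
have d w : is_derive w (delta_mx 0 j : 'rV[R]_n) (fun y => F (row_mx p y))
    (partial (rshift m j) F (row_mx p w)).
  apply/is_derive_lineP.
  have e h : row_mx p (w + h *: delta_mx 0 j) = row_mx p w + h *: delta_mx 0 (rshift m j).
    apply/rowP => k; rewrite [RHS]mxE; case: (split_ordP k) => k' ->.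
      by rewrite !row_mxEl !mxE eq_lrshift andbF mulr0 addr0.
    rewrite !row_mxEr [LHS]mxE; congr (_ + _).
    by rewrite !mxE (inj_eq (@rshift_inj _ _)).
  under eq_fun do rewrite e.
  by apply/is_derive_lineP; apply: DeriveDef.
have pe : partial j (fun y => F (row_mx p y)) = fun y => partial (rshift m j) F (row_mx p y).
  by apply/funext => w; rewrite (partial_of_is_derive (d w)).
rewrite /pint -pe; apply: (rint_partial HC) => [|w]; first by rewrite pe; exact: HD.
by have [] := d w.
Qed.

Lemma ldom_lin F G a b : ldom F -> ldom G -> ldom (fun w => a * F w + b * G w).
Proof.
move=> [cF bF] [cG bG]; split=> [|r].
  by apply: continuous_add; apply: continuous_mul => //; exact: cst_continuous.
have [C HC] := bF r; have [D HD] := bG r.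
exists (`|a| * C + `|b| * D) => p pr y; rewrite mulrDl.
apply: (le_trans (ler_normD _ _)); rewrite !normrM lerD// -mulrA ler_wpM2l//.
  exact: HC.
exact: HD.
Qed.

Lemma pint_lin F G a b p : ldom F -> ldom G ->
  pint (fun w => a * F w + b * G w) p = a * pint F p + b * pint G p.
Proof.
move=> lF lG; have [C HC] := ldom_dom1 p lF; have [D HD] := ldom_dom1 p lG.
exact: (rint_lin a b HC HD).
Qed.

Lemma ldom_param F (g : 'rV[R]_m -> R) : continuous g ->
  (forall r, exists C, forall p, `|p| <= r -> `|g p| <= C) ->
  ldom F -> ldom (fun w => g (lsubmx w) * F w).
Proof.
move=> cg bg [cF bF]; split=> [|r].
  apply: continuous_mul cF; apply: (continuous_compose _ cg).
  apply: continuous_rV => i.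
  have -> : (fun w : 'rV[R]_(m + n) => lsubmx w 0 i) = (fun w => w 0 (lshift n i)).
    by apply/funext => v; rewrite mxE.
  exact: coord_continuous.
have [C HC] := bg r; have [D HD] := bF r.
exists (C * D) => p pr y; rewrite row_mxKl normrM -mulrA.
by apply: ler_pM => //; [exact: HC|exact: HD].
Qed.

Lemma pint_param F (g : 'rV[R]_m -> R) p : ldom F ->
  pint (fun w => g (lsubmx w) * F w) p = g p * pint F p.
Proof.
move=> lF; have [C HC] := ldom_dom1 p lF; rewrite /pint -(rintZ (g p) HC).
by apply: eq_rint => y; rewrite row_mxKl.
Qed.

Lemma pint_bound F p C : continuous F -> (forall y, `|F (row_mx p y)| <= C * rho y) ->
  `|pint F p| <= C * pi ^+ n.
Proof.
move=> cF HC; apply: rint_bound; split=> //.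
apply: (continuous_compose _ cF).
by apply: continuous_row_mx; [exact: cst_continuous|exact: continuous_idfun].
Qed.
End ParametricIntegrals.

(** * Oscillatory integrals *)

Section Coordinates.
Context (R : realType).

Lemma is_derive_coord n (k i : 'I_n) (x : 'rV[R]_n) :
  is_derive x (delta_mx 0 i : 'rV[R]_n) (fun w : 'rV[R]_n => w 0 k) (i == k)%:R.
Proof.
apply/is_derive_lineP.
have -> : (fun h : R => (x + h *: (delta_mx 0 i : 'rV[R]_n)) 0 k) = (fun h : R => x 0 k + (i == k)%:R * h).
  by apply/funext => h; rewrite !mxE eqxx /= eq_sym mulrC.
have hid := @is_derive_id R R 0 1; have hM := is_deriveM (@is_derive_cst R R R (i == k)%:R 0 1) hid.
have hD := is_deriveD (@is_derive_cst R R R (x 0 k) 0 1) hM.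
apply: (is_derive_eq hD); rewrite /GRing.scale /=; ring.
Qed.

Lemma rsmooth_of_partials n (f : 'rV[R]_n -> R) : continuous f ->
  (forall i x, derivable f x (delta_mx 0 i : 'rV[R]_n)) ->
  (forall i, rsmooth (partial i f)) -> rsmooth f.
Proof.
move=> cf df sf; elim/last_ind => [//|l i _].
by rewrite -cats1 partials_cat; exact: sf.
Qed.

Lemma rsmooth_coord n (k : 'I_n) : rsmooth (fun w : 'rV[R]_n => w 0 k).
Proof.
apply: rsmooth_of_partials => [|i x|i]; first exact: coord_continuous.
  by have [] := is_derive_coord k i x.
rewrite (_ : partial i _ = fun=> (i == k)%:R); first exact: rsmooth_cst.
by apply/funext => x; rewrite (partial_of_is_derive (is_derive_coord k i x)).
Qed.

Lemma partial_coord n (k i : 'I_n) :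
  partial i (fun w : 'rV[R]_n => w 0 k) = fun=> (i == k)%:R.
Proof.
by apply/funext => x; rewrite (partial_of_is_derive (is_derive_coord k i x)).
Qed.

Lemma is_derive_chain n (g : R -> R) (f : 'rV[R]_n -> R) x v dg df :
  is_derive (f x) (1 : R) g dg -> is_derive x v f df ->
  is_derive x v (fun w => g (f w)) (dg * df).
Proof.
move=> hg /is_derive_lineP hf; apply/is_derive_lineP.
have hg' : is_derive (f (x + 0 *: v)) (1 : R) g dg by rewrite scale0r addr0.
exact: (is_derive1_comp hg' hf).
Qed.
End Coordinates.

Section Oscillation.
Context (R : realType) (d : nat).
Local Notation X := 'rV[R]_d.
Local Notation pr1 w := (lsubmx (lsubmx (w : 'rV[R]_((d + d) + d)))).
Local Notation pr2 w := (rsubmx (lsubmx (w : 'rV[R]_((d + d) + d)))).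
Local Notation pr3 w := (rsubmx (w : 'rV[R]_((d + d) + d))).
(** Points of the amplitude space are [((x, xi), z)]; [ix1], [ix2] and [ix3] are
    the directions of [x], [xi] and [z]. *)
Definition ix1 (i : 'I_d) : 'I_((d + d) + d) := lshift d (lshift d i).
Definition ix2 (i : 'I_d) : 'I_((d + d) + d) := lshift d (rshift d i).
Definition ix3 (i : 'I_d) : 'I_((d + d) + d) := rshift (d + d) i.

Definition phase (w : 'rV[R]_((d + d) + d)) : R := \sum_j w 0 (ix3 j) * w 0 (ix2 j).

Lemma phaseE w : phase w = dotv (pr3 w) (pr2 w).
Proof. by apply: eq_bigr => j _; rewrite !mxE. Qed.

Lemma rsmooth_phase_term j : rsmooth (fun w : 'rV[R]_((d + d) + d) => w 0 (ix3 j) * w 0 (ix2 j)).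
Proof. by apply: (@rsmoothM _ _ (fun w : 'rV[R]_((d + d) + d) => w 0 (ix3 j)) (fun w => w 0 (ix2 j))); exact: rsmooth_coord. Qed.

Lemma rsmooth_phase : rsmooth phase.
Proof.
have -> : phase = (fun w => \sum_(j <- index_enum 'I_d) 1 * (w 0 (ix3 j) * w 0 (ix2 j))).
  by apply/funext => w; apply: eq_bigr => j _; rewrite mul1r.
apply: (partials_sum _ (fun=> 1) (F := fun j w => w 0 (ix3 j) * w 0 (ix2 j)) _).1 => j.
exact: rsmooth_phase_term.
Qed.

Lemma partial_phase k w : partial k phase w =
  \sum_j ((k == ix3 j)%:R * w 0 (ix2 j) + w 0 (ix3 j) * (k == ix2 j)%:R).
Proof.
have -> : phase = (fun w => \sum_(j <- index_enum 'I_d) 1 * (w 0 (ix3 j) * w 0 (ix2 j))).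
  by apply/funext => {}w; apply: eq_bigr => j _; rewrite mul1r.
have /(congr1 (fun f => f w)) := (partials_sum (index_enum 'I_d) (fun=> 1) rsmooth_phase_term).2 [:: k].
move=> /= e; apply: (etrans e); apply: eq_bigr => j _; rewrite mul1r.
rewrite (@partialM _ _ (fun w : 'rV[R]_((d + d) + d) => w 0 (ix3 j)) (fun w => w 0 (ix2 j))); try exact: rsmooth_coord.
by rewrite !partial_coord.
Qed.

Lemma partial_phase1 i w : partial (ix1 i) phase w = 0.
Proof.
rewrite partial_phase big1 // => j _.
by rewrite /ix1 /ix2 /ix3 eq_lrshift (inj_eq (@lshift_inj _ _)) eq_lrshift mul0r mulr0 addr0.
Qed.

Lemma partial_phase2 i w : partial (ix2 i) phase w = w 0 (ix3 i).
Proof.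
rewrite partial_phase (bigD1 i)//= big1 => [|j ji].
  by rewrite /ix2 /ix3 eq_lrshift eqxx mul0r mulr1 add0r addr0.
rewrite /ix2 /ix3 eq_lrshift (inj_eq (@lshift_inj _ _)) (inj_eq (@rshift_inj _ _)).
by rewrite eq_sym (negbTE ji) mul0r mulr0 addr0.
Qed.

Lemma partial_phase3 i w : partial (ix3 i) phase w = w 0 (ix2 i).
Proof.
rewrite partial_phase (bigD1 i)//= big1 => [|j ji].
  by rewrite /ix2 /ix3 eq_rlshift eqxx mul1r mulr0 !addr0.
rewrite /ix2 /ix3 eq_rlshift (inj_eq (@rshift_inj _ _)).
by rewrite eq_sym (negbTE ji) mul0r mulr0 addr0.
Qed.

(** The phase shift [th] covers real and imaginary part at once, and turns
    differentiation of the trigonometric factor into a shift by [pi / 2]. *)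
Definition osc (th : R) (b : 'rV[R]_((d + d) + d) -> R) : 'rV[R]_((d + d) + d) -> R :=
  fun w => cos (phase w + th) * b w.

(** A derivative falls either on the phase, which shifts the angle, or on the
    amplitude. *)
Lemma is_derive_osc th b k w : rsmooth b ->
  is_derive w (delta_mx 0 k : 'rV[R]_((d + d) + d)) (osc th b)
    (partial k phase w * osc (th + pi / 2) b w + osc th (partial k b) w).
Proof.
move=> sb.
have dph := DeriveDef (@rsmooth_derivable _ _ _ w k rsmooth_phase) erefl.
have dphth := is_deriveD dph (is_derive_cst th w (delta_mx 0 k)).
have dc := is_derive_chain (g := cos) (is_derive_cos (phase w + th)) dphth.
have db := DeriveDef (@rsmooth_derivable _ _ _ w k sb) erefl.
have D := is_deriveM dc db.
apply: (is_derive_eq D).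
by rewrite /osc addrA cosDpihalf /partial addr0 /GRing.scale /=; ring.
Qed.

Lemma derivable_osc th b k w : rsmooth b ->
  derivable (osc th b) w (delta_mx 0 k : 'rV[R]_((d + d) + d)).
Proof. by move=> sb; have [] := is_derive_osc th k w sb. Qed.

Lemma partial_osc th b k : rsmooth b ->
  partial k (osc th b) =
  fun w => partial k phase w * osc (th + pi / 2) b w + osc th (partial k b) w.
Proof.
move=> sb; apply/funext => w.
by rewrite (partial_of_is_derive (is_derive_osc th k w sb)).
Qed.

Lemma continuous_osc th b : rsmooth b -> continuous (osc th b).
Proof.
move=> sb; apply: continuous_mul (rsmooth_continuous sb).
apply: (continuous_compose _ (@continuous_cos R)).
by apply: continuous_add; [exact: rsmooth_continuous rsmooth_phase|exact: cst_continuous].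
Qed.

Lemma osc_le th b w : `|osc th b w| <= `|b w|.
Proof.
rewrite /osc normrM ler_piMl//.
by rewrite ler_norml cos_geN1 cos_le1.
Qed.

Lemma osc_mulr th b (g : 'rV[R]_((d + d) + d) -> R) w : osc th (fun w => g w * b w) w = g w * osc th b w.
Proof. by rewrite /osc mulrCA. Qed.
End Oscillation.

Section Amplitudes.
Context (R : realType) (d : nat) (s sigma : R).
Hypotheses (s0 : 0 < s) (sigma0 : 0 < sigma).
Local Notation W3 := ('rV[R]_((d + d) + d)).
Local Notation pr1 w := (lsubmx (lsubmx (w : W3))).
Local Notation pr2 w := (rsubmx (lsubmx (w : W3))).
Local Notation pr3 w := (rsubmx (w : W3)).
Implicit Types (V : 'rV[R]_d -> R) (b : W3 -> R).

(** The directions of [x] and [z] have Gevrey order [sigma], those of [xi] have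
    order [s]. *)
Definition space_dir3 : pred 'I_((d + d) + d) := fun k =>
  match fintype.split k with
  | inl k' => match fintype.split k' with inl _ => true | inr _ => false end
  | inr _ => true end.

Lemma space_dir3_1 i : space_dir3 (ix1 i). Proof. by rewrite /space_dir3 /ix1 !(unsplitK (inl _)). Qed.
Lemma space_dir3_2 i : space_dir3 (ix2 i) = false.
Proof. by rewrite /space_dir3 /ix2 (unsplitK (inl _)) (unsplitK (inr _)). Qed.
Lemma space_dir3_3 i : space_dir3 (ix3 i). Proof. by rewrite /space_dir3 /ix3 (unsplitK (inr _)). Qed.

(** Nothing is asked of [V] beyond local boundedness; growth in [xi] is allowed
    and is overcome by integration by parts in [z]. *)
Definition amp_weight V r (w : W3) : R :=
  V (pr1 w) * expR (r * `|pr2 w| `^ sigma^-1) * rho (pr3 w).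

Definition locally_bounded V := forall r : R, exists C, forall x : 'rV[R]_d, `|x| <= r -> V x <= C.

Local Notation amp := (gevrey sigma s space_dir3).

(** The rate given by [exp_of_moments] for Gevrey constant [h]. *)
Definition freq_decay (h : R) : R := sigma / (2 * h `^ sigma^-1).

Lemma freq_decay_gt0 h : 0 < h -> 0 < freq_decay h.
Proof. by move=> h0; rewrite divr_gt0// mulr_gt0// powR_gt0. Qed.

Lemma ldom_amp_weight (F : W3 -> R) V r C : continuous F -> locally_bounded V -> (forall x, 0 <= V x) -> 0 <= r -> 0 <= C ->
  (forall w, `|F w| <= C * amp_weight V r w) -> ldom F.
Proof.
move=> cF bV V0 r0 C0 FW; split=> // q.
have [D HD] := bV q.
exists (C * (D * expR (r * q `^ sigma^-1))) => p pq y.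
apply: (le_trans (FW _)); rewrite /amp_weight row_mxKl row_mxKr.
rewrite -(mulrA C); apply: ler_wpM2l => //; apply: ler_wpM2r; first exact: rho_ge0.
have lp : `|lsubmx p| <= q /\ `|rsubmx p| <= q.
  split; apply: le_trans pq; rewrite -{2}[p]hsubmxK;
    [exact: norm_row_mxl|exact: norm_row_mxr].
apply: ler_pM; rewrite ?expR_ge0//; first exact: HD lp.1.
rewrite ler_expR; apply: ler_wpM2l => //; apply: powR_le lp.2 => //.
by rewrite invr_ge0 ltW.
Qed.

Lemma ldom_osc th b h V r : amp h (amp_weight V r) b -> locally_bounded V -> (forall x, 0 <= V x) -> 0 <= r -> ldom (osc th b).
Proof.
move=> ab bV V0 r0; apply: (ldom_amp_weight (C := 1) _ bV V0 r0) => // [|w].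
  exact: continuous_osc ab.1.
by rewrite mul1r; apply: (le_trans (osc_le _ _ _)); exact: gevrey_norm_le ab.
Qed.

(** With [p = (x, xi)] this is INT_z cos(<z, xi> + th) b(x, xi, z). *)
Definition Jint th b : 'rV[R]_(d + d) -> R := pint (osc th b).
(** INT_xi INT_z cos(<z, xi> + th) b(x, xi, z), a real piece of the operator. *)
Definition Iint th b : 'rV[R]_d -> R := pint (Jint th b).

Lemma amp_partials h V r b l : 0 <= h -> amp h (amp_weight V r) b ->
  let H := 2 `^ sigma * 2 `^ s * h in
  amp H (amp_weight (fun x => H ^+ size l * gevrey_fact sigma s space_dir3 l * V x) r) (partials l b).
Proof.
move=> h0 ab H.
have H0 : 0 <= H by rewrite !mulr_ge0 ?powR_ge0.
apply: (gevrey_le H0 (lexx _) _ (gevrey_partials (ltW sigma0) (ltW s0) l h0 ab)) => w.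
by rewrite /amp_weight !mulrA.
Qed.

Lemma bounded_coord n (k : 'I_n) r : exists C, forall p : 'rV[R]_n, `|p| <= r -> `|p 0 k| <= C.
Proof. by exists r => p pq; apply: le_trans pq; exact: coord_le_norm. Qed.

(** [p 0 (rshift d j)] is the frequency xi_j, which is the derivative of the
    phase in z_j; integrating by parts in z_j moves it onto the amplitude. *)
Lemma Jint_parts th b j (p : 'rV[R]_(d + d)) : rsmooth b ->
  (forall th, ldom (osc th b)) -> (forall th, ldom (osc th (partial (ix3 j) b))) ->
  p 0 (rshift d j) * Jint th b p = - Jint (th - pi / 2) (partial (ix3 j) b) p.
Proof.
move=> sb lo lo'.
pose g (q : 'rV[R]_(d + d)) := q 0 (rshift d j).
have pe : partial (rshift (d + d) j) (osc (th - pi / 2) b) =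
   (fun w => 1 * (g (lsubmx w) * osc th b w) + 1 * osc (th - pi / 2) (partial (ix3 j) b) w).
  apply/funext => w; rewrite (partial_osc _ (ix3 j) sb) partial_phase3 subrK !mul1r.
  by rewrite /g [lsubmx w 0 _]mxE.
have l1 : ldom (fun w => g (lsubmx w) * osc th b w).
  by apply: ldom_param => //; [exact: coord_continuous|exact: bounded_coord].
have l2 := ldom_lin 1 1 l1 (lo' (th - pi / 2)).
have := @pint_partial R (d + d) d (osc (th - pi / 2) b) j p (lo _).
rewrite pe => /(_ l2 (fun w => @derivable_osc R d _ _ _ w sb)).
rewrite (pint_lin _ _ _ l1 (lo' _)) (pint_param g)// !mul1r => /eqP.
by rewrite addr_eq0 => /eqP.
Qed.

(** The growth rate [r] in [xi] stays below half of the decay rate produced by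
    integration by parts in [z], which leaves room for integrability. *)
Definition admissible h r V b := [/\ amp h (amp_weight V r) b, locally_bounded V, forall x, 0 <= V x, 0 <= r & r <= freq_decay h / 2].

Lemma admissible_smooth h r V b : admissible h r V b -> rsmooth b.
Proof. by case=> -[]. Qed.

Lemma admissible_ldom h r V b th : admissible h r V b -> ldom (osc th b).
Proof. by case=> ab bV V0 r0 _; exact: ldom_osc ab bV V0 r0. Qed.

Lemma admissible_partials_ldom h r V b l th : 0 < h -> admissible h r V b -> ldom (osc th (partials l b)).
Proof.
move=> h0 [ab bV V0 r0 _]; apply: (ldom_osc th (amp_partials l (ltW h0) ab)) => //; last first.
  move=> x; rewrite mulr_ge0// mulr_ge0 ?gevrey_fact_ge0// exprn_ge0//.
  by rewrite !mulr_ge0 ?powR_ge0// ltW.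
move=> q; have [C HC] := bV q; eexists => x xq; apply: ler_wpM2l (HC _ xq).
rewrite mulr_ge0 ?gevrey_fact_ge0// exprn_ge0//.
by rewrite !mulr_ge0 ?powR_ge0// ltW.
Qed.

Lemma Jint_iter h r V b j l k th (p : 'rV[R]_(d + d)) : 0 < h -> admissible h r V b ->
  exists th', `|p 0 (rshift d j)| ^+ k * `|Jint th (partials l b) p| =
    `|Jint th' (partials (nseq k (ix3 j) ++ l) b) p|.
Proof.
move=> h0 gb; elim: k l th => [|k IH] l th; first by exists th; rewrite mul1r.
rewrite exprSr -mulrA -normrM.
rewrite (@Jint_parts _ _ j p (rsmooth_partials l (admissible_smooth gb)) (fun th => admissible_partials_ldom l th h0 gb)
  (fun th => admissible_partials_ldom (ix3 j :: l) th h0 gb)) normrN.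
have [th' e] := IH (ix3 j :: l) (th - pi / 2); exists th'; rewrite [LHS]e.
congr (`|Jint _ (partials _ _) _|).
by elim: (k) => //= k' ->.
Qed.

Lemma Jint_moment h r V b j k th (p : 'rV[R]_(d + d)) : 0 < h -> admissible h r V b ->
  `|p 0 (rshift d j)| ^+ k * `|Jint th b p| <=
  V (lsubmx p) * expR (r * `|rsubmx p| `^ sigma^-1) * pi ^+ d * h ^+ k * factpow sigma k.
Proof.
move=> h0 gb; have [th' ->] := Jint_iter j [::] k th p h0 gb.
rewrite cats0; have [ab _ _ _ _] := gb.
apply: (@le_trans _ _ ((V (lsubmx p) * expR (r * `|rsubmx p| `^ sigma^-1) * (h ^+ k * factpow sigma k)) * pi ^+ d)); last first.
  by apply: eq_ler; ring.
apply: pint_bound => [|y].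
  exact: continuous_osc (rsmooth_partials _ (admissible_smooth gb)).
apply: (le_trans (osc_le _ _ _)); apply: (le_trans (ab.2 _ _)).
rewrite /amp_weight row_mxKl row_mxKr /gevrey_fact !count_nseq size_nseq /= space_dir3_3 /= mul1n mul0n factpow0 mulr1.
by apply: eq_ler; ring.
Qed.

(** Integration by parts in [z] bounds all the moments in [xi]; the Gevrey order
    [sigma] in [z] turns them into exponential decay. *)
Lemma Jint_decay h r V b th (p : 'rV[R]_(d + d)) : 0 < h -> admissible h r V b ->
  `|Jint th b p| <= 2 `^ sigma * (V (lsubmx p) * expR (r * `|rsubmx p| `^ sigma^-1) * pi ^+ d) *
     expR (- (freq_decay h * `|rsubmx p| `^ sigma^-1)).
Proof.
move=> h0 gb; have [_ _ V0 r0 _] := gb.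
apply: exp_of_moments => // [|k].
  by rewrite !mulr_ge0 ?expR_ge0 ?exprn_ge0 ?pi_ge0.
have [z|/mx_norm_neq0[[i j] e]] := eqVneq (mx_norm (rsubmx p)) 0.
  have -> : `|rsubmx p| = 0 by exact: z.
  case: k => [|k]; last first.
    by rewrite expr0n mul0r !mulr_ge0 ?expR_ge0 ?exprn_ge0 ?pi_ge0 ?factpow_ge0 ?(ltW h0).
  rewrite expr0 mul1r factpow0 !mulr1.
  apply: (@le_trans _ _ ((V (lsubmx p) * expR (r * `|rsubmx p| `^ sigma^-1)) * pi ^+ d)); last first.
    by rewrite (_ : `|rsubmx p| = 0).
  have [ab _ _ _ _] := gb.
  apply: pint_bound => [|y]; first exact: continuous_osc (admissible_smooth gb).
  apply: (le_trans (osc_le _ _ _)); apply: (le_trans (gevrey_norm_le _ ab)).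
  by rewrite /amp_weight row_mxKl row_mxKr.
have -> : `|rsubmx p| ^+ k = `|p 0 (rshift d j)| ^+ k.
  by rewrite [`|rsubmx p|]e /= (ord1 i) mxE.
exact: Jint_moment gb.
Qed.

(** The constant depends on the Gevrey constant alone, uniformly in the
    amplitude. *)
Lemma Jint_bound h : 0 < h -> exists2 K, 0 < K & forall th b V r (p : 'rV[R]_(d + d)),
  admissible h r V b -> `|Jint th b p| <= K * V (lsubmx p) * rho (rsubmx p).
Proof.
move=> h0; have c20 : 0 < freq_decay h / 2 by rewrite divr_gt0 ?freq_decay_gt0.
have [K K0 HK] := exp_le_rho d sigma0 c20.
exists (2 `^ sigma * pi ^+ d * K); first by rewrite !mulr_gt0 ?powR_gt0 ?exprn_gt0 ?pi_gt0.
move=> th b V r p gb; have [_ _ V0 r0 rc] := gb.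
apply: (le_trans (Jint_decay _ _ h0 gb)).
set t := `|rsubmx p| `^ _.
have e : expR (r * t) * expR (- (freq_decay h * t)) <= K * rho (rsubmx p).
  apply: le_trans (HK _); rewrite -expRD ler_expR -/t.
  have t0 : 0 <= t by exact: powR_ge0.
  have : r * t <= freq_decay h / 2 * t by rewrite ler_wpM2r.
  by lra.
rewrite [leLHS](_ : _ = (2 `^ sigma * pi ^+ d * V (lsubmx p)) * (expR (r * t) * expR (- (freq_decay h * t)))); last by ring.
rewrite [leRHS](_ : _ = (2 `^ sigma * pi ^+ d * V (lsubmx p)) * (K * rho (rsubmx p))); last by ring.
by apply: ler_wpM2l e; rewrite !mulr_ge0 ?powR_ge0 ?exprn_ge0 ?pi_ge0.
Qed.

Lemma Jint_continuous h r V b th : admissible h r V b -> continuous (Jint th b).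
Proof. by move=> gb; apply: pint_continuous; exact: admissible_ldom gb. Qed.

Lemma Jint_ldom h r V b th : 0 < h -> admissible h r V b -> ldom (Jint th b).
Proof.
move=> h0 gb; split; first exact: Jint_continuous gb.
move=> q; have [_ bV V0 _ _] := gb; have [D HD] := bV q.
have [K K0 HK] := Jint_bound h0.
exists (K * D) => p pq y; apply: (le_trans (HK _ _ _ _ _ gb)).
by rewrite row_mxKl row_mxKr ler_wpM2r ?rho_ge0// ler_wpM2l ?(ltW K0)// HD.
Qed.

Lemma Iint_bound h : 0 < h -> exists2 K, 0 < K & forall th b V r x,
  admissible h r V b -> `|Iint th b x| <= K * V x.
Proof.
move=> h0; have [K K0 HK] := Jint_bound h0.
exists (K * pi ^+ d); first by rewrite mulr_gt0// exprn_gt0// pi_gt0.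
move=> th b V r x gb; rewrite mulrAC; apply: pint_bound => [|y].
  exact: Jint_continuous gb.
by have := HK th b V r (row_mx x y) gb; rewrite row_mxKl row_mxKr.
Qed.

Lemma partial_Jint1 h r V h' r' V' b i th : 0 < h -> 0 < h' ->
  admissible h r V b -> admissible h' r' V' (partial (ix1 i) b) ->
  forall p, is_derive p (delta_mx 0 (lshift d i) : 'rV[R]_(d + d)) (Jint th b)
     (Jint th (partial (ix1 i) b) p).
Proof.
move=> h0 h'0 gb gb' p.
have e : partial (lshift d (lshift d i)) (osc th b) = osc th (partial (ix1 i) b).
  rewrite (partial_osc _ (ix1 i) (admissible_smooth gb)); apply/funext => w.
  by rewrite partial_phase1 mul0r add0r.
have := @pint_derive R (d + d) d (osc th b) (lshift d i) p (admissible_ldom th gb).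
rewrite e; apply; first exact: admissible_ldom gb'.
by move=> w; exact: derivable_osc (admissible_smooth gb).
Qed.

(** The phase does not involve [x], so derivatives in [x] fall on the amplitude. *)
Lemma is_derive_Iint h r V h' r' V' b i th x : 0 < h -> 0 < h' ->
  admissible h r V b -> admissible h' r' V' (partial (ix1 i) b) ->
  is_derive x (delta_mx 0 i : 'rV[R]_d) (Iint th b) (Iint th (partial (ix1 i) b) x).
Proof.
move=> h0 h'0 gb gb'.
have dJ := partial_Jint1 th h0 h'0 gb gb'.
have e : partial (lshift d i) (Jint th b) = Jint th (partial (ix1 i) b).
  by apply/funext => p; rewrite (partial_of_is_derive (dJ p)).
have := @pint_derive R d d (Jint th b) i x (Jint_ldom th h0 gb).
rewrite e; apply; first exact: (Jint_ldom th h'0 gb').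
by move=> p; have [] := dJ p.
Qed.

(** A coordinate of [x - eps z], the point at which the test function is
    evaluated. *)
Definition ycoord (eps : R) j (w : W3) : R := w 0 (ix1 j) - eps * w 0 (ix3 j).

(** Writes x_j as (x_j - eps z_j) + eps z_j.  The factor z_j is the derivative
    of the phase in xi_j, and integration by parts in xi_j moves it onto the
    amplitude. *)
Lemma Iint_mulx eps h r V h' r' V' h'' r'' V'' b j th (x : 'rV[R]_d) : eps ^+ 2 = 1 ->
  0 < h -> 0 < h' -> 0 < h'' ->
  admissible h r V b -> admissible h' r' V' (fun w => ycoord eps j w * b w) ->
  admissible h'' r'' V'' (partial (ix2 j) b) ->
  x 0 j * Iint th b x = Iint th (fun w => ycoord eps j w * b w) x -
     eps * Iint (th - pi / 2) (partial (ix2 j) b) x.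
Proof.
move=> e2 h0 h'0 h''0 gb gy gx.
set yb := (fun w => _) in gy *; set xb := partial _ _ in gx *.
have sb := admissible_smooth gb.
pose g (q : 'rV[R]_(d + d)) := q 0 (lshift d j).
have cg : continuous g by exact: coord_continuous.
pose th' := th - pi / 2.
(* The derivative of the integrand in xi_j.  The phase contributes the factor
   z_j, which equals eps (x_j - y_j) with y = x - eps z because eps^2 = 1. *)
pose zb w := 1 * (eps * (g (lsubmx w) * osc th b w) + (- eps) * osc th yb w) + 1 * osc th' xb w.
have pe : partial (lshift d (rshift d j)) (osc th' b) = zb.
  apply/funext => w; rewrite (partial_osc _ (ix2 j) sb) partial_phase2 /th' subrK /zb !mul1r.
  congr (_ + _); rewrite /yb osc_mulr /ycoord /g [lsubmx w 0 _]mxE.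
  rewrite [LHS](_ : _ = eps ^+ 2 * w 0 (ix3 j) * osc th b w); last by rewrite e2 mul1r.
  by rewrite -/(ix1 j); ring.
have lg : ldom (fun w => g (lsubmx w) * osc th b w).
  by apply: ldom_param => //; [exact: bounded_coord|exact: admissible_ldom gb].
have l1 := ldom_lin eps (- eps) lg (admissible_ldom th gy).
have lz : ldom zb := ldom_lin 1 1 l1 (admissible_ldom th' gx).
have dJ p : is_derive p (delta_mx 0 (rshift d j) : 'rV[R]_(d + d)) (Jint th' b) (pint zb p).
  have := @pint_derive R (d + d) d (osc th' b) (rshift d j) p (admissible_ldom th' gb).
  by rewrite pe; apply => // w; exact: derivable_osc sb.
have pJ : partial (rshift d j) (Jint th' b) = (fun p =>
   1 * (eps * (g p * Jint th b p) + (- eps) * Jint th yb p) + 1 * Jint th' xb p).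
  apply/funext => p; rewrite (partial_of_is_derive (dJ p)) /zb.
  rewrite (pint_lin 1 1 p l1 (admissible_ldom th' gx)) (pint_lin eps (- eps) p lg (admissible_ldom th gy)).
  by rewrite (pint_param g p (admissible_ldom th gb)).
pose g1 (x : 'rV[R]_d) := x 0 j.
have eg : g = (fun p => g1 (lsubmx p)) by apply/funext => p; rewrite /g1 mxE.
have Lg : ldom (fun p => g p * Jint th b p).
  rewrite eg; apply: ldom_param; [exact: coord_continuous|exact: bounded_coord|].
  exact: Jint_ldom gb.
have L1 := ldom_lin eps (- eps) Lg (Jint_ldom th h'0 gy).
have L := ldom_lin 1 1 L1 (Jint_ldom th' h''0 gx).
have := @pint_partial R d d (Jint th' b) j x (Jint_ldom th' h0 gb).
rewrite pJ => /(_ L (fun p => @ex_derive _ _ _ _ _ _ _ (dJ p))).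
rewrite (pint_lin 1 1 x L1 (Jint_ldom th' h''0 gx)) (pint_lin eps (- eps) x Lg (Jint_ldom th h'0 gy)).
have -> : pint (fun p => g p * Jint th b p) x = g1 x * Iint th b x.
  by rewrite eg (pint_param g1 x (Jint_ldom th h0 gb)).
rewrite -/(Iint th yb x) -/(Iint th' xb x) /g1 -/th' => E.
have : eps * (1 * (eps * (x 0 j * Iint th b x) + - eps * Iint th yb x) + 1 * Iint th' xb x) = 0.
  by rewrite E mulr0.
rewrite [LHS](_ : _ = eps ^+ 2 * (x 0 j * Iint th b x) - eps ^+ 2 * Iint th yb x + eps * Iint th' xb x); last by ring.
by rewrite e2 !mul1r => /eqP; rewrite addr_eq0 subr_eq => /eqP ->; ring.
Qed.
End Amplitudes.

(** * Gevrey bounds for monomials *)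

Section Monomials.
Context (R : realType) (d : nat) (s sigma : R).
Hypotheses (s0 : 0 < s) (sigma0 : 0 < sigma) (ss1 : 1 <= s + sigma).

Lemma rsmooth_mono (j : 'I_d) k : rsmooth (fun w : 'rV[R]_d => w 0 j ^+ k).
Proof.
elim: k => [|k IH].
  by under eq_fun do rewrite expr0; exact: rsmooth_cst.
have -> : (fun w : 'rV[R]_d => w 0 j ^+ k.+1) = (fun w => w 0 j * w 0 j ^+ k).
  by apply/funext => w; rewrite exprS.
by apply: (@rsmoothM _ _ (fun w : 'rV[R]_d => w 0 j)) => //; exact: rsmooth_coord.
Qed.

Lemma partial_mono (i j : 'I_d) k :
  partial i (fun w : 'rV[R]_d => w 0 j ^+ k) = fun w => (i == j)%:R * k%:R * w 0 j ^+ k.-1.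
Proof.
elim: k => [|k IH].
  apply/funext => x; rewrite /partial mulr0 mul0r.
  have -> : (fun w : 'rV[R]_d => w 0 j ^+ 0) = (fun=> 1) by apply/funext => w; rewrite expr0.
  exact: derive_cst.
have -> : (fun w : 'rV[R]_d => w 0 j ^+ k.+1) = (fun w => w 0 j * w 0 j ^+ k).
  by apply/funext => w; rewrite exprS.
rewrite (@partialM _ _ (fun w : 'rV[R]_d => w 0 j) (fun w => w 0 j ^+ k)); last 2 first.
- exact: rsmooth_coord.
- exact: rsmooth_mono.
rewrite IH partial_coord; apply/funext => x /=.
case: k {IH} => [|k] /=; first by rewrite !expr0; ring.
by rewrite [x 0 j ^+ k.+1]exprS -[k.+2%:R]natr1; ring.
Qed.

Lemma partials_mono_le (j : 'I_d) k l (x : 'rV[R]_d) :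
  `|partials l (fun w : 'rV[R]_d => w 0 j ^+ k) x| <= (k ^_ size l)%:R * `|x| ^+ (k - size l).
Proof.
elim/last_ind: l k => [|l i IH] k.
  rewrite ffactn0 mul1r subn0 /= normrX lerXn2r ?nnegrE//; exact: coord_le_norm.
rewrite -cats1 partials_cat /= partial_mono size_cat addn1.
have -> : (fun w : 'rV[R]_d => (i == j)%:R * k%:R * w 0 j ^+ k.-1) =
   (fun w => ((i == j)%:R * k%:R) * w 0 j ^+ k.-1 + 0 * w 0 j ^+ k.-1).
  by apply/funext => w; rewrite mul0r addr0.
rewrite partials_comb; try exact: rsmooth_mono.
rewrite mul0r addr0 normrM.
case: k => [|k]; first by rewrite mulr0 normr0 mul0r mulr_ge0// exprn_ge0.
rewrite ffactSS natrM subSS -mulrA; apply: ler_pM => //.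
by case: (i == j); rewrite ?mul1r ?mul0r ?normr0// ger0_norm.
Qed.

(** The falling factorial is [m!] times a binomial coefficient. *)
Lemma ffact_le k m : (k ^_ m <= 2 ^ k * m`!)%N.
Proof.
rewrite -bin_ffact leq_mul2r; apply/orP; right.
have [mk|km] := leqP m k; last by rewrite bin_small.
have -> : (2 = 1 + 1)%N by [].
rewrite expnDn (bigD1 (inord m)) //= !exp1n !muln1 inordK ?ltnS//.
by rewrite leq_addr.
Qed.

(** This is the place where the orders must satisfy [1 <= s + sigma]. *)
Lemma fact_le_factpow m : (m`!%:R : R) <= factpow sigma m * factpow s m.
Proof.
rewrite /factpow -powRD; last by rewrite pnatr_eq0 -lt0n fact_gt0 implybT.
apply: le_trans (_ : (m`!%:R : R) `^ 1 <= _); first by rewrite powRr1.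
by apply: ler_powR; [rewrite ler1n fact_gt0|rewrite addrC].
Qed.

(** The factor 2 pays for binomial coefficients, the other one for the moment
    bound [moment_le]. *)
Definition mono_cst (r : R) : R := 2 * (1 + (s / r) `^ s).

Lemma mono_cst_gt0 r : 0 < mono_cst r.
Proof. by rewrite mulr_gt0// ltr_pwDl// powR_ge0. Qed.

Definition mono_weight r k (x : 'rV[R]_d) : R := mono_cst r ^+ k * factpow s k * expR (r * `|x| `^ s^-1).

Lemma gevrey_one r : 0 < r -> gevrey sigma s predT 1 (mono_weight r 0) (fun _ : 'rV[R]_d => 1).
Proof.
move=> r0.
have one_le x : 1 <= mono_weight r 0 x.
  rewrite /mono_weight expr0 factpow0 !mul1r -expR0 ler_expR.
  by rewrite mulr_ge0 ?powR_ge0// ltW.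
split=> [|[|i l] x]; first exact: rsmooth_cst.
  by rewrite /= normr1 gevrey_fact_nil !mulr1.
rewrite partials_cst normr0 mulr_ge0//; first exact: le_trans ler01 (one_le x).
by rewrite mulr_ge0 ?gevrey_fact_ge0 ?exprn_ge0.
Qed.

(** An [m]-th derivative of a [k]-th power costs [m!] up to a geometric factor;
    one part of it is the allowed [m!^sigma], and the rest [m!^s] joins
    [(k - m)!^s] from the moment bound to give [k!^s]. *)
Lemma gevrey_monomial (j : 'I_d) k r : 0 < r ->
  gevrey sigma s predT 1 (mono_weight r k)
    (fun w : 'rV[R]_d => w 0 j ^+ k).
Proof.
move=> r0; split=> [|l x]; first exact: rsmooth_mono.
rewrite expr1n mul1r gevrey_factT.
apply: (le_trans (partials_mono_le j k l x)); rewrite /mono_weight.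
set m := size l; have [mk|km] := leqP m k; last first.
  by rewrite ffact_small// mul0r !mulr_ge0 ?factpow_ge0 ?expR_ge0// exprn_ge0// ltW// mono_cst_gt0.
have K1 : (s / r) `^ s <= 1 + (s / r) `^ s by rewrite lerDr.
have K2 : 1 <= 1 + (s / r) `^ s by rewrite lerDl powR_ge0.
have p1 : (k ^_ m)%:R <= (2 ^+ k * (factpow sigma m * factpow s m) : R).
  apply: (@le_trans _ _ ((2 ^ k * m`!)%N%:R)); first by rewrite ler_nat ffact_le.
  by rewrite natrM natrX ler_wpM2l ?exprn_ge0// fact_le_factpow.
have p2 : `|x| ^+ (k - m) <= (1 + (s / r) `^ s) ^+ k * factpow s (k - m) * expR (r * `|x| `^ s^-1).
  apply: (le_trans (moment_le (k - m) s0 r0 (normr_ge0 x))).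
  rewrite ler_wpM2r ?expR_ge0// ler_wpM2r ?factpow_ge0//.
  apply: (@le_trans _ _ ((1 + (s / r) `^ s) ^+ (k - m))).
    by rewrite lerXn2r// nnegrE ?powR_ge0// (le_trans _ K2).
  by rewrite ler_weXn2l// leq_subr.
apply: (le_trans (ler_pM (ler0n _ _) (exprn_ge0 _ (normr_ge0 _)) p1 p2)).
have p3 : factpow s m * factpow s (k - m) <= factpow s k.
  by rewrite -{2}(subnKC mk) factpow_mul// ltW.
rewrite [leLHS](_ : _ = (mono_cst r ^+ k * expR (r * `|x| `^ s^-1) * factpow sigma m) * (factpow s m * factpow s (k - m))); last first.
  by rewrite /mono_cst exprMn; ring.
rewrite [leRHS](_ : _ = (mono_cst r ^+ k * expR (r * `|x| `^ s^-1) * factpow sigma m) * factpow s k); last by ring.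
by apply: ler_wpM2l p3; rewrite !mulr_ge0 ?factpow_ge0 ?expR_ge0// exprn_ge0// ltW// mono_cst_gt0.
Qed.
End Monomials.

(** * The amplitude of the operator *)

Section Pullbacks.
Context (R : realType) (d : nat).

(** A crude bound for the norm of the linear map given by [L], sufficient for
    the chain rule. *)
Definition mxl1 m n (L : 'M[R]_(m, n)) : R := \sum_i \sum_k `|L i k|.

Lemma mxl1_ge0 m n (L : 'M[R]_(m, n)) : 0 <= mxl1 L.
Proof. by apply: sumr_ge0 => i _; apply: sumr_ge0. Qed.

Lemma row_le_mxl1 m n (L : 'M[R]_(m, n)) i : \sum_k `|L i k| <= mxl1 L.
Proof.
rewrite /mxl1 (bigD1 i)//= lerDl; apply: sumr_ge0 => j _; exact: sumr_ge0.
Qed.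

Definition space_dir : pred 'I_(d + d) := fun k =>
  match fintype.split k with inl _ => true | inr _ => false end.

Lemma space_dir3_lshift k : space_dir3 (lshift d k : 'I_((d + d) + d)) = space_dir k.
Proof. by rewrite /space_dir3 (unsplitK (inl _)). Qed.

(** Sends [((x, xi), z)] to [(x - z B, xi)], the argument of the symbol. *)
Definition Lsym (B : 'M[R]_d) : 'M[R]_((d + d) + d, d + d) :=
  col_mx 1%:M (row_mx (- B) 0).

(** Sends [((x, xi), z)] to [x + z Q]. *)
Definition Lpos (Q : 'M[R]_d) : 'M[R]_((d + d) + d, d) := col_mx (col_mx 1%:M 0) Q.

Lemma mul_Lsym B (p : 'rV[R]_(d + d)) z : row_mx p z *m Lsym B =
  row_mx (lsubmx p - z *m B) (rsubmx p).
Proof.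
rewrite mul_row_col mulmx1 mul_mx_row mulmx0 mulmxN -{1}[p]hsubmxK add_row_mx addr0.
by [].
Qed.

Lemma mul_Lpos Q (p : 'rV[R]_(d + d)) z : row_mx p z *m Lpos Q = lsubmx p + z *m Q.
Proof. by rewrite mul_row_col -{1}[p]hsubmxK mul_row_col mulmx1 mulmx0 addr0. Qed.

Lemma Lsym_dir B i k : Lsym B i k != 0 -> space_dir3 i = space_dir k.
Proof.
rewrite /Lsym; case: (split_ordP i) => i' ->; rewrite ?col_mxEu ?col_mxEd.
  rewrite mxE space_dir3_lshift; have [->//|_] := eqVneq i' k.
  by rewrite eqxx.
case: (split_ordP k) => k' ->; rewrite ?row_mxEl ?row_mxEr => H.
  by rewrite -/(ix3 i') space_dir3_3 /space_dir (unsplitK (inl _)).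
by rewrite mxE eqxx in H.
Qed.

Lemma Lpos_dir Q i k : Lpos Q i k != 0 -> space_dir3 i = predT k.
Proof.
rewrite /Lpos; case: (split_ordP i) => i' ->; rewrite ?col_mxEu ?col_mxEd; last by rewrite space_dir3_3.
case: (split_ordP i') => i'' ->; rewrite ?col_mxEu ?col_mxEd; first by rewrite space_dir3_1.
by rewrite mxE eqxx.
Qed.

Local Notation dir2 := (space_dir : pred 'I_(d + d)).
Local Notation dir3 := (@space_dir3 d).

Lemma gevrey_linear (s1 s2 : R) m n (cm : pred 'I_m) (cn : pred 'I_n) (L : 'M[R]_(m, n)) h W F :
  (forall i k, L i k != 0 -> cm i = cn k) -> 0 <= h -> gevrey s1 s2 cn h W F ->
  gevrey s1 s2 cm (mxl1 L * h) (fun w => W (w *m L)) (fun w => F (w *m L)).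
Proof.
move=> Lc h0 gF.
have := gevrey_affine 0 Lc (row_le_mxl1 L) h0 (mxl1_ge0 _) gF.
by under eq_fun do rewrite addr0; under [X in gevrey _ _ _ _ _ X]eq_fun do rewrite addr0.
Qed.
End Pullbacks.

(** [U], [X], [Y], [Z], [Xi] stand for the powers of the norms of [x - z B],
    [x], [x - eps z], [z], [xi].  The decay [c Y] pays for a monomial in
    [x - eps z], for the growth in [x - z B] and for decay in [z], at the price
    of small growth in [x]. *)
Lemma exp_trade (R : realType) (c kap r rh rz tp U X Y Z Xi : R) :
  0 <= X -> 0 <= Y -> 0 <= r -> 0 <= rz -> 0 < tp ->
  U <= kap * (X + Y) -> Z <= tp * (X + Y) ->
  r * kap <= c / 4 -> r * kap <= rh / 2 -> rz <= c / 2 -> rz <= rh / 2 ->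
  expR (c / 4 * Y) * (expR (r * (U + Xi)) * expR (- (c * Y))) <=
  expR (rh * X) * expR (r * Xi) * expR (- (rz / tp * Z)).
Proof.
move=> X0 Y0 r0 rz0 tp0 hU hZ r2 r3 rz1 rz2.
rewrite -(expRD (r * _)) -(expRD (c / 4 * Y)) -(expRD (rh * X)) -(expRD (rh * X + _)) ler_expR.
have e1 : rz / tp * Z <= rz * (X + Y).
  by rewrite mulrAC ler_pdivrMr// -mulrA ler_wpM2l// mulrC.
have e2 : r * U <= r * kap * (X + Y) by rewrite -mulrA ler_wpM2l.
have e3 : r * kap * X <= rh / 2 * X by rewrite ler_wpM2r.
have e4 : r * kap * Y <= c / 4 * Y by rewrite ler_wpM2r.
have e5 : rz * X <= rh / 2 * X by rewrite ler_wpM2r.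
have e6 : rz * Y <= c / 2 * Y by rewrite ler_wpM2r.
rewrite !mulrDr in e1 e2 *; lra.
Qed.

Lemma mulr_shuffle (R : comPzRingType) (f g G C N P E F K z : R) :
  f * g * G * (C * N) * (P * (E * F * (K * z))) =
  P * (f * g) * G * (C * K * N * E) * F * z.
Proof. ring. Qed.

Lemma expR_halve (R : realType) (u y : R) :
  expR (u / 2 * y) * expR (- (u * y)) = expR (- (u / 2 * y)).
Proof. by rewrite -expRD; congr expR; lra. Qed.

Section MainEstimate.
Context (R : realType) (d : nat) (s sigma : R).
Hypotheses (s0 : 0 < s) (sigma0 : 0 < sigma) (ss1 : 1 <= s + sigma).
Variables (eps : R) (B : 'M[R]_d).
Hypothesis eps2 : eps ^+ 2 = 1.
Local Notation dir2 := (@space_dir d).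
Local Notation dir3 := (@space_dir3 d).
Local Notation p := (s^-1).
Local Notation q := (sigma^-1).
Implicit Types (a : 'rV[R]_(d + d) -> R) (f : 'rV[R]_d -> R).

(** Weights use the maximum norm, for which linear maps are easily estimated; it
    is equivalent to the Euclidean one. *)
Definition symbol_bound (ha : R) a := forall r, 0 < r -> exists2 C, 0 < C &
  gevrey sigma s dir2 ha
    (fun w => C * expR (r * (`|lsubmx w| `^ p + `|rsubmx w| `^ q))) a.

(** The weight expresses decay in [x] directly instead of through moments. *)
Definition test_bound (hf c N : R) f :=
  gevrey sigma s predT hf (fun y => N * expR (- (c * `|y| `^ p))) f.

Definition amplitude a f : 'rV[R]_((d + d) + d) -> R :=
  fun w => a (w *m Lsym B) * f (w *m Lpos (- eps)%:M).

Lemma p_ge0 : 0 <= p. Proof. by rewrite invr_ge0 ltW. Qed.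

Let kap : R := (1 + mxl1 B) `^ p * 2 `^ p.

Lemma kap_gt0 : 0 < kap.
Proof. by rewrite mulr_gt0// powR_gt0// ltr_pwDl// (mxl1_ge0 B). Qed.

Lemma eps1 : `|eps| = 1.
Proof.
by apply/eqP; rewrite -(@eqrXn2 _ 2)// expr1n real_normK ?num_real// eps2.
Qed.

Lemma norm_z_le (x z : 'rV[R]_d) : `|z| <= `|x| + `|x - eps *: z|.
Proof.
have -> : `|z| = `|x - (x - eps *: z)|.
  by rewrite opprB addrC subrK normrZ eps1 mul1r.
exact: ler_normB.
Qed.

(** The argument of the symbol is controlled by [x] and [x - eps z], since [z]
    is. *)
Lemma powR_zB (x z : 'rV[R]_d) : `|x - z *m B| `^ p <= kap * (`|x| `^ p + `|x - eps *: z| `^ p).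
Proof.
have h : `|x - z *m B| <= (1 + mxl1 B) * (`|x| + `|x - eps *: z|).
  apply: (le_trans (ler_normB _ _)); rewrite mulrDl mul1r lerD ?lerDl//.
  apply: (le_trans (norm_mulmx_le z B)); apply: ler_wpM2l; first exact: mxl1_ge0.
  exact: norm_z_le.
apply: (le_trans (powR_le p_ge0 (normr_ge0 _) h)).
rewrite (powRM _ (addr_ge0 ler01 (mxl1_ge0 B)) (addr_ge0 (normr_ge0 _) (normr_ge0 _))).
rewrite -[leRHS]mulrA ler_wpM2l ?powR_ge0//; apply: powRD_le => //; exact: p_ge0.
Qed.

Lemma powR_z (x z : 'rV[R]_d) : `|z| `^ p <= 2 `^ p * (`|x| `^ p + `|x - eps *: z| `^ p).
Proof.
apply: (le_trans (powR_le p_ge0 (normr_ge0 _) (norm_z_le x z))).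
by apply: powRD_le => //; exact: p_ge0.
Qed.

Lemma mul_Lpos_eps (w : 'rV[R]_((d + d) + d)) :
  w *m Lpos (- eps)%:M = lsubmx (lsubmx w) - eps *: rsubmx w.
Proof. by rewrite -{1}[w]hsubmxK mul_Lpos mul_mx_scalar scaleNr. Qed.

Lemma mul_LsymE (w : 'rV[R]_((d + d) + d)) :
  w *m Lsym B = row_mx (lsubmx (lsubmx w) - rsubmx w *m B) (rsubmx (lsubmx w)).
Proof. by rewrite -{1}[w]hsubmxK mul_Lsym. Qed.

(** The amplitudes met when [x_j^k] is multiplied in: [g] is a power of a
    coordinate of [x - eps z], [l2] lists derivatives in [xi] and [l]
    derivatives in [x]. *)
Definition mono_amplitude (g : 'rV[R]_d -> R) (l2 l : seq 'I_d) b : 'rV[R]_((d + d) + d) -> R :=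
  fun w => g (w *m Lpos (- eps)%:M) * partials (map (@ix2 d) l2 ++ map (@ix1 d) l) b w.

(** [h], [Q] and [H] are chosen before [a] and [rh]: the Gevrey constants do not
    see the growth rates.  This makes it possible to take [rh] small compared
    with the decay that the moment constant [Q] will produce. *)
Lemma mono_amplitude_admissible ha hf c : 0 < ha -> 0 < hf -> 0 < c ->
  exists h Q H, [/\ 0 < h, 0 < Q & 0 < H] /\
  forall a rh, symbol_bound ha a -> 0 < rh -> exists r M, (0 < r /\ 0 < M) /\
  forall N f k1 g l2 l, 0 <= N -> test_bound hf c N f ->
  gevrey sigma s predT 1 (mono_weight s (c / 4) k1) g ->
  admissible s sigma h r (fun x => Q ^+ (k1 + size l2) * (factpow s k1 * factpow s (size l2)) *
      (H ^+ size l * factpow sigma (size l)) * (M * N * expR (rh * `|x| `^ p)))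
    (mono_amplitude g l2 l (amplitude a f)).
Proof.
move=> ha0 hf0 c0.
pose hb := mxl1 (Lsym B) * ha + mxl1 (Lpos (- eps)%:M : 'M[R]_((d + d) + d, d)) * hf.
have hb0 : 0 <= hb by rewrite addr_ge0// mulr_ge0 ?mxl1_ge0// ltW.
(* [hb] may vanish, and a positive constant is needed for powers of it. *)
pose H := 2 `^ sigma * 2 `^ s * (hb + 1).
have H0 : 0 < H by rewrite !mulr_gt0 ?powR_gt0// ltr_wpDl.
pose K := mono_cst s (c / 4).
have c4 : 0 < c / 4 by rewrite divr_gt0.
have K0 : 0 < K by rewrite mulr_gt0// ltr_pwDl// powR_ge0.
pose h := mxl1 (Lpos (- eps)%:M : 'M[R]_((d + d) + d, d)) * 1 + H.
have h0 : 0 < h by rewrite ltr_wpDl// mulr1 mxl1_ge0.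
exists h, (K + H), H; split; first by split=> //; rewrite addr_gt0.
move=> a rh sa rh0.
have cd0 : 0 < freq_decay sigma h / 2 by rewrite divr_gt0// freq_decay_gt0.
(* The growth rate allowed for the symbol: small for admissibility in [xi], small
   against the decay of the test function, and small against [rh]. *)
pose r := Num.min (freq_decay sigma h / 2) (Num.min (c / 4 / kap) (rh / 2 / kap)).
have r0 : 0 < r by rewrite !lt_min cd0 !divr_gt0 ?kap_gt0.
have r1 : r <= freq_decay sigma h / 2 by rewrite ge_min lexx.
have r2 : r * kap <= c / 4 by rewrite -ler_pdivlMr ?kap_gt0// !ge_min lexx orbT.
have r3 : r * kap <= rh / 2 by rewrite -ler_pdivlMr ?kap_gt0// !ge_min lexx !orbT.
have [C C0 ga] := sa _ r0.
(* The rate of decay in [z] extracted from the decay in [x - eps z]. *)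
pose rz := Num.min (c / 2) (rh / 2).
have rz0 : 0 < rz by rewrite lt_min !divr_gt0.
have rz1 : rz <= c / 2 by rewrite ge_min lexx.
have rz2 : rz <= rh / 2 by rewrite ge_min lexx orbT.
have rzp0 : 0 < rz / 2 `^ p by rewrite divr_gt0// powR_gt0.
have [Kz Kz0 HKz] := exp_le_rho d s0 rzp0.
exists r, (C * Kz); split; first by split=> //; rewrite mulr_gt0.
move=> N f k1 g l2 l N0 tf gg.
pose V0 := (K + H) ^+ (k1 + size l2) * (factpow s k1 * factpow s (size l2)) *
  (H ^+ size l * factpow sigma (size l)).
have V00 : 0 <= V0.
  by rewrite !mulr_ge0 ?factpow_ge0 ?exprn_ge0// ?addr_ge0 ?(ltW K0) ?(ltW H0).
have CKN : 0 <= C * Kz * N by rewrite !mulr_ge0 ?(ltW C0) ?(ltW Kz0).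
have Vx x : 0 <= V0 * (C * Kz * N * expR (rh * `|x : 'rV[R]_d| `^ p)).
  by rewrite mulr_ge0// mulr_ge0// expR_ge0.
split; last exact: r1; last exact: ltW; last exact: Vx; last first.
  move=> t; exists (V0 * (C * Kz * N * expR (rh * t `^ p))) => x xt.
  apply: ler_wpM2l => //; apply: ler_wpM2l => //.
  rewrite ler_expR; apply: ler_wpM2l; first exact: ltW.
  by apply: powR_le xt => //; exact: p_ge0.
pose W (w : 'rV[R]_((d + d) + d)) := C * expR (r * (`|lsubmx (w *m Lsym B)| `^ p + `|rsubmx (w *m Lsym B)| `^ q)) *
  (N * expR (- (c * `|w *m Lpos (- eps)%:M| `^ p))).
have gb : gevrey sigma s dir3 hb W (amplitude a f).
  apply: (gevrey_mul (ltW sigma0) (ltW s0)); [by rewrite mulr_ge0 ?mxl1_ge0 ?ltW..| |].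
    exact: gevrey_linear (@Lsym_dir R d B) (ltW ha0) ga.
  exact: gevrey_linear (@Lpos_dir R d _) (ltW hf0) tf.
have gb1 : gevrey sigma s dir3 (hb + 1) W (amplitude a f).
  by apply: (gevrey_le hb0 _ _ gb); rewrite ?lerDl.
have gp := gevrey_partials (ltW sigma0) (ltW s0) (map (@ix2 d) l2 ++ map (@ix1 d) l) (addr_ge0 hb0 ler01) gb1.
have gm := gevrey_linear (@Lpos_dir R d (- eps)%:M) ler01 gg.
have gf := gevrey_mul (ltW sigma0) (ltW s0) (mulr_ge0 (mxl1_ge0 _) ler01) (ltW H0) gm gp.
apply: (gevrey_le (ltW h0) (lexx _) _ gf) => w.
set x := lsubmx (lsubmx w); set z := rsubmx w; set xi := rsubmx (lsubmx w).
rewrite size_cat !size_map /gevrey_fact !count_cat !count_map.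
have -> : count (preim (@ix1 d) dir3) l = size l.
  by rewrite (eq_count (a2 := predT)) ?count_predT// => i; exact: space_dir3_1.
have -> : count (preim (@ix1 d) (predC dir3)) l = 0%N.
  by rewrite (eq_count (a2 := pred0)) ?count_pred0// => i; rewrite /= space_dir3_1.
have -> : count (preim (@ix2 d) dir3) l2 = 0%N.
  by rewrite (eq_count (a2 := pred0)) ?count_pred0// => i; rewrite /= space_dir3_2.
have -> : count (preim (@ix2 d) (predC dir3)) l2 = size l2.
  by rewrite (eq_count (a2 := predT)) ?count_predT// => i; rewrite /= space_dir3_2.
rewrite /= add0n addn0 /mono_weight -/K.
rewrite /W /amp_weight mul_LsymE row_mxKl row_mxKr mul_Lpos_eps -/x -/z -/xi.
have hU := powR_zB x z; have hZ := powR_z x z.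
set U := `|x - z *m B| `^ p in hU *; set X := `|x| `^ p in hU hZ *.
set Y := `|x - eps *: z| `^ p in hU hZ *; set Z := `|z| `^ p in hZ; set Xi := `|xi| `^ q.
have X0 : 0 <= X by exact: powR_ge0.
have Y0 : 0 <= Y by exact: powR_ge0.
have tp : 0 < 2 `^ p by rewrite powR_gt0.
have E1 : expR (c / 4 * Y) * (expR (r * (U + Xi)) * expR (- (c * Y))) <=
    expR (rh * X) * expR (r * Xi) * (Kz * rho z).
  apply: (@le_trans _ _ (expR (rh * X) * expR (r * Xi) * expR (- (rz / 2 `^ p * Z)))); last first.
    by apply: ler_wpM2l; [rewrite mulr_ge0 ?expR_ge0|exact: HKz].
  exact: (exp_trade _ X0 Y0 (ltW r0) (ltW rz0) tp hU hZ r2 r3 rz1 rz2).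
have E2 : K ^+ k1 * H ^+ (size l2) <= (K + H) ^+ (k1 + (size l2)).
  rewrite exprD; apply: ler_pM; rewrite ?exprn_ge0 ?(ltW K0) ?(ltW H0)//.
    by rewrite lerXn2r ?nnegrE ?addr_ge0 ?(ltW K0) ?(ltW H0)// lerDl ltW.
  by rewrite lerXn2r ?nnegrE ?addr_ge0 ?(ltW K0) ?(ltW H0)// lerDr ltW.
have E3 := ler_pM (mulr_ge0 (exprn_ge0 k1 (ltW K0)) (exprn_ge0 (size l2) (ltW H0)))
  (mulr_ge0 (expR_ge0 _) (mulr_ge0 (expR_ge0 _) (expR_ge0 _))) E2 E1.
pose T := factpow s k1 * factpow s (size l2) * (H ^+ size l * factpow sigma (size l)) * (C * N).
have T0 : 0 <= T by rewrite !mulr_ge0 ?factpow_ge0 ?exprn_ge0 ?(ltW C0) ?(ltW H0).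
have E4 := ler_wpM2l T0 E3.
apply: le_trans (le_trans E4 _).
  by apply: eq_ler; rewrite /T (exprD H) -/H -/K; ring.
by apply: eq_ler; exact: mulr_shuffle.
Qed.

(** The moments of [Iint] in [x_j] are computed by [Iint_mulx] and turned into
    decay by [exp_of_moments]; the rate [cQ] so obtained depends on [Q] only, so
    the growth rate in [x] of the amplitude can be taken equal to [cQ / 2]. *)
Theorem Iint_test ha hf c : 0 < ha -> 0 < hf -> 0 < c -> forall a, symbol_bound ha a ->
  exists H c' C, [/\ 0 < H, 0 < c' & 0 < C] /\
  forall N f th, 0 <= N -> test_bound hf c N f ->
    test_bound H c' (C * N) (Iint th (amplitude a f)).
Proof.
move=> ha0 hf0 c0 a sa.
have [h [Q [H [[h0 Q0 H0] HG]]]] := mono_amplitude_admissible ha0 hf0 c0.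
have [KI KI0 HKI] := @Iint_bound R d s sigma s0 sigma0 h h0.
(* The rate produced by [exp_of_moments] from moments with constant [2 Q]; the
   factor 2 comes from the two terms of [Iint_mulx]. *)
pose cQ := s / (2 * (2 * Q) `^ p).
have cQ0 : 0 < cQ by rewrite divr_gt0// mulr_gt0// powR_gt0// mulr_gt0.
have cQ2 : 0 < cQ / 2 by rewrite divr_gt0.
have [r [M [[r0 M0] HM]]] := HG a (cQ / 2) sa cQ2.
exists H, (cQ / 2), (2 `^ s * KI * M); split.
  by split=> //; rewrite !mulr_gt0 ?powR_gt0.
move=> N f th N0 tf.
have c4 : 0 < c / 4 by rewrite divr_gt0.
have good_f j k1 k2 l := HM N f k1 (fun w => w 0 j ^+ k1) (nseq k2 j) l N0 tf (gevrey_monomial s0 ss1 j k1 c4).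
have good_1 l := HM N f 0%N (fun=> 1) [::] l N0 tf (@gevrey_one R d s sigma _ c4).
set b := amplitude a f in good_f good_1 *.
have fam1 l : mono_amplitude (fun=> 1) [::] l b = partials (map (@ix1 d) l) b.
  by apply/funext => w; rewrite /mono_amplitude mul1r.
have dI l i x : is_derive x (delta_mx 0 i : 'rV[R]_d) (Iint th (partials (map (@ix1 d) l) b))
    (Iint th (partials (map (@ix1 d) (i :: l)) b) x).
  have := good_1 l; have := good_1 (i :: l); rewrite !fam1 => g1 g2.
  exact: (is_derive_Iint s0 sigma0 th x h0 h0 g2 g1).
have pI l : partials l (Iint th b) = Iint th (partials (map (@ix1 d) l) b).
  elim: l => [//|i l IH]; rewrite [LHS]/= IH; apply/funext => x.
  by rewrite (partial_of_is_derive (dI l i x)).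
have sI : rsmooth (Iint th b).
  move=> l; rewrite pI; split; last by move=> i x; have [] := dI l i x.
  apply: pint_continuous; have := good_1 l; rewrite fam1 => g1.
  exact: (Jint_ldom s0 sigma0 th h0 g1).
split=> // l x.
rewrite pI gevrey_factT.
pose D := KI * M * N * (H ^+ size l * factpow sigma (size l)) * expR (cQ / 2 * `|x| `^ p).
have D0 : 0 <= D by rewrite !mulr_ge0 ?expR_ge0 ?factpow_ge0 ?exprn_ge0// ltW.
pose bj j k1 k2 := mono_amplitude (fun w => w 0 j ^+ k1) (nseq k2 j) l b.
have bnd j k1 k2 th' : `|Iint th' (bj j k1 k2) x| <= D * Q ^+ (k1 + k2) * factpow s (k1 + k2).
  apply: (le_trans (HKI th' _ _ _ x (good_f j k1 k2 l))).
  have le := factpow_mul k1 k2 (ltW s0).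
  rewrite size_nseq [leLHS](_ : _ = D * Q ^+ (k1 + k2) * (factpow s k1 * factpow s k2)); last by rewrite /D; ring.
  by apply: ler_wpM2l le; rewrite mulr_ge0// exprn_ge0// ltW.
have sb : rsmooth b by have := admissible_smooth (good_1 [::]); rewrite fam1.
have step j k1 k2 th' : x 0 j * Iint th' (bj j k1 k2) x =
    Iint th' (bj j k1.+1 k2) x - eps * Iint (th' - pi / 2) (bj j k1 k2.+1) x.
  have ey : (fun w => ycoord eps j w * bj j k1 k2 w) = bj j k1.+1 k2.
    apply/funext => w; rewrite /bj /mono_amplitude exprS -mulrA; congr (_ * _).
    by rewrite mul_Lpos_eps /ycoord !mxE.
  have ex : partial (ix2 j) (bj j k1 k2) = bj j k1 k2.+1.
    have sm : rsmooth (fun w : 'rV[R]_((d + d) + d) => (w *m Lpos (- eps)%:M) 0 j ^+ k1).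
      have := rsmooth_affine (Lpos (- eps)%:M : 'M[R]_((d + d) + d, d)) 0 (@rsmooth_mono R d j k1).
      by under eq_fun do rewrite addr0.
    rewrite /bj /mono_amplitude (partialM _ sm (rsmooth_partials _ sb)); apply/funext => w.
    suff -> : partial (ix2 j) (fun w : 'rV[R]_((d + d) + d) => (w *m Lpos (- eps)%:M) 0 j ^+ k1) w = 0.
      by rewrite mul0r add0r.
    have := partial_affine (Lpos (- eps)%:M : 'M[R]_((d + d) + d, d)) 0 (ix2 j) (@rsmooth_mono R d j k1).
    under eq_fun do rewrite addr0; move=> ->.
    rewrite /affine_partial big1// => k _.
    by rewrite /Lpos /ix2 col_mxEu col_mxEd mxE mul0r.
  have := @Iint_mulx R d s sigma s0 sigma0 eps h r _ h r _ h r _ (bj j k1 k2) j th' x eps2 h0 h0 h0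
    (good_f j k1 k2 l).
  by rewrite ey ex; apply; [exact: good_f|exact: good_f].
have mom j k k1 k2 th' : `|x 0 j| ^+ k * `|Iint th' (bj j k1 k2) x| <=
    2 ^+ k * (D * Q ^+ (k + (k1 + k2)) * factpow s (k + (k1 + k2))).
  elim: k k1 k2 th' => [|k IH] k1 k2 th'; first by rewrite !mul1r add0n bnd.
  rewrite exprSr -mulrA -normrM step.
  apply: (@le_trans _ _ (`|x 0 j| ^+ k * (`|Iint th' (bj j k1.+1 k2) x| +
      `|Iint (th' - pi / 2) (bj j k1 k2.+1) x|))).
    apply: ler_wpM2l; first exact: exprn_ge0.
    by apply: (le_trans (ler_normB _ _)); rewrite normrM eps1 mul1r.
  rewrite mulrDr; apply: (le_trans (lerD (IH _ _ _) (IH _ _ _))).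
  rewrite !(addnS, addSn) !exprS.
  by apply: eq_ler; ring.
have fin : `|Iint th (partials (map (@ix1 d) l) b) x| <= 2 `^ s * D * expR (- (cQ * `|x| `^ p)).
  apply: exp_of_moments => // [|k]; first by rewrite mulr_gt0.
  have [z|/mx_norm_neq0[[i j] e]] := eqVneq (mx_norm x) 0.
    rewrite (_ : `|x| = 0)//; case: k => [|k].
      rewrite expr0 mul1r factpow0 !mulr1.
      have := HKI th _ _ _ x (good_1 l); rewrite fam1; move/le_trans; apply.
      by rewrite factpow0 /D le_eqVlt; apply/orP; left; apply/eqP; ring.
    by rewrite expr0n mul0r !mulr_ge0 ?factpow_ge0 ?exprn_ge0// ?mulr_ge0// ltW.
  have := mom j k 0%N 0%N th; rewrite !addn0.
  have -> : bj j 0%N 0%N = partials (map (@ix1 d) l) b.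
    by apply/funext => w; rewrite /bj /mono_amplitude expr0 mul1r.
  rewrite [`|x|]e /= (ord1 i) => /le_trans; apply.
  by rewrite exprMn le_eqVlt; apply/orP; left; apply/eqP; ring.
apply: (le_trans fin).
have eE : expR (cQ / 2 * `|x| `^ p) * expR (- (cQ * `|x| `^ p)) = expR (- (cQ / 2 * `|x| `^ p)).
  exact: expR_halve.
rewrite -eE /D le_eqVlt; apply/orP; left; apply/eqP.
by move: (expR _) (expR _) (factpow _ _) => e1 e2 e3; ring.
Qed.
End MainEstimate.

(** * The bilinear form and Fubini *)

(** Here two decaying factors are present, at points with powers adding up to
    [S]; they pay for the growth of the symbol and for decay in both [u] and
    [t]. *)
Lemma exp_split (R : realType) (c kap r tp S U Z Xi : R) :
  0 < c -> 0 < tp -> 0 < kap -> 0 <= r -> 0 <= S ->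
  U <= kap * S -> Z <= tp * S -> r * kap <= c / 4 ->
  expR (r * (U + Xi)) * expR (- (c * S)) <=
  expR (- (c / 4 / kap * U)) * expR (r * Xi) * expR (- (c / 4 / tp * Z)).
Proof.
move=> c0 tp0 kap_gt0 r0 S0 hU hZ rk.
rewrite -(expRD (r * _)) -(expRD _ (r * Xi)) -(expRD (_ + _)) ler_expR.
have e1 : c / 4 / tp * Z <= c / 4 * S.
  by rewrite -mulrA ler_wpM2l ?divr_ge0 ?(ltW c0)// mulrC ler_pdivrMr// mulrC.
have e3 : c / 4 / kap * U <= c / 4 * S.
  by rewrite -mulrA ler_wpM2l ?divr_ge0 ?(ltW c0)// mulrC ler_pdivrMr// mulrC.
have e2 : r * U <= r * kap * S by rewrite -mulrA ler_wpM2l.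
have e4 : r * kap * S <= c / 4 * S by rewrite ler_wpM2r.
have e5 : 0 <= c * S by rewrite mulr_ge0// ltW.
rewrite !mulrDr in e1 e2 *; lra.
Qed.

Lemma mulr_gather (R : comPzRingType) (C M N x y z : R) :
  C * x * (M * y * (N * z)) = C * M * N * (x * (y * z)).
Proof. ring. Qed.

Lemma mulr_gather2 (R : comPzRingType) (C M N K L x y z : R) :
  C * M * N * K * L * x * y * z = C * M * N * (K * x * y * (L * z)).
Proof. ring. Qed.

Section BilinearForm.
Context (R : realType) (d : nat) (s sigma : R).
Hypotheses (s0 : 0 < s) (sigma0 : 0 < sigma).
Variables (eps : R) (B : 'M[R]_d).
Hypothesis eps2 : eps ^+ 2 = 1.
Local Notation p := (s^-1).
Local Notation q := (sigma^-1).
Local Notation dir2 := (@space_dir d).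
Local Notation dir3 := (@space_dir3 d).
Local Notation symbol_bound := (symbol_bound s sigma).
Local Notation test_bound := (test_bound s sigma).
Implicit Types (a : 'rV[R]_(d + d) -> R) (f g : 'rV[R]_d -> R).

Lemma gevrey_fst h W a : 0 <= h -> gevrey sigma s dir2 h W a ->
  gevrey sigma s dir3 (mxl1 (Lsym (0 : 'M[R]_d)) * h)
    (fun w => W (lsubmx w)) (fun w => a (lsubmx w)).
Proof.
have e (w : 'rV[R]_((d + d) + d)) : w *m Lsym 0 = lsubmx w.
  by rewrite mul_LsymE mulmx0 subr0 hsubmxK.
move=> h0 gF; have := gevrey_linear (@Lsym_dir R d 0) h0 gF.
by under eq_fun do rewrite e; under [X in gevrey _ _ _ _ _ X]eq_fun do rewrite e.
Qed.

(** With [x = u + t B], the two test functions are evaluated at [x] and at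
    [x - eps t]. *)
Definition pair0 g f : 'rV[R]_((d + d) + d) -> R :=
  fun w => g (w *m Lpos B) * f (w *m Lpos (B - eps%:M)).

Definition pair_amp a g f : 'rV[R]_((d + d) + d) -> R :=
  fun w => a (lsubmx w) * pair0 g f w.

Lemma pair_ampE a g f u xi t : pair_amp a g f (row_mx (row_mx u xi) t) =
  a (row_mx u xi) * (g (u + t *m B) * f (u + t *m B - eps *: t)).
Proof.
by rewrite /pair_amp /pair0 row_mxKl !mul_Lpos row_mxKl mulmxBr mul_mx_scalar addrA.
Qed.

(** Seen as an amplitude in [((u, xi), t)], the integrand of the bilinear form
    has integrable weight in [u], so the integral over [(u, xi)] is dominated. *)
Lemma pair_amp_admissible ha hf c N M a g f : 0 < ha -> 0 < hf -> 0 < c -> 0 <= N -> 0 <= M ->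
  symbol_bound ha a -> test_bound hf c M g -> test_bound hf c N f ->
  exists h r C, 0 < h /\ admissible s sigma h r (fun x => C * rho x) (pair_amp a g f).
Proof.
move=> ha0 hf0 c0 N0 M0 sa tg tf.
pose h := mxl1 (Lsym (0 : 'M[R]_d)) * ha + (mxl1 (Lpos B) * hf + mxl1 (Lpos (B - eps%:M)) * hf).
have h0' : 0 <= h by rewrite !addr_ge0// mulr_ge0 ?mxl1_ge0// ltW.
have h1 : 0 < h + 1 by rewrite ltr_wpDl.
pose kap : R := (1 + mxl1 B) `^ p * 2 `^ p.
have kp0 : 0 < kap by rewrite mulr_gt0// powR_gt0// ltr_pwDl// mxl1_ge0.
have tp : 0 < 2 `^ p :> R by rewrite powR_gt0.
have cd0 : 0 < freq_decay sigma (h + 1) / 2 by rewrite divr_gt0// freq_decay_gt0.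
pose r := Num.min (freq_decay sigma (h + 1) / 2) (c / 4 / kap).
have r0 : 0 < r by rewrite !lt_min cd0 !divr_gt0.
have r1 : r <= freq_decay sigma (h + 1) / 2 by rewrite ge_min lexx.
have r2 : r * kap <= c / 4 by rewrite -ler_pdivlMr// !ge_min lexx orbT.
have [C C0 ga] := sa _ r0.
have ck0 : 0 < c / 4 / kap by rewrite !divr_gt0.
have ct0 : 0 < c / 4 / 2 `^ p by rewrite !divr_gt0.
have [Ku Ku0 HKu] := exp_le_rho d s0 ck0.
have [Kt Kt0 HKt] := exp_le_rho d s0 ct0.
have c4 : 0 < c / 4 by rewrite divr_gt0.
exists (h + 1), r, (C * M * N * Ku * Kt); split=> //.
have D0 : 0 <= C * M * N * Ku * Kt by rewrite !mulr_ge0 ?(ltW C0) ?(ltW Ku0) ?(ltW Kt0).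
split=> //.
- pose W (w : 'rV[R]_((d + d) + d)) :=
    (C * expR (r * (`|lsubmx (lsubmx w)| `^ p + `|rsubmx (lsubmx w)| `^ q))) *
    ((M * expR (- (c * `|w *m Lpos B| `^ p))) *
     (N * expR (- (c * `|w *m Lpos (B - eps%:M)| `^ p)))).
  have gb : gevrey sigma s dir3 h W (pair_amp a g f).
    apply: (gevrey_mul (ltW sigma0) (ltW s0)).
    + by rewrite mulr_ge0 ?mxl1_ge0 ?ltW.
    + by rewrite addr_ge0// mulr_ge0 ?mxl1_ge0 ?ltW.
    + exact: gevrey_fst (ltW ha0) ga.
    apply: (gevrey_mul (ltW sigma0) (ltW s0)); [by rewrite mulr_ge0 ?mxl1_ge0 ?ltW..| |].
      exact: gevrey_linear (@Lpos_dir R d _) (ltW hf0) tg.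
    exact: gevrey_linear (@Lpos_dir R d _) (ltW hf0) tf.
  apply: (gevrey_le h0' _ _ gb) => [|w]; first by rewrite lerDl.
  rewrite /W /amp_weight.
  set u := lsubmx (lsubmx w); set t := rsubmx w; set xi := rsubmx (lsubmx w).
  have ev1 : w *m Lpos B = u + t *m B by rewrite -{1}[w]hsubmxK mul_Lpos.
  have ev2 : w *m Lpos (B - eps%:M) = (u + t *m B) - eps *: t.
    by rewrite -{1}[w]hsubmxK mul_Lpos mulmxBr mul_mx_scalar addrA.
  rewrite ev1 ev2; set v := u + t *m B.
  have eu : u = v - t *m B by rewrite addrK.
  have hU := powR_zB s0 B eps2 v t; have hZ := powR_z s0 eps2 v t.
  rewrite -eu -/kap in hU.
  have X0 := powR_ge0 `|v| p; have Y0 := powR_ge0 `|v - eps *: t| p.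
  set X := `|v| `^ p in hU hZ X0 *; set Y := `|v - eps *: t| `^ p in hU hZ Y0 *.
  have E := exp_split (`|xi| `^ q) c0 tp kp0 (ltW r0) (addr_ge0 X0 Y0) hU hZ r2.
  rewrite (mulrDr c) opprD (expRD (- (c * X))) in E.
  have E' : expR (- (c / 4 / kap * `|u| `^ p)) * expR (r * `|xi| `^ q) *
      expR (- (c / 4 / 2 `^ p * `|t| `^ p)) <= Ku * rho u * expR (r * `|xi| `^ q) * (Kt * rho t).
    apply: ler_pM; [by rewrite mulr_ge0 ?expR_ge0|exact: expR_ge0| |exact: HKt].
    by apply: ler_wpM2r; [exact: expR_ge0|exact: HKu].
  have CMN : 0 <= C * M * N by rewrite !mulr_ge0// ltW.
  have := ler_wpM2l CMN (le_trans E E').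
  by rewrite (mulr_gather C) (mulr_gather2 C).
- move=> t; exists (C * M * N * Ku * Kt) => x _.
  rewrite ler_piMr//; apply: prodr_ile1 => i _; rewrite lorentz_ge0; exact: lorentz_le1.
- by move=> x; rewrite mulr_ge0// rho_ge0.
- exact: ltW.
Qed.

Lemma phase_row3 (u xi t : 'rV[R]_d) : phase (row_mx (row_mx u xi) t) = dotv t xi.
Proof. by rewrite phaseE row_mxKr row_mxKl row_mxKr. Qed.

Lemma pair0_ldom hf c N M g f th : 0 < hf -> 0 < c -> 0 <= N -> 0 <= M ->
  test_bound hf c M g -> test_bound hf c N f -> ldom (osc th (pair0 g f)).
Proof.
move=> hf0 c0 N0 M0 tg tf.
have gb : rsmooth (pair0 g f).
  by case: (gevrey_mul (ltW sigma0) (ltW s0) (mulr_ge0 (mxl1_ge0 _) (ltW hf0))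
     (mulr_ge0 (mxl1_ge0 _) (ltW hf0)) (gevrey_linear (@Lpos_dir R d B) (ltW hf0) tg)
     (gevrey_linear (@Lpos_dir R d (B - eps%:M)) (ltW hf0) tf)).
have tp : 0 < 2 `^ p :> R by rewrite powR_gt0.
have ct0 : 0 < c / 2 `^ p by rewrite divr_gt0.
have [Kt Kt0 HKt] := exp_le_rho d s0 ct0.
split; first exact: continuous_osc.
move=> r; exists (M * N * Kt) => w _ t; apply: (le_trans (osc_le _ _ _)).
rewrite /pair0 !mul_Lpos mulmxBr mul_mx_scalar addrA; set v := lsubmx w + t *m B.
have gv : `|g v| <= M * expR (- (c * `|v| `^ p)).
  exact: gevrey_norm_le tg.
have fv : `|f (v - eps *: t)| <= N * expR (- (c * `|v - eps *: t| `^ p)).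
  exact: gevrey_norm_le tf.
rewrite normrM; apply: (le_trans (ler_pM (normr_ge0 _) (normr_ge0 _) gv fv)).
rewrite mulrACA -expRD -[leRHS]mulrA; apply: ler_wpM2l; first exact: mulr_ge0.
apply: le_trans (HKt t); rewrite ler_expR -opprD lerN2 -mulrDr.
rewrite -mulrA ler_wpM2l ?(ltW c0)// mulrC ler_pdivrMr// mulrC; exact: powR_z.
Qed.

Lemma Jint_pair hf c N M a g f th w : 0 < hf -> 0 < c -> 0 <= N -> 0 <= M ->
  test_bound hf c M g -> test_bound hf c N f ->
  Jint th (pair_amp a g f) w = a w * Jint th (pair0 g f) w.
Proof.
move=> hf0 c0 N0 M0 tg tf; rewrite /Jint -(pint_param a w (pair0_ldom th hf0 c0 N0 M0 tg tf)).
by apply: eq_rint => t; rewrite /pair_amp osc_mulr.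
Qed.

Lemma amplitude_admissible ha hf c N a f : 0 < ha -> 0 < hf -> 0 < c -> 0 <= N ->
  symbol_bound ha a -> test_bound hf c N f ->
  exists h r M, [/\ 0 < h, 0 <= M &
    admissible s sigma h r (fun x => M * expR (c / 2 * `|x| `^ p)) (amplitude eps B a f)].
Proof.
move=> ha0 hf0 c0 N0 sa tf.
have [h [Q [H [[h0 Q0 H0] HG]]]] := mono_amplitude_admissible s0 sigma0 B eps2 ha0 hf0 c0.
have c2 : 0 < c / 2 by rewrite divr_gt0.
have c4 : 0 < c / 4 by rewrite divr_gt0.
have [r [M [[r0 M0] HM]]] := HG a (c / 2) sa c2.
have := HM N f 0%N (fun=> 1) [::] [::] N0 tf (@gevrey_one R d s sigma _ c4).
exists h, r, (M * N); split=> //; first by rewrite mulr_ge0// ltW.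
have -> : amplitude eps B a f = mono_amplitude eps (fun=> 1) [::] [::] (amplitude eps B a f).
  by apply/funext => w; rewrite /mono_amplitude mul1r.
congr (admissible _ _ _ _ _ _): H1.
by apply/funext => x; rewrite !factpow0 !mulr1 !mul1r.
Qed.

(** After exchanging [u] with [xi] and with [t], the translation [u = x - t B]
    turns the pair of test functions into [g x] times the amplitude of the
    operator; the integrals are then put back into the order of [Iint].  Decay
    in [xi] is available only after the integral over [t], which dictates the
    order of the exchanges. *)
Theorem bilinear_fubini ha hf c N M a g f th :
  0 < ha -> 0 < hf -> 0 < c -> 0 <= N -> 0 <= M ->
  symbol_bound ha a -> test_bound hf c M g -> test_bound hf c N f ->
  rint (fun w => a w * Jint th (pair0 g f) w) =
  rint (fun x => g x * Iint th (amplitude eps B a f) x).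
Proof.
move=> ha0 hf0 c0 N0 M0 sa tg tf.
have [h [r [C [h0 gb]]]] := pair_amp_admissible ha0 hf0 c0 N0 M0 sa tg tf.
have [h' [r' [M' [h0' M'0 gb']]]] := amplitude_admissible ha0 hf0 c0 N0 sa tf.
set b := pair_amp a g f in gb; set b' := amplitude eps B a f in gb' *.
have [K K0 HK] := @Jint_bound R d s sigma s0 sigma0 h h0.
have [K' K0' HK'] := @Jint_bound R d s sigma s0 sigma0 h' h0'.
have cb := @continuous_osc R d th b (admissible_smooth gb).
have cb' := @continuous_osc R d th b' (admissible_smooth gb').
have bb w : `|b w| <= amp_weight sigma (fun x => C * rho x) r w.
  by case: gb => ab _ _ _ _; exact: gevrey_norm_le ab.
have bb' w : `|b' w| <= amp_weight sigma (fun x => M' * expR (c / 2 * `|x| `^ p)) r' w.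
  by case: gb' => ab _ _ _ _; exact: gevrey_norm_le ab.
have cg : continuous g by exact: rsmooth_continuous tg.1.
have c2 : 0 < c / 2 by rewrite divr_gt0.
have [Kx Kx0 HKx] := exp_le_rho d s0 c2.
have gV x : `|g x| * (M' * expR (c / 2 * `|x| `^ p)) <= M * M' * Kx * rho x.
  have gx : `|g x| <= M * expR (- (c * `|x| `^ p)).
    exact: gevrey_norm_le tg.
  apply: (@le_trans _ _ (M * expR (- (c * `|x| `^ p)) * (M' * expR (c / 2 * `|x| `^ p)))).
    by apply: ler_wpM2r; rewrite // mulr_ge0// expR_ge0.
  rewrite mulrACA (mulrC (expR _)) expR_halve -[leRHS]mulrA ler_wpM2l ?mulr_ge0//.
have pairs (u xi t : 'rV[R]_d) :
    osc th b (row_mx (row_mx (u - t *m B) xi) t) = g u * osc th b' (row_mx (row_mx u xi) t).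
  rewrite /osc !phase_row3 /b pair_ampE subrK /b' /amplitude mul_Lsym mul_Lpos_eps.
  by rewrite !(row_mxKl, row_mxKr) [RHS]mulrCA; congr (_ * _); rewrite [LHS]mulrCA.
transitivity (rint (Jint th b)).
  by apply: eq_rint => w; rewrite (Jint_pair a th w hf0 c0 N0 M0 tg tf).
have cJ : continuous (Jint th b) by exact: Jint_continuous gb.
have cJ' : continuous (Jint th b') by exact: Jint_continuous gb'.
rewrite rint_row_mx.
(* Exchange of [u] and [xi]: the integral over [t] has produced the decay. *)
rewrite (@rint_swap R d d (K * C) (fun z => Jint th b (row_mx z.1 z.2))); first last.
- move=> u xi /=; apply: (le_trans (HK th b _ r _ gb)).
  by rewrite row_mxKl row_mxKr mulrA.
- apply: (continuous_compose _ cJ).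
  by apply: continuous_row_mx; [exact: continuous_fst|exact: continuous_snd].
transitivity (rint (fun xi => rint (fun x => g x * Jint th b' (row_mx x xi)))).
  apply: eq_rint => xi.
  (* Exchange of [u] and [t] for fixed [xi], where growth in [xi] is harmless. *)
  transitivity (rint (fun t => rint (fun u => osc th b (row_mx (row_mx u xi) t)))).
    apply: (@rint_swap R d d (C * expR (r * `|xi| `^ q))
      (fun z => osc th b (row_mx (row_mx z.1 xi) z.2))).
      apply: continuous_compose cb; apply: continuous_row_mx; last exact: continuous_snd.
      by apply: continuous_row_mx; [exact: continuous_fst|exact: cst_continuous].
    move=> u t /=; apply: (le_trans (osc_le _ _ _)); apply: (le_trans (bb _)).
    by rewrite /amp_weight !(row_mxKl, row_mxKr) le_eqVlt; apply/orP; left; apply/eqP; ring.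
  transitivity (rint (fun t => rint (fun x => g x * osc th b' (row_mx (row_mx x xi) t)))).
    apply: eq_rint => t.
    under [RHS]eq_rint do rewrite -pairs.
    symmetry; apply: (@rint_translate R d (C * expR (r * `|xi| `^ q) * rho t)
       (fun u => osc th b (row_mx (row_mx u xi) t)) (- (t *m B))).
    split.
      apply: continuous_compose cb; apply: continuous_row_mx; last exact: cst_continuous.
      by apply: continuous_row_mx; [exact: continuous_idfun|exact: cst_continuous].
    move=> u; apply: (le_trans (osc_le _ _ _)); apply: (le_trans (bb _)).
    by rewrite /amp_weight !(row_mxKl, row_mxKr) le_eqVlt; apply/orP; left; apply/eqP; ring.
  symmetry; transitivity (rint (fun x => rint (fun t => g x * osc th b' (row_mx (row_mx x xi) t)))).
    apply: eq_rint => x.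
    have [D dD] := ldom_dom1 (row_mx x xi) (admissible_ldom sigma0 th gb').
    by rewrite (rintZ _ dD).
  apply: (@rint_swap R d d (M * M' * Kx * expR (r' * `|xi| `^ q))
      (fun z => g z.1 * osc th b' (row_mx (row_mx z.1 xi) z.2))).
    apply: continuous_mul.
      by apply: (continuous_compose _ cg); exact: continuous_fst.
    apply: (continuous_compose _ cb'); apply: continuous_row_mx; last exact: continuous_snd.
    by apply: continuous_row_mx; [exact: continuous_fst|exact: cst_continuous].
  move=> x t /=; rewrite normrM.
  apply: (le_trans (ler_wpM2l (normr_ge0 _) (le_trans (osc_le _ _ _) (bb' _)))).
  rewrite /amp_weight !(row_mxKl, row_mxKr).
  have ee : 0 <= expR (r' * `|xi| `^ q) * rho t by rewrite mulr_ge0 ?expR_ge0 ?rho_ge0.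
  have := ler_wpM2r ee (gV x).
  move: (expR (r' * _)) (expR _) => e1 e2 LE.
  by rewrite [leLHS](_ : _ = `|g x| * (M' * e2) * (e1 * rho t));
    [rewrite [leRHS](_ : _ = M * M' * Kx * rho x * (e1 * rho t))|]; [|ring..].
(* Exchange of [x] and [xi]: the decay of [g] beats the growth of [Jint]. *)
rewrite -(@rint_swap R d d (M * M' * Kx * K') (fun z => g z.1 * Jint th b' (row_mx z.1 z.2))).
- apply: eq_rint => x /=.
  have [D dD] := ldom_dom1 x (Jint_ldom s0 sigma0 th h0' gb').
  by rewrite (rintZ _ dD).
- apply: continuous_mul; first by apply: (continuous_compose _ cg); exact: continuous_fst.
  apply: (continuous_compose _ cJ').
  by apply: continuous_row_mx; [exact: continuous_fst|exact: continuous_snd].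
- move=> x xi /=; rewrite normrM.
  apply: (le_trans (ler_wpM2l (normr_ge0 _) (HK' th b' _ r' _ gb'))).
  rewrite row_mxKl row_mxKr.
  have ee : 0 <= K' * rho xi by rewrite mulr_ge0 ?rho_ge0 ?ltW.
  have := ler_wpM2r ee (gV x).
  move: (expR _) => e2 LE.
  by rewrite [leLHS](_ : _ = `|g x| * (M' * e2) * (K' * rho xi));
    [rewrite [leRHS](_ : _ = M * M' * Kx * rho x * (K' * rho xi))|]; [|ring..].
Qed.

End BilinearForm.

(** * Gelfand-Shilov seminorms in terms of exponential decay *)

Section Seminorms.
Context (R : realType).

Lemma Re_le_normc (z : R[i]) : `|complex.Re z| <= Normc.normc z.
Proof.
case: z => x y /=; rewrite -sqrtr_sqr ler_sqrt ?addr_ge0 ?sqr_ge0//.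
by rewrite lerDl sqr_ge0.
Qed.

Lemma Im_le_normc (z : R[i]) : `|complex.Im z| <= Normc.normc z.
Proof.
case: z => x y /=; rewrite -sqrtr_sqr ler_sqrt ?addr_ge0 ?sqr_ge0//.
by rewrite lerDr sqr_ge0.
Qed.

Lemma normc_le_ReIm (z : R[i]) : Normc.normc z <= `|complex.Re z| + `|complex.Im z|.
Proof.
case: z => x y /=; rewrite -[leRHS]ger0_norm ?addr_ge0// -sqrtr_sqr ler_sqrt ?sqr_ge0//.
rewrite sqrrD !real_normK ?num_real// -addrA [_ *+ 2 + _]addrC addrA lerDl.
by rewrite mulrn_wge0// mulr_ge0.
Qed.

Context (d : nat) (s sigma : R).
Hypotheses (s0 : 0 < s) (sigma0 : 0 < sigma).
Local Notation test_bound := (test_bound s sigma).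

Definition mi_delta (j : 'I_d) (k : nat) : 'I_d -> nat := fun i => if i == j then k else 0%N.

Lemma mi_abs_delta j k : mi_abs (mi_delta j k) = k.
Proof.
rewrite /mi_abs (bigD1 j)//= {1}/mi_delta eqxx big1 ?addn0// => i /negbTE ij.
by rewrite /mi_delta ij.
Qed.

Lemma mi_fact_delta j k : mi_fact (mi_delta j k) = k`!.
Proof.
rewrite /mi_fact (bigD1 j)//= {1}/mi_delta eqxx big1 ?muln1// => i /negbTE ij.
by rewrite /mi_delta ij fact0.
Qed.

Lemma mi_pow_delta j k (x : 'rV[R]_d) : mi_pow x (mi_delta j k) = x 0 j ^+ k.
Proof.
rewrite /mi_pow (bigD1 j)//= {1}/mi_delta eqxx big1 ?mulr1// => i /negbTE ij.
by rewrite /mi_delta ij expr0.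
Qed.

Lemma mi_fact_powR_le (t : R) n (al : 'I_n -> nat) : 0 <= t ->
  (mi_fact al)%:R `^ t <= factpow t (mi_abs al).
Proof. by move=> t0; apply: ler_powR_nat => //; exact: mi_fact_le. Qed.

Lemma mi_fact_gt0 n (al : 'I_n -> nat) : (0 < mi_fact al)%N.
Proof. by apply: prodn_gt0 => i; exact: fact_gt0. Qed.

Lemma gs_quot_moment h N (f : 'rV[R]_d -> R[i]) al be x : 0 < h ->
  gs_quot s sigma h f al be x <= N ->
  `|mi_pow x al| * Normc.normc (mderiv be f x) <=
  N * (h ^+ (mi_abs al + mi_abs be) * (mi_fact al)%:R `^ s * (mi_fact be)%:R `^ sigma).
Proof.
move=> h0; rewrite /gs_quot ler_pdivrMr// !mulr_gt0 ?exprn_gt0// powR_gt0// ltr0n;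
 exact: mi_fact_gt0.
Qed.

(** The monomials [x_j^k] for a coordinate that realizes the maximum norm
    suffice to recover the decay. *)
Lemma test_part h N (f : 'rV[R]_d -> R[i]) (F : 'rV[R]_d -> R) : 0 < h -> 0 <= N ->
  rsmooth F -> (forall be x, `|rderiv be F x| <= Normc.normc (mderiv be f x)) ->
  (forall al be x, gs_quot s sigma h f al be x <= N) ->
  test_bound h (s / (2 * h `^ s^-1)) (2 `^ s * N) F.
Proof.
move=> h0 N0 sF le_F Hq; split=> // l x.
rewrite gevrey_factT.
have D0 : 0 <= N * (h ^+ size l * factpow sigma (size l)).
  by rewrite !mulr_ge0 ?factpow_ge0// exprn_ge0// ltW.
rewrite [leRHS](_ : _ = 2 `^ s * (N * (h ^+ size l * factpow sigma (size l))) *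
   expR (- (s / (2 * h `^ s^-1) * `|x| `^ s^-1))); last by move: (expR _) => e; ring.
have mom al : `|mi_pow x al| * `|partials l F x| <=
    N * (h ^+ size l * factpow sigma (size l)) * h ^+ mi_abs al * (mi_fact al)%:R `^ s.
  rewrite partials_rderiv//.
  apply: (le_trans (ler_wpM2l (normr_ge0 _) (le_F _ _))).
  apply: (le_trans (gs_quot_moment h0 (Hq al (mi_of l) x))).
  rewrite mi_abs_of exprD [leLHS](_ : _ = N * h ^+ size l * h ^+ mi_abs al *
     (mi_fact al)%:R `^ s * (mi_fact (mi_of l))%:R `^ sigma); last by ring.
  rewrite [leRHS](_ : _ = N * h ^+ size l * h ^+ mi_abs al *
     (mi_fact al)%:R `^ s * factpow sigma (size l)); last by ring.
  rewrite ler_wpM2l ?mulr_ge0 ?powR_ge0 ?exprn_ge0 ?(ltW h0)//.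
  by have := mi_fact_powR_le (mi_of l) (ltW sigma0); rewrite mi_abs_of.
apply: exp_of_moments => // k.
have [z|/mx_norm_neq0[[i j] e]] := eqVneq (mx_norm x) 0.
  rewrite (_ : `|x| = 0)//; case: k => [|k].
    have := mom (fun=> 0%N).
    have -> : mi_pow x (fun=> 0%N) = 1 by rewrite /mi_pow big1.
    have -> : mi_abs ((fun=> 0%N) : 'I_d -> nat) = 0%N by rewrite /mi_abs big1.
    have -> : mi_fact ((fun=> 0%N) : 'I_d -> nat) = 1%N by rewrite /mi_fact big1.
    by rewrite normr1 powR1 factpow0 !expr0 mul1r.
  by rewrite expr0n mul0r !mulr_ge0 ?factpow_ge0 ?exprn_ge0// ltW.
have := mom (mi_delta j k); rewrite mi_pow_delta mi_abs_delta mi_fact_delta normrX.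
by rewrite [`|x|]e /= (ord1 i).
Qed.

Lemma test_gs h N (f : 'rV[R]_d -> R[i]) : 0 < h -> 0 <= N -> smooth f ->
  (forall al be x, gs_quot s sigma h f al be x <= N) ->
  test_bound h (s / (2 * h `^ s^-1)) (2 `^ s * N) (fun x => complex.Re (f x)) /\
  test_bound h (s / (2 * h `^ s^-1)) (2 `^ s * N) (fun x => complex.Im (f x)).
Proof.
move=> h0 N0 [sr si] Hq; split; apply: (test_part (f := f)) => // be x.
  exact: (Re_le_normc (mderiv be f x)).
exact: (Im_le_normc (mderiv be f x)).
Qed.

Lemma mi_pow_le (x : 'rV[R]_d) al : `|mi_pow x al| <= `|x| ^+ mi_abs al.
Proof.
rewrite /mi_pow /mi_abs normr_prod -prodrXr; apply: ler_prod => i _.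
rewrite normrX exprn_ge0//= lerXn2r ?nnegrE//; exact: coord_le_norm.
Qed.

Lemma size_rderiv (al : 'I_d -> nat) :
  size (flatten [seq nseq (al i) i | i <- enum 'I_d]) = mi_abs al.
Proof.
rewrite size_flatten /shape -map_comp sumnE big_map big_enum /mi_abs.
by apply: eq_bigr => i _ /=; rewrite size_nseq.
Qed.

Lemma factpow_abs_le (t : R) (al : 'I_d -> nat) : 0 <= t ->
  factpow t (mi_abs al) <= ((2 ^+ d) `^ t) ^+ mi_abs al * (mi_fact al)%:R `^ t.
Proof.
move=> t0; rewrite -powR_exprn ?exprn_ge0// -powRM ?exprn_ge0//.
have := ler_powR_nat t0 (fact_abs_le al).
by rewrite natrM !natrX.
Qed.

(** Monomials are paid by the exponential decay, and factorials of orders are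
    replaced by products of factorials at the price of geometric factors
    collected in [h']. *)
Lemma gs_quot_of_test H c : 0 < H -> 0 < c -> exists2 h', 0 < h' &
  forall N (F G : 'rV[R]_d -> R), 0 <= N -> test_bound H c N F -> test_bound H c N G ->
  forall al be x, gs_quot s sigma h' (fun x => (F x +i* G x)%C) al be x <= 2 * N.
Proof.
move=> H0 c0; pose A := (s / c) `^ s * (2 ^+ d) `^ s; pose D := H * (2 ^+ d) `^ sigma.
have p0 (u t : R) : 0 < u -> 0 < u `^ t by exact: powR_gt0.
have A0 : 0 < A by rewrite mulr_gt0// p0// ?divr_gt0// exprn_gt0.
have D0 : 0 < D by rewrite mulr_gt0// p0// exprn_gt0.
exists (A + D); first by rewrite addr_gt0.
move=> N F G N0 tF tG al be x.
have mf0 (ga : 'I_d -> nat) (t : R) : 0 < (mi_fact ga)%:R `^ t by rewrite p0// ltr0n mi_fact_gt0.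
have AD : 0 < A + D by rewrite addr_gt0.
rewrite /gs_quot ler_pdivrMr; last by rewrite !mulr_gt0// exprn_gt0.
have der K : test_bound H c N K -> `|rderiv be K x| <=
    N * expR (- (c * `|x| `^ s^-1)) * (D ^+ mi_abs be * (mi_fact be)%:R `^ sigma).
  case=> _ /(_ (flatten [seq nseq (be i) i | i <- enum 'I_d]) x); rewrite -/(rderiv be K).
  rewrite gevrey_factT size_rderiv.
  move/le_trans; apply; rewrite ler_wpM2l ?mulr_ge0 ?expR_ge0// exprMn -mulrA.
  by rewrite ler_wpM2l ?exprn_ge0 ?(ltW H0)//; exact: factpow_abs_le (ltW sigma0).
have dd : Normc.normc (mderiv be (fun x => (F x +i* G x)%C) x) <=
    2 * N * expR (- (c * `|x| `^ s^-1)) * (D ^+ mi_abs be * (mi_fact be)%:R `^ sigma).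
  apply: (le_trans (normc_le_ReIm _)); apply: (le_trans (lerD (der _ tF) (der _ tG))).
  by move: (expR _) => e; apply: eq_ler; ring.
have pp : `|mi_pow x al| <= A ^+ mi_abs al * (mi_fact al)%:R `^ s * expR (c * `|x| `^ s^-1).
  apply: (le_trans (mi_pow_le x al)).
  apply: (le_trans (moment_le (mi_abs al) s0 c0 (normr_ge0 x))).
  rewrite ler_wpM2r ?expR_ge0// exprMn -mulrA ler_wpM2l ?exprn_ge0 ?powR_ge0//.
  exact: factpow_abs_le (ltW s0).
apply: (le_trans (ler_pM (normr_ge0 _) (le_trans (normr_ge0 _) (Re_le_normc _)) pp dd)).
have ee : expR (c * `|x| `^ s^-1) * expR (- (c * `|x| `^ s^-1)) = 1 :> R by rewrite -expRD subrr expR0.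
rewrite [leLHS](_ : _ = 2 * N * ((expR (c * `|x| `^ s^-1) * expR (- (c * `|x| `^ s^-1))) *
   (A ^+ mi_abs al * D ^+ mi_abs be * (mi_fact al)%:R `^ s * (mi_fact be)%:R `^ sigma))); last first.
  by move: (expR _) (expR _) => e1 e2; ring.
rewrite ee mul1r ler_wpM2l ?mulr_ge0// !ler_wpM2r ?powR_ge0// exprD.
by apply: ler_pM; rewrite ?exprn_ge0 ?(ltW A0) ?(ltW D0)//;
  rewrite lerXn2r ?nnegrE ?(ltW A0) ?(ltW D0) ?(ltW AD)// ?lerDl ?lerDr ?(ltW A0) ?(ltW D0).
Qed.

Lemma test_mono H H' c c' N N' (F : 'rV[R]_d -> R) : 0 <= H -> H <= H' -> 0 <= c' -> c' <= c -> 0 <= N -> N <= N' ->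
  test_bound H c N F -> test_bound H' c' N' F.
Proof.
move=> H0 HH c0 cc N0 NN; apply: gevrey_le => // x.
apply: ler_pM => //.
by rewrite ler_expR lerN2 ler_wpM2r// powR_ge0.
Qed.

Lemma test_comb H c N M (u v : R) (F G : 'rV[R]_d -> R) : test_bound H c N F -> test_bound H c M G ->
  test_bound H c (`|u| * N + `|v| * M) (fun x => u * F x + v * G x).
Proof.
move=> tF tG; have := gevrey_lin u v tF tG.
rewrite /test_bound; congr (gevrey _ _ _ _ _ _).
by apply/funext => x; rewrite mulrDl !mulrA.
Qed.

Lemma count_space_dir (l : seq 'I_(d + d)) :
  mi_abs (fun i : 'I_d => count_mem (lshift d i) l) = count (@space_dir d) l /\
  mi_abs (fun i : 'I_d => count_mem (rshift d i) l) = count (predC (@space_dir d)) l.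
Proof.
rewrite /mi_abs; elim: l => [|k l [IHl IHr]] /=; first by rewrite !big1.
rewrite !big_split/= IHl IHr; split; congr (_ + _)%N.
  rewrite /space_dir; case: (split_ordP k) => i ->.
    rewrite (bigD1 i)//= eqxx big1// => j /negbTE ji.
    by rewrite (inj_eq (@lshift_inj _ _)) eq_sym ji.
  by rewrite big1// => j _; rewrite eq_rlshift.
rewrite /space_dir; case: (split_ordP k) => i ->.
  by rewrite big1// => j _; rewrite eq_lrshift.
rewrite (bigD1 i)//= eqxx big1// => j /negbTE ji.
by rewrite (inj_eq (@rshift_inj _ _)) eq_sym ji.
Qed.

Lemma mi_pair_of (l : seq 'I_(d + d)) :
  mi_pair (fun i : 'I_d => count_mem (lshift d i) l) (fun i : 'I_d => count_mem (rshift d i) l) = mi_of l.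
Proof.
apply/funext => k; rewrite /mi_pair /mi_of; by case: (split_ordP k) => i ->.
Qed.

Lemma powR_enorm_le n (t : R) (x : 'rV[R]_n) : 0 <= t -> enorm x `^ t <= n%:R `^ t * `|x| `^ t.
Proof.
by move=> t0; rewrite -powRM//; apply: powR_le => //; [exact: sqrtr_ge0|exact: enorm_le].
Qed.

(** Passing from the Euclidean to the maximum norm multiplies the exponent by a
    constant, harmless because [r] is arbitrary. *)
Lemma symbol_bound_part (a : 'rV[R]_(d + d) -> R[i]) (b : 'rV[R]_(d + d) -> R) h :
  0 < h -> rsmooth b -> (forall be x, `|rderiv be b x| <= Normc.normc (mderiv be a x)) ->
  (forall r : R, 0 < r -> exists2 C : R, 0 < C &
    forall (alpha beta : 'I_d -> nat) (x xi : 'rV[R]_d),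
      Normc.normc (mderiv (mi_pair alpha beta) a (row_mx x xi)) <=
      C * h ^+ (mi_abs alpha + mi_abs beta) *
      (mi_fact alpha)%:R `^ sigma * (mi_fact beta)%:R `^ s *
      expR (r * (enorm x `^ s^-1 + enorm xi `^ sigma^-1))) ->
  symbol_bound s sigma h b.
Proof.
move=> h0 sb leb Ha r r0.
(* [k] bounds the distortion of both powers of the norm; 1 is added because [d]
   may be 0. *)
pose k : R := 1 + (d%:R `^ s^-1 + d%:R `^ sigma^-1).
have k0 : 0 < k by rewrite ltr_pwDl// addr_ge0// powR_ge0.
have rk : 0 < r / k by rewrite divr_gt0.
have [C C0 HC] := Ha _ rk; exists C => //; split=> // l w.
have [e1 e2] := count_space_dir l.
rewrite partials_rderiv// -mi_pair_of; apply: (le_trans (leb _ _)).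
rewrite -{1}[w]hsubmxK; apply: (le_trans (HC _ _ _ _)).
rewrite e1 e2 count_predC -!mulrA ler_wpM2l ?(ltW C0)// [leRHS]mulrC -!mulrA.
rewrite ler_wpM2l ?exprn_ge0 ?(ltW h0)//.
apply: ler_pM; [exact: powR_ge0|by rewrite mulr_ge0 ?powR_ge0 ?expR_ge0| |].
  by have := mi_fact_powR_le (fun i : 'I_d => count_mem (lshift d i) l) (ltW sigma0); rewrite e1.
apply: ler_pM; [exact: powR_ge0|exact: expR_ge0| |].
  by have := mi_fact_powR_le (fun i : 'I_d => count_mem (rshift d i) l) (ltW s0); rewrite e2.
rewrite ler_expR ler_wpM2l ?(ltW r0)// mulrC ler_pdivrMr// mulrDl.
have q1 (u v y : R) : 0 <= u -> 0 <= v -> 0 <= y -> u * y <= y * (1 + (u + v)).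
  by move=> u0 v0 y0; rewrite mulrC ler_wpM2l// addrA addrAC lerDr addr_ge0.
have q2 (u v y : R) : 0 <= u -> 0 <= v -> 0 <= y -> v * y <= y * (1 + (u + v)).
  by move=> u0 v0 y0; rewrite (addrC u); exact: q1.
apply: lerD.
  apply: (le_trans (powR_enorm_le _ _)); first by rewrite invr_ge0 ltW.
  by apply: q1; exact: powR_ge0.
apply: (le_trans (powR_enorm_le _ _)); first by rewrite invr_ge0 ltW.
by apply: q2; exact: powR_ge0.
Qed.

Lemma symbol_bound_Gamma0 (a : 'rV[R]_(d + d) -> R[i]) : Gamma0 s sigma a ->
  exists2 h, 0 < h & symbol_bound s sigma h (fun w => complex.Re (a w)) /\
    symbol_bound s sigma h (fun w => complex.Im (a w)).
Proof.
case=> [[sr si] [h h0 Ha]]; exists h => //; split; apply: (symbol_bound_part (a := a)) => // be x.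
  exact: (Re_le_normc (mderiv be a x)).
exact: (Im_le_normc (mderiv be a x)).
Qed.

End Seminorms.

(** * Complex integrals *)

Section Parts.
Context (R : realType).
Implicit Types (phi tau : R) (z y : R[i]).

(** The real part of [z e^(i phi)].  Working with all angles at once replaces
    the case distinction between real and imaginary parts by shifts of [phi]. *)
Definition part phi z : R := cos phi * complex.Re z - sin phi * complex.Im z.
(** The argument of the unit attached to a real ([false]) or imaginary ([true])
    part. *)
Definition rot (b : bool) : R := if b then pi / 2 else 0.
Definition reim (b : bool) z : R := if b then complex.Im z else complex.Re z.

Lemma part_Re z : part 0 z = complex.Re z.
Proof. by rewrite /part cos0 sin0 mul1r mul0r subr0. Qed.

Lemma part_Im z : part (- (pi / 2)) z = complex.Im z.
Proof. by rewrite /part cosN sinN cos_pihalf sin_pihalf mul0r mulN1r opprK add0r. Qed.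

Lemma part_inj z y : (forall phi, part phi z = part phi y) -> z = y.
Proof.
move=> zy; have := zy 0; have := zy (- (pi / 2)); rewrite !part_Re !part_Im.
by case: z y {zy} => a b [c d] /= -> ->.
Qed.

(** An imaginary factor rotates by a right angle. *)
Lemma part_mul phi z y : part phi (z * y) = \sum_(b : bool) reim b z * part (phi + rot b) y.
Proof.
rewrite big_bool /rot /part addr0 sinDpihalf cosDpihalf.
by case: z y => a b [c d] /=; ring.
Qed.

Lemma partZ phi (k : R) z : part phi (k%:C%C * z) = k * part phi z.
Proof. by rewrite /part; case: z => a b /=; ring. Qed.

Lemma partD phi z y : part phi (z + y) = part phi z + part phi y.
Proof. by rewrite /part; case: z y => a b [c d] /=; ring. Qed.

Lemma part_expi phi tau : part phi (expi tau) = cos (tau + phi).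
Proof. by rewrite /part /= cosD; ring. Qed.

Definition idom n (F : 'rV[R]_n -> R) := exists C, dom C F.

Lemma idom_ext n (F G : 'rV[R]_n -> R) : F =1 G -> idom G -> idom F.
Proof. by move=> /funext ->. Qed.

Lemma idomZ n (k : R) (F : 'rV[R]_n -> R) : idom F -> idom (fun x => k * F x).
Proof.
move=> [C dF]; have := dom_lin k 0 dF dF => d; exists (`|k| * C + `|0 : R| * C).
by move: d; under eq_fun do rewrite mul0r addr0.
Qed.

Lemma idom_sum n (F : bool -> 'rV[R]_n -> R) : (forall b, idom (F b)) ->
  idom (fun x => \sum_(b : bool) F b x).
Proof.
move=> dF; have [C d1] := dF true; have [D d2] := dF false.
exists (`|1| * C + `|1| * D); have := dom_lin 1 1 d1 d2.
by under eq_fun do rewrite !mul1r; under [X in _ -> dom _ X]eq_fun do rewrite big_bool.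
Qed.

Lemma rint_sum n (F : bool -> 'rV[R]_n -> R) : (forall b, idom (F b)) ->
  rint (fun x => \sum_(b : bool) F b x) = \sum_(b : bool) rint (F b).
Proof.
move=> dF; have [C d1] := dF true; have [D d2] := dF false.
rewrite big_bool /= -[rint (F true)]mul1r -[rint (F false)]mul1r -(rint_lin 1 1 d1 d2).
by apply: eq_rint => x; rewrite big_bool !mul1r.
Qed.

(** Domination in all directions, equivalent to that of real and imaginary part
    but stable under multiplication by complex scalars. *)
Definition cidom n (F : 'rV[R]_n -> R[i]) := forall phi, idom (fun x => part phi (F x)).

Lemma part_cint n (F : 'rV[R]_n -> R[i]) phi : cidom F ->
  part phi (cint F) = rint (fun x => part phi (F x)).
Proof.
move=> dF; have [C d1] := dF 0; have [D d2] := dF (- (pi / 2)).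
rewrite /part /= -mulNr -(rint_lin (cos phi) (- sin phi) (F := fun x => complex.Re (F x))
  (G := fun x => complex.Im (F x)) (C := C) (D := D)).
- by apply: eq_rint => x; rewrite mulNr.
- by move: d1; under eq_fun do rewrite part_Re.
- by move: d2; under eq_fun do rewrite part_Im.
Qed.

Lemma cintZ n (k : R) (F : 'rV[R]_n -> R[i]) : cidom F ->
  cint (fun x => k%:C%C * F x) = k%:C%C * cint F.
Proof.
move=> dF; apply: part_inj => phi; rewrite partZ !part_cint//.
  have [C dC] := dF phi; rewrite -(rintZ _ dC); apply: eq_rint => x; exact: partZ.
by move=> psi; apply: (idom_ext (fun x => partZ psi k (F x))); exact: idomZ.
Qed.

Lemma eq_cint n (F G : 'rV[R]_n -> R[i]) : F =1 G -> cint F = cint G.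
Proof. by move=> /funext ->. Qed.

(** Linearity over the complex numbers, from [part_mul] and real linearity. *)
Lemma cint_lin n (k : R[i]) (F G : 'rV[R]_n -> R[i]) : cidom F -> cidom G ->
  cint (fun x => k * F x + G x) = k * cint F + cint G.
Proof.
move=> dF dG.
pose H phi (b : bool) x := if b then \sum_(b : bool) reim b k * part (phi + rot b) (F x)
  else part phi (G x).
have HE phi x : part phi (k * F x + G x) = \sum_b H phi b x.
  by rewrite partD part_mul [RHS]big_bool.
have dK phi b : idom (fun x => reim b k * part (phi + rot b) (F x)) by exact/idomZ/dF.
have dH phi b : idom (H phi b).
  case: b => /=; last exact: dG.
  exact: (idom_sum (F := fun b x => reim b k * part (phi + rot b) (F x))).
apply: part_inj => phi; rewrite partD part_mul !part_cint//.
  transitivity (rint (fun x => \sum_b H phi b x)); first exact: eq_rint.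
  rewrite rint_sum// [LHS]big_bool /H; congr (_ + _).
  rewrite rint_sum//; apply: eq_bigr => b _.
  by have [C dC] := dF (phi + rot b); rewrite (rintZ _ dC) part_cint.
move=> psi; apply: (idom_ext (HE psi)); exact: idom_sum.
Qed.

End Parts.

(** * The operator on functions with Gevrey decay *)

Section Operator.
Context (R : realType) (d : nat) (s sigma : R).
Hypotheses (s0 : 0 < s) (sigma0 : 0 < sigma) (ss1 : 1 <= s + sigma).
Variables (eps : R) (B : 'M[R]_d).
Hypothesis eps2 : eps ^+ 2 = 1.
Variables (ha : R) (a : 'rV[R]_(d + d) -> R[i]).
Hypotheses (ha0 : 0 < ha) (sa : forall b, symbol_bound s sigma ha (fun w => reim b (a w))).
Implicit Types (F G : 'rV[R]_d -> R[i]).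

Definition ctest_bound (h c N : R) F := forall b, test_bound s sigma h c N (fun x => reim b (F x)).

Definition op_integrand F (x xi z : 'rV[R]_d) : R[i] :=
  a (row_mx (x - z *m B) xi) * F (x - eps *: z) * expi (dotv z xi).

Definition fourier_cst : R := (2 * pi) `^ (- (d%:R / 2)).
(** The factor (2 pi)^-d appears as two factors (2 pi)^(-d/2), as in the
    definition of the kernel. *)
Definition op_cst : R := fourier_cst * fourier_cst.

(** The operator [T] above; for [(B, eps) = (A^T, 1)] it is the
    pseudo-differential operator itself. *)
Definition opT F (x : 'rV[R]_d) : R[i] :=
  op_cst%:C%C * cint (fun xi => cint (op_integrand F x xi)).

Local Notation ampik F i k := (amplitude eps B (fun w => reim i (a w)) (fun x => reim k (F x))).

(** The four products of real and imaginary parts of the symbol and of the test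
    function, each with its own phase shift. *)
Lemma part_op_integrand phi F x xi z : part phi (op_integrand F x xi z) =
  \sum_(i : bool) \sum_(k : bool)
    osc (phi + rot R i + rot R k) (ampik F i k) (row_mx (row_mx x xi) z).
Proof.
rewrite /op_integrand -mulrA part_mul; apply: eq_bigr => i _.
rewrite part_mul mulr_sumr; apply: eq_bigr => k _.
rewrite part_expi /osc phase_row3 /amplitude mul_Lsym mul_Lpos_eps !(row_mxKl, row_mxKr).
by rewrite mulrA mulrC addrA.
Qed.

Section OnTest.
Variables (hf c N : R) (F : 'rV[R]_d -> R[i]).
Hypotheses (hf0 : 0 < hf) (c_gt0 : 0 < c) (N0 : 0 <= N) (tF : ctest_bound hf c N F).

Lemma ampik_admissible i k : exists h r M, [/\ 0 < h, 0 <= M &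
    admissible s sigma h r (fun x => M * expR (c / 2 * `|x| `^ s^-1)) (ampik F i k)].
Proof. exact: (amplitude_admissible s0 sigma0 B eps2 ha0 hf0 c_gt0 N0 (sa i) (tF k)). Qed.

Lemma idom_osc th i k x xi :
  idom (fun z => osc th (ampik F i k) (row_mx (row_mx x xi) z)).
Proof.
have [h [r [M [h0 M0 g]]]] := ampik_admissible i k.
exact: (ldom_dom1 (row_mx x xi) (admissible_ldom sigma0 th g)).
Qed.

Lemma idom_Jint th i k x : idom (fun xi => Jint th (ampik F i k) (row_mx x xi)).
Proof.
have [h [r [M [h0 M0 g]]]] := ampik_admissible i k.
exact: (ldom_dom1 x (Jint_ldom s0 sigma0 th h0 g)).
Qed.

Lemma cidom_op_integrand x xi : cidom (op_integrand F x xi).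
Proof.
move=> phi; apply: (idom_ext (part_op_integrand phi F x xi)).
by apply: idom_sum => i; apply: idom_sum => k; exact: idom_osc.
Qed.

Lemma part_inner phi x xi : part phi (cint (op_integrand F x xi)) =
  \sum_(i : bool) \sum_(k : bool) Jint (phi + rot R i + rot R k) (ampik F i k) (row_mx x xi).
Proof.
rewrite part_cint; last exact: cidom_op_integrand.
rewrite (eq_rint (part_op_integrand phi F x xi)) rint_sum; last first.
  by move=> i; apply: idom_sum => k; exact: idom_osc.
apply: eq_bigr => i _; rewrite rint_sum// => k; exact: idom_osc.
Qed.

Lemma cidom_inner x : cidom (fun xi => cint (op_integrand F x xi)).
Proof.
move=> phi; apply: (idom_ext (part_inner phi x)).
by apply: idom_sum => i; apply: idom_sum => k; exact: idom_Jint.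
Qed.

Lemma part_opT phi x : part phi (opT F x) =
  op_cst * \sum_(i : bool) \sum_(k : bool) Iint (phi + rot R i + rot R k) (ampik F i k) x.
Proof.
rewrite partZ part_cint; last exact: cidom_inner.
rewrite (eq_rint (part_inner phi x)) rint_sum; last first.
  by move=> i; apply: idom_sum => k; exact: idom_Jint.
congr (_ * _); apply: eq_bigr => i _; rewrite rint_sum// => k; exact: idom_Jint.
Qed.

End OnTest.

Lemma opT_lin hf c N F hf' c' N' G (k : R[i]) x :
  0 < hf -> 0 < c -> 0 <= N -> ctest_bound hf c N F ->
  0 < hf' -> 0 < c' -> 0 <= N' -> ctest_bound hf' c' N' G ->
  opT (fun y => k * F y + G y) x = k * opT F x + opT G x.
Proof.
move=> h0 c_0 N0 tF h0' c_0' N0' tG.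
have e xi z : op_integrand (fun y => k * F y + G y) x xi z = k * op_integrand F x xi z + op_integrand G x xi z.
  by rewrite /op_integrand; ring.
rewrite /opT mulrCA -mulrDr; congr (_ * _).
rewrite -cint_lin; [|exact: cidom_inner h0 c_0 N0 tF _|exact: cidom_inner h0' c_0' N0' tG _].
apply: eq_cint => xi; rewrite -cint_lin; [|exact: cidom_op_integrand h0 c_0 N0 tF _ _|exact: cidom_op_integrand h0' c_0' N0' tG _ _].
by apply: eq_cint => z.
Qed.

Lemma test_sum h c N (f : bool -> 'rV[R]_d -> R) : (forall b, test_bound s sigma h c N (f b)) ->
  test_bound s sigma h c (2 * N) (fun x => \sum_(b : bool) f b x).
Proof.
move=> tf; have := test_comb 1 1 (tf true) (tf false); rewrite normr1 !mul1r.
have -> : N + N = 2 * N by ring.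
congr (test_bound _ _ _ _ _ _); apply/funext => x; by rewrite big_bool !mul1r.
Qed.

Lemma testZ h c N (k : R) (f : 'rV[R]_d -> R) : test_bound s sigma h c N f ->
  test_bound s sigma h c (`|k| * N) (fun x => k * f x).
Proof.
move=> tf; have := test_comb k 0 tf tf; rewrite normr0 mul0r addr0.
by congr (test_bound _ _ _ _ _ _); apply/funext => x; rewrite mul0r addr0.
Qed.

Lemma opT_test hf c : 0 < hf -> 0 < c -> exists H c' C, [/\ 0 < H, 0 < c' & 0 < C] /\
  forall N F phi, 0 <= N -> ctest_bound hf c N F ->
    test_bound s sigma H c' (C * N) (fun x => part phi (opT F x)).
Proof.
move=> hf0 c_0.
have [H1 [k1 [C1 [[H10 k10 C10] t1]]]] :=
  Iint_test s0 sigma0 ss1 B eps2 ha0 hf0 c_0 (sa true).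
have [H2 [k2 [C2 [[H20 k20 C20] t2]]]] :=
  Iint_test s0 sigma0 ss1 B eps2 ha0 hf0 c_0 (sa false).
exists (H1 + H2), (Num.min k1 k2), (`|op_cst| * (2 * (2 * (C1 + C2)))); split.
  split; rewrite ?addr_gt0 ?lt_min ?k10//.
  rewrite !mulr_gt0 ?addr_gt0// normr_gt0 mulf_neq0// gt_eqF// powR_gt0// mulr_gt0//; exact: pi_gt0.
move=> N F phi N0 tF.
have T i k th : test_bound s sigma (H1 + H2) (Num.min k1 k2) ((C1 + C2) * N)
    (Iint th (ampik F i k)).
  have m0 : 0 <= Num.min k1 k2 by rewrite le_min !ltW.
  case: i; [have t := t1 N _ th N0 (tF k)|have t := t2 N _ th N0 (tF k)].
    apply: (test_mono (ltW H10) _ m0 _ _ _ t); rewrite ?ge_min ?lexx ?lerDl ?(ltW H20)//.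
      by rewrite mulr_ge0// ltW.
    by rewrite ler_wpM2r// lerDl ltW.
  apply: (test_mono (ltW H20) _ m0 _ _ _ t); rewrite ?ge_min ?lexx ?orbT ?lerDr ?(ltW H10)//.
    by rewrite mulr_ge0// ltW.
  by rewrite ler_wpM2r// lerDr ltW.
have := testZ op_cst (test_sum (fun i => test_sum (fun k => T i k (phi + rot R i + rot R k)))).
rewrite [X in test_bound _ _ _ _ X _](_ : _ = `|op_cst| * (2 * (2 * (C1 + C2))) * N); last by ring.
congr (test_bound _ _ _ _ _ _); apply/funext => x.
by rewrite (part_opT hf0 c_0 N0 tF).
Qed.

(** With [w = (u, xi)] this is the innermost integrand of the bilinear form. *)
Definition form_integrand G F (w : 'rV[R]_(d + d)) (t : 'rV[R]_d) : R[i] :=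
  G (lsubmx w + t *m B) * F (lsubmx w + t *m B - eps *: t) * expi (dotv t (rsubmx w)).

Local Notation pairjk G F j k := (pair0 eps B (fun x => reim j (G x)) (fun x => reim k (F x))).

Lemma part_form_integrand phi G F w t : part phi (form_integrand G F w t) =
  \sum_(j : bool) \sum_(k : bool)
    osc (phi + rot R j + rot R k) (pairjk G F j k) (row_mx w t).
Proof.
rewrite /form_integrand -mulrA part_mul; apply: eq_bigr => i _.
rewrite part_mul mulr_sumr; apply: eq_bigr => k _.
rewrite part_expi /osc phaseE row_mxKl row_mxKr /pair0 !mul_Lpos mulmxBr mul_mx_scalar.
by rewrite [lsubmx w + (_ - _)]addrA mulrA mulrC.
Qed.

Section OnPair.
Variables (hf c N M : R) (F G : 'rV[R]_d -> R[i]).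
Hypotheses (hf0 : 0 < hf) (c_gt0 : 0 < c) (N0 : 0 <= N) (M0 : 0 <= M).
Hypotheses (tF : ctest_bound hf c N F) (tG : ctest_bound hf c M G).

Lemma idom_pair th j k w : idom (fun t => osc th (pairjk G F j k) (row_mx w t)).
Proof. exact: (ldom_dom1 w (pair0_ldom s0 sigma0 B eps2 th hf0 c_gt0 N0 M0 (tG j) (tF k))). Qed.

Lemma cidom_form_integrand w : cidom (form_integrand G F w).
Proof.
move=> phi; apply: (idom_ext (part_form_integrand phi G F w)).
by apply: idom_sum => j; apply: idom_sum => k; exact: idom_pair.
Qed.

Lemma part_cint_form_integrand phi w : part phi (cint (form_integrand G F w)) =
    \sum_(j : bool) \sum_(k : bool) Jint (phi + rot R j + rot R k) (pairjk G F j k) w.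
Proof.
rewrite part_cint; last exact: cidom_form_integrand.
rewrite (eq_rint (part_form_integrand phi G F w)) rint_sum.
  by apply: eq_bigr => j _; rewrite rint_sum// => k; exact: idom_pair.
by move=> j; apply: idom_sum => k; exact: idom_pair.
Qed.

Lemma idom_mul_Jint th i j k : idom (fun w => reim i (a w) * Jint th (pairjk G F j k) w).
Proof.
have [h [r [C [h0 g]]]] := pair_amp_admissible s0 sigma0 B eps2 ha0 hf0 c_gt0 N0 M0 (sa i) (tG j) (tF k).
have [K K0 HK] := @Jint_bound R d s sigma s0 sigma0 h h0.
apply: (idom_ext (G := Jint th (pair_amp eps B (fun w => reim i (a w)) (fun x => reim j (G x)) (fun x => reim k (F x))))).
  by move=> w; rewrite (Jint_pair s0 sigma0 B eps2 _ th w hf0 c_gt0 N0 M0 (tG j) (tF k)).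
exists (K * C); split; first exact: Jint_continuous g.
move=> w; apply: (le_trans (HK th _ _ r w g)).
by rewrite -{3}[w]hsubmxK rho_row_mx !mulrA.
Qed.

Lemma part_form phi w : part phi (a w * cint (form_integrand G F w)) =
    \sum_(i : bool) \sum_(j : bool) \sum_(k : bool)
      reim i (a w) * Jint (phi + rot R i + rot R j + rot R k) (pairjk G F j k) w.
Proof.
rewrite part_mul; apply: eq_bigr => i _; rewrite part_cint_form_integrand mulr_sumr.
by apply: eq_bigr => j _; rewrite mulr_sumr.
Qed.

Lemma cidom_form : cidom (fun w => a w * cint (form_integrand G F w)).
Proof.
move=> phi; apply: (idom_ext (part_form phi)).
by do 3 (apply: idom_sum => ?); exact: idom_mul_Jint.
Qed.

(** Both sides are sums over real and imaginary parts of the three factors with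
    equal phase shifts, and the terms agree by [bilinear_fubini]. *)
Theorem opT_form : fourier_cst%:C%C * cint (fun w => a w * (fourier_cst%:C%C * cint (form_integrand G F w))) =
  cint (fun x => opT F x * G x).
Proof.
have id3 th i j k : idom (fun x => reim j (G x) * Iint th (ampik F i k) x).
  have [H [c' [C [[H0 c'0 C0] t]]]] := Iint_test s0 sigma0 ss1 B eps2 ha0 hf0 c_gt0 (sa i).
  have tI := t N _ th N0 (tF k).
  have [K K0 HK] := exp_le_rho d s0 c'0.
  exists (M * (C * N * K)); split.
    apply: continuous_mul; [exact: rsmooth_continuous (tG j).1|exact: rsmooth_continuous tI.1].
  move=> x; rewrite normrM -(mulrA M); apply: ler_pM => //.
    apply: (le_trans (gevrey_norm_le x (tG j))).
    by rewrite ler_piMr// -expR0 ler_expR oppr_le0 mulr_ge0 ?powR_ge0// ltW.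
  apply: (le_trans (gevrey_norm_le x tI)).
  by rewrite -!mulrA !ler_wpM2l// ltW.
have p3 phi x : part phi (opT F x * G x) = op_cst * \sum_(i : bool) \sum_(j : bool) \sum_(k : bool)
      reim j (G x) * Iint (phi + rot R i + rot R j + rot R k) (ampik F i k) x.
  rewrite mulrC part_mul [X in _ = _ * X]exchange_big/= mulr_sumr; apply: eq_bigr => j _.
  rewrite (part_opT hf0 c_gt0 N0 tF) mulrCA mulr_sumr; congr (_ * _); apply: eq_bigr => i _.
  by rewrite mulr_sumr; apply: eq_bigr => k _; rewrite (addrAC phi).
have cid3 : cidom (fun x => opT F x * G x).
  move=> phi; apply: (idom_ext (p3 phi)); apply: idomZ.
  apply: (idom_sum (F := fun i x => \sum_j \sum_k _)) => i.
  apply: (idom_sum (F := fun j x => \sum_k _)) => j.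
  exact: (idom_sum (F := fun k x => _)).
transitivity (op_cst%:C%C * cint (fun w => a w * cint (form_integrand G F w))).
  have -> : op_cst%:C%C = fourier_cst%:C%C * fourier_cst%:C%C by rewrite /op_cst rmorphM.
  rewrite -mulrA; congr (_ * _); rewrite -(cintZ fourier_cst cidom_form).
  by apply: eq_cint => w; rewrite mulrCA.
apply: part_inj => phi; rewrite partZ !part_cint//; last exact: cidom_form.
rewrite (eq_rint (part_form phi)) (eq_rint (p3 phi)).
rewrite rint_sum; last first.
  by move=> i; do 2 (apply: idom_sum => ?); exact: idom_mul_Jint.
have id4 i j th : idom (fun x => \sum_(k : bool) reim j (G x) * Iint (th k) (ampik F i k) x).
  exact: (idom_sum (F := fun k x => reim j (G x) * Iint (th k) (ampik F i k) x)).
have id5 i th : idom (fun x => \sum_(j : bool) \sum_(k : bool) reim j (G x) * Iint (th j k) (ampik F i k) x).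
  exact: (idom_sum (F := fun j x => \sum_(k : bool) reim j (G x) * Iint (th j k) (ampik F i k) x)).
have [D dD] : idom (fun x => \sum_(i : bool) \sum_(j : bool) \sum_(k : bool)
      reim j (G x) * Iint (phi + rot R i + rot R j + rot R k) (ampik F i k) x).
  exact: (idom_sum (F := fun i x => \sum_(j : bool) \sum_(k : bool) _)).
rewrite (rintZ _ dD); congr (_ * _); rewrite rint_sum//; apply: eq_bigr => i _.
rewrite rint_sum; last by move=> j; apply: idom_sum => k; exact: idom_mul_Jint.
rewrite rint_sum//; apply: eq_bigr => j _; rewrite !rint_sum//; last first.
  by move=> k; exact: idom_mul_Jint.
apply: eq_bigr => k _.
exact: (bilinear_fubini s0 sigma0 B eps2 _ ha0 hf0 c_gt0 N0 M0 (sa i) (tG j) (tF k)).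
Qed.

End OnPair.
End Operator.

(** * Continuity on the space and on its dual *)

Section Spaces.
Context (R : realType) (d : nat) (s sigma : R).
Hypotheses (s0 : 0 < s) (sigma0 : 0 < sigma) (ss1 : 1 <= s + sigma).
Local Notation gs := (gs s sigma d).
Local Notation gs_dual := (gs_dual s sigma d).
Local Notation gs_norm := (gs_norm s sigma).
Local Notation gs_quot := (gs_quot s sigma).

Lemma gs_norm_leP h (F : 'rV[R]_d -> R[i]) N :
  (gs_norm h F <= N%:E)%E <-> forall al be x, gs_quot h F al be x <= N.
Proof.
split=> [le al be x|le].
  rewrite -lee_fin; apply: le_trans le; apply: ereal_sup_ubound.
  by exists al, be, x.
by apply: ge_ereal_sup => _ [al [be [x ->]]]; rewrite lee_fin.
Qed.

Lemma gs_smooth (f : gs) : smooth f.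
Proof. by have /asboolP[] := gsP f. Qed.

Lemma gs_bound (f : gs) : exists h N, [/\ 0 < h, 0 <= N &
  forall al be x, gs_quot h f al be x <= N].
Proof.
have /asboolP[_ [h h0 /gs_norm_ltP[M HM]]] := gsP f.
exists h, (Num.max M 0); split=> // [|al be x]; first by rewrite le_max lexx orbT.
by apply: (le_trans (HM al be x)); rewrite le_max lexx.
Qed.

Definition decay (h : R) : R := s / (2 * h `^ s^-1).

Lemma decay_gt0 h : 0 < h -> 0 < decay h.
Proof. by move=> h0; rewrite divr_gt0// mulr_gt0// powR_gt0. Qed.

Lemma ctest_bound_quot h N (F : 'rV[R]_d -> R[i]) : 0 < h -> 0 <= N -> smooth F ->
  (forall al be x, gs_quot h F al be x <= N) -> ctest_bound s sigma h (decay h) (2 `^ s * N) F.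
Proof.
move=> h0 N0 sF Hq; have [t1 t2] := test_gs s0 sigma0 h0 N0 sF Hq.
by case.
Qed.

(** Both functions are brought to common constants, as required by [opT_form]. *)
Lemma gs_ctest_bound2 (f g : gs) : exists h c N, [/\ 0 < h, 0 < c, 0 <= N,
  ctest_bound s sigma h c N f & ctest_bound s sigma h c N g].
Proof.
have [h [N [h0 N0 Hf]]] := gs_bound f; have [k [M [k0 M0 Hg]]] := gs_bound g.
pose l := Num.max h k; have l0 : 0 < l by rewrite lt_max h0.
have L0 : 0 <= Num.max N M by rewrite le_max N0.
exists l, (decay l), (2 `^ s * Num.max N M); split=> //.
- exact: decay_gt0.
- by rewrite mulr_ge0// powR_ge0.
- apply: ctest_bound_quot => // [|al be x]; first exact: gs_smooth.
  apply: (le_trans (@gs_quot_le R s sigma d h l f al be x h0 _)); first by rewrite le_max lexx.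
  by apply: (le_trans (Hf al be x)); rewrite le_max lexx.
- apply: ctest_bound_quot => // [|al be x]; first exact: gs_smooth.
  apply: (le_trans (@gs_quot_le R s sigma d k l g al be x k0 _)); first by rewrite le_max lexx orbT.
  by apply: (le_trans (Hg al be x)); rewrite le_max lexx orbT.
Qed.

Definition step_bound (T : gs -> gs) (h h' K : R) := forall (f : gs) N, 0 <= N ->
  (gs_norm h f <= N%:E)%E -> (gs_norm h' (T f) <= (K * N)%:E)%E.

(** Continuity between steps of the inductive limit, with the target step
    depending on the source step. *)
Definition step_bounded (T : gs -> gs) := forall h : R, 0 < h ->
  exists h' K : R, [/\ 0 < h', 0 < K & step_bound T h h' K].

Section Existence.
Variables (eps : R) (B : 'M[R]_d).
Hypothesis eps2 : eps ^+ 2 = 1.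
Variables (a : 'rV[R]_(d + d) -> R[i]).
Hypothesis (Ga : Gamma0 s sigma a).

Lemma symbol_bound_reim : exists2 ha, 0 < ha & forall b, symbol_bound s sigma ha (fun w => reim b (a w)).
Proof.
have [ha ha0 [s1 s2]] := symbol_bound_Gamma0 s0 sigma0 Ga; exists ha => //; by case.
Qed.

Lemma opT_quot h : 0 < h -> exists h' K, [/\ 0 < h', 0 < K & forall F N, 0 <= N -> smooth F ->
  (forall al be x, gs_quot h F al be x <= N) -> smooth (opT eps B a F) /\
  forall al be x, gs_quot h' (opT eps B a F) al be x <= K * N].
Proof.
move=> h0; have [ha ha0 sa] := symbol_bound_reim.
have [H [c [C [[H0 c_0 C0] t]]]] := opT_test s0 sigma0 ss1 B eps2 ha0 sa h0 (decay_gt0 h0).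
have [h' h'0 q] := gs_quot_of_test d s0 sigma0 H0 c_0.
exists h', (2 * (C * 2 `^ s)); split=> // [|F N N0 sF Hq].
  by rewrite !mulr_gt0// powR_gt0.
have N0' : 0 <= 2 `^ s * N by rewrite mulr_ge0// powR_ge0.
have tF phi := t _ F phi N0' (ctest_bound_quot h0 N0 sF Hq).
have tR : test_bound s sigma H c (C * (2 `^ s * N)) (fun x => complex.Re (opT eps B a F x)).
  by have := tF 0; under eq_fun do rewrite part_Re.
have tI : test_bound s sigma H c (C * (2 `^ s * N)) (fun x => complex.Im (opT eps B a F x)).
  by have := tF (- (pi / 2)); under eq_fun do rewrite part_Im.
split; first by split; [exact: tR.1|exact: tI.1].
move=> al be x; rewrite -!mulrA.
have := q _ _ _ (mulr_ge0 (ltW C0) N0') tR tI al be x.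
by rewrite (_ : (fun x => _) = opT eps B a F).
Qed.

Lemma opT_gs : exists T : {linear gs -> gs},
  (forall f : gs, (T f : 'rV[R]_d -> R[i]) = opT eps B a f) /\ step_bounded T.
Proof.
have [ha ha0 sa] := symbol_bound_reim.
have inT (f : gs) : opT eps B a f \in gs_pred s sigma (n := d).
  have [h [N [h0 N0 Hf]]] := gs_bound f.
  have [h' [K [h'0 K0 HK]]] := opT_quot h0.
  have [sT bT] := HK f N N0 (gs_smooth f) Hf.
  apply/asboolP; split=> //; exists h' => //.
  by apply/gs_norm_ltP; exists (K * N).
pose T0 (f : gs) : gs := GS (inT f).
have lT : linear T0.
  move=> k f g; apply: val_inj; apply/funext => x.
  have [h [c [N [h0 c_0 N0 tf tg]]]] := gs_ctest_bound2 f g.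
  exact: (opT_lin s0 sigma0 B eps2 ha0 sa k x h0 c_0 N0 tf h0 c_0 N0 tg).
pose m := GRing.isLinear.Build _ _ _ _ T0 lT.
pose T : {linear gs -> gs} := HB.pack T0 m.
exists T; split=> // h h0; have [h' [K [h'0 K0 HK]]] := opT_quot h0.
exists h', K; split=> // f N N0 /gs_norm_leP Hf; apply/gs_norm_leP.
by have [_] := HK f N N0 (gs_smooth f) Hf.
Qed.
End Existence.

(** A linear map pulls absolutely convex sets back to absolutely convex sets,
    and the step estimates pull back the condition on the steps. *)
Lemma step_bounded_continuous (T : {linear gs -> gs}) : step_bounded T -> continuous T.
Proof.
move=> bT; apply/continuousP => W oW; have {}oW : gs_open W := oW.
change (gs_open (T @^-1` W)) => f /= Wf.
have [U [cU mU UW]] := oW _ Wf.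
exists (T @^-1` U); split.
- by move=> u v g1 g2 uv Ug1 Ug2; rewrite /preimage/= linearD !linearZ; exact: cU.
- move=> h h0; have [h' [K [h'0 K0 HK]]] := bT h h0.
  have [e e0 eU] := mU h' h'0; exists (e / (2 * K)); first by rewrite divr_gt0// mulr_gt0.
  move=> g /ltW le; apply: eU.
  have e'0 : 0 <= e / (2 * K) by rewrite divr_ge0 ?mulr_ge0 ?(ltW e0) ?(ltW K0).
  apply: (le_lt_trans (HK g _ e'0 le)); rewrite lte_fin.
  rewrite [ltLHS](_ : _ = e / 2); first by rewrite ltr_pdivrMr// ltr_pMr// ltr1n.
  by field; rewrite gt_eqF.
- by move=> g Ug; rewrite /preimage/= linearD; exact: UW.
Qed.

Lemma normc_real (k : R) : Normc.normc k%:C%C = `|k|.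
Proof. by rewrite /= expr0n addr0 sqrtr_sqr. Qed.

Lemma gs_normZ h (k : R) (f : gs) N : 0 < h -> 0 <= k -> (gs_norm h f <= N%:E)%E ->
  (gs_norm h (k%:C%C *: f) <= (k * N)%:E)%E.
Proof.
move=> h0 k0 /gs_norm_leP Hf; apply/gs_norm_leP => al be x.
apply: le_trans (ler_wpM2l k0 (Hf al be x)).
rewrite /Defs.gs_quot (mderivZ _ _ _ (gs_smooth f)) Normc.normcM normc_real (ger0_norm k0).
by rewrite mulrCA !mulrA.
Qed.

Lemma normc_scalar (u : gs -> R[i]) h K (f : gs) D :
  (forall (k : R[i]) g, u (k *: g) = k * u g) -> 0 < h -> 0 < K ->
  (forall g : gs, (gs_norm h g <= 1%:E)%E -> Normc.normc (u g) <= D) ->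
  (gs_norm h f <= K%:E)%E -> Normc.normc (u f) <= K * D.
Proof.
move=> uZ h0 K0 uD fK.
have Ki : 0 <= K^-1 by rewrite invr_ge0 ltW.
have := gs_normZ h0 Ki fK; rewrite mulVf ?gt_eqF// => /uD.
rewrite uZ Normc.normcM normc_real ger0_norm//.
by rewrite ler_pdivrMl.
Qed.

Lemma dual_norm_leP h (u : gs -> R[i]) D : (dual_norm h u <= D%:E)%E <->
  forall g : gs, (gs_norm h g <= 1%:E)%E -> Normc.normc (u g) <= D.
Proof.
split=> [le g g1|le].
  by rewrite -lee_fin; apply: le_trans le; apply: ereal_sup_ubound; exists g.
by apply: ge_ereal_sup => _ [g g1 <-]; rewrite lee_fin; exact: le.
Qed.

(** By homogeneity, a bound of [u] on the unit ball of the step [h'] bounds it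
    on the ball of radius [K], which contains the image of the unit ball of the
    step [h]. *)
Lemma dual_norm_comp (T : gs -> gs) h h' K (u : gs -> R[i]) D :
  (forall (k : R[i]) g, u (k *: g) = k * u g) -> 0 < h' -> 0 < K ->
  step_bound T h h' K ->
  (dual_norm h' u <= D%:E)%E -> (dual_norm h (fun f => u (T f)) <= (K * D)%:E)%E.
Proof.
move=> uZ h'0 K0 HK /dual_norm_leP uD; apply/dual_norm_leP => g g1.
apply: (normc_scalar uZ h'0 K0 uD); have := HK g 1 ler01 g1; by rewrite mulr1.
Qed.

Lemma dual_norm_fin (u : gs_dual) h : 0 < h -> exists2 D, 0 <= D & (dual_norm h u <= D%:E)%E.
Proof.
move=> h0; have := dualP u h0; case: dual_norm => [r _|//|_].
  by exists (Num.max r 0); rewrite ?le_max ?lexx ?orbT// lee_fin le_max lexx.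
by exists 0 => //; rewrite leNye.
Qed.

(** A neighbourhood in the projective limit involves finitely many steps; each
    is pulled back to the step of its image, and the radius is divided by the
    largest of finitely many constants. *)
Lemma dual_transpose (Pt : {linear gs -> gs}) : step_bounded Pt ->
  exists2 T : gs_dual -> gs_dual, forall u g, T u g = u (Pt g) & continuous T.
Proof.
move=> bP.
have fT (u : gs_dual) h : 0 < h -> (dual_norm h (u \o Pt : {scalar gs}) < +oo)%E.
  move=> h0; have [h' [K [h'0 K0 HK]]] := bP h h0.
  have [D D0 uD] := dual_norm_fin u h'0.
  apply: (le_lt_trans (dual_norm_comp _ h'0 K0 HK uD)); last by rewrite ltry.
  by move=> k g; rewrite linearZ.
pose T (u : gs_dual) : gs_dual := GSDual (fT u).
exists T => //; apply/continuousP => W oW; have {}oW : dual_open W := oW.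
change (dual_open (T @^-1` W)) => u /= Wu.
have [hs [e [hs0 e0 eW]]] := oW _ Wu.
(* The target steps have to be fixed before the common radius is chosen. *)
have [h' Hh'] : exists h', forall h, 0 < h ->
    exists K : R, [/\ 0 < h' h, 0 < K & step_bound Pt h (h' h) K].
  have H h : exists h', 0 < h -> exists K : R, [/\ 0 < h', 0 < K & step_bound Pt h h' K].
    have [h0|h0] := boolP (0 < h); last by exists 0.
    by have [h' HK] := bP h h0; exists h'.
  by exists (fun h => projT1 (cid (H h))) => h; exact: (projT2 (cid (H h))).
have [e' e'0 He'] : exists2 e' : R, 0 < e' & forall h, h \in hs -> forall v : gs_dual,
    (dual_norm (h' h) (fun f => (v f - u f)%R) < e'%:E)%E ->
    (dual_norm h (fun f => (T v f - T u f)%R) < e%:E)%E.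
  elim: hs hs0 {eW} => [|h hs IH] hs0; first by exists 1.
  have [|e1 e10 He1] := IH; first by move=> k kh; apply: hs0; rewrite in_cons kh orbT.
  have [|K [hh0 K0 HK]] := Hh' h; first by apply: hs0; rewrite mem_head.
  have ek0 : 0 < e / (2 * K) by rewrite divr_gt0// mulr_gt0.
  exists (Num.min e1 (e / (2 * K))); first by rewrite lt_min e10.
  move=> k; rewrite in_cons => /orP[/eqP ->|kh] v lt; last first.
    by apply: He1 => //; apply: (lt_le_trans lt); rewrite lee_fin ge_min lexx.
  have lt2 : (dual_norm (h' h) (fun f => (v f - u f)%R) <= (e / (2 * K))%:E)%E.
    by apply: ltW; apply: (lt_le_trans lt); rewrite lee_fin ge_min lexx orbT.
  have vuZ (z : R[i]) g : v (z *: g) - u (z *: g) = z * (v g - u g) by rewrite mulrBr !linearZ.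
  have := dual_norm_comp vuZ hh0 K0 HK lt2.
  move/le_lt_trans; apply; rewrite lte_fin.
  rewrite [ltLHS](_ : _ = e / 2); first by rewrite ltr_pdivrMr// ltr_pMr// ltr1n.
  by field; rewrite gt_eqF.
exists [seq h' h | h <- hs], e'; split=> //.
  by move=> _ /mapP[h hin ->]; have [K []] := Hh' h (hs0 _ hin).
move=> v Hv; apply: eW => h hin; apply: (He' h hin); apply: Hv.
exact: map_f.
Qed.

Section Kernel.
Variable A : 'M[R]_d.

(** The inverse of [quant_mx A]: [(u, t)] is sent to
    [(u + t A^T, u + t (A^T - 1))]. *)
Definition quant_inv : 'M[R]_(d + d) := block_mx 1%:M 1%:M A^T (A^T - 1%:M).

Lemma quant_mulV : quant_mx A *m quant_inv = 1%:M.
Proof.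
rewrite /quant_mx /quant_inv mulmx_block !mulmx1 !mul1mx !mulNmx !mul1mx.
have -> : 1%:M - A^T + A^T = 1%:M by rewrite subrK.
have -> : 1%:M - A^T + (A^T - 1%:M) = 0 by rewrite addrA subrK subrr.
have -> : A^T - (A^T - 1%:M) = 1%:M by rewrite opprB addrC subrK.
by rewrite subrr -scalar_mx_block.
Qed.

Lemma quant_inv_mx : invmx (quant_mx A) = quant_inv.
Proof.
have [u _] := mulmx1_unit quant_mulV.
by rewrite -[RHS](mulKmx u) quant_mulV mulmx1.
Qed.

(** Right multiplication by a unipotent matrix makes [quant_mx A] block
    triangular with diagonal blocks [1] and [-1]. *)
Lemma norm_det_quant : `|\det (quant_mx A)| = 1.
Proof.
have e : quant_mx A *m block_mx 1%:M 0 A^T 1%:M = block_mx 1%:M 1%:M 0 (- 1%:M).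
  rewrite /quant_mx mulmx_block !mulmx1 !mulmx0 !mul1mx !mulNmx !mul1mx !add0r.
  by rewrite subrK subrr.
have := congr1 determinant e; rewrite det_mulmx det_lblock det_ublock !det1 !mul1r mulr1 => ->.
by rewrite -scaleN1r detZ det1 mulr1 normrX normrN1 expr1n.
Qed.

(** The change of variables has determinant of modulus 1, and the partial
    Fourier transform of the tensor product is written out. *)
Lemma Op_formE (a : 'rV[R]_(d + d) -> R[i]) f g : Op A (distr a) f g =
  two_pi_pow (- (d%:R / 2)) * cint (fun w => a w * (two_pi_pow (- (d%:R / 2)) *
    cint (fun t => g (lsubmx w + t *m A^T) * f (lsubmx w + t *m (A^T - 1%:M)) *
      expi (dotv t (rsubmx w))))).
Proof.
rewrite /Op /Defs.kernel /pull norm_det_quant invr1 quant_inv_mx mul1r.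
congr (_ * _); apply: eq_cint => w; congr (_ * (_ * _)); apply: eq_cint => t.
by rewrite /tensor /quant_inv mul_row_block !mulmx1 row_mxKl row_mxKr.
Qed.

End Kernel.

Section Final.
Variables (A : 'M[R]_d) (a : 'rV[R]_(d + d) -> R[i]).
Hypothesis (Ga : Gamma0 s sigma a).

Lemma Op_opT (f g : gs) : Op A (distr a) f g = distr (opT 1 A^T a f) g.
Proof.
have [ha ha0 sa] := symbol_bound_reim Ga.
have [h [c [N [h0 c_0 N0 tf tg]]]] := gs_ctest_bound2 f g.
have e1 : (1 : R) ^+ 2 = 1 by rewrite expr1n.
rewrite Op_formE /distr -(opT_form s0 sigma0 ss1 A^T e1 ha0 sa h0 c_0 N0 N0 tf tg).
congr (_ * _); apply: eq_cint => w; congr (_ * (_ * _)); apply: eq_cint => t.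
by rewrite /form_integrand scale1r mulmxBr mulmx1 addrA.
Qed.

Lemma Op_opT_transpose (f g : gs) :
  Op A (distr a) f g = distr f (opT (- 1) (A^T - 1%:M) a g).
Proof.
have [ha ha0 sa] := symbol_bound_reim Ga.
have [h [c [N [h0 c_0 N0 tf tg]]]] := gs_ctest_bound2 f g.
have e1 : (- 1 : R) ^+ 2 = 1 by rewrite sqrrN expr1n.
transitivity (cint (fun x => opT (- 1) (A^T - 1%:M) a g x * f x)); last first.
  by apply: eq_cint => x; rewrite mulrC.
rewrite Op_formE -(opT_form s0 sigma0 ss1 (A^T - 1%:M) e1 ha0 sa h0 c_0 N0 N0 tg tf).
congr (_ * _); apply: eq_cint => w; congr (_ * (_ * _)); apply: eq_cint => t.
rewrite /form_integrand scaleN1r opprK mulmxBr mulmx1 addrA subrK.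
by rewrite [g _ * _]mulrC.
Qed.

End Final.
End Spaces.

Theorem theorem4p7 (R : realType) (d : nat) (A : 'M[R]_d) (s sigma : R)
    (s_gt0 : 0 < s) (sigma_gt0 : 0 < sigma) (s_sigma : 1 <= s + sigma)
    (a : 'rV[R]_(d + d) -> R[i]) (ha : Gamma0 s sigma a) :
  continuous_on_gs s sigma (Op A (distr a)) /\
  continuous_on_dual s sigma (Op A (distr a)).
Proof.
have e1 : (1 : R) ^+ 2 = 1 by rewrite expr1n.
have e2 : (- 1 : R) ^+ 2 = 1 by rewrite sqrrN expr1n.
split.
  have [T [TE bT]] := opT_gs s_gt0 sigma_gt0 s_sigma A^T e1 ha.
  exists T; split; first exact: step_bounded_continuous bT.
  move=> f g; rewrite (Op_opT s_gt0 sigma_gt0 s_sigma A ha).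
  by rewrite -TE.
have [Pt [PE bP]] := opT_gs s_gt0 sigma_gt0 s_sigma (A^T - 1%:M) e2 ha.
have PtE (f g : gs s sigma d) : Op A (distr a) f g = distr f (Pt g).
  by rewrite (Op_opT_transpose s_gt0 sigma_gt0 s_sigma A ha) -PE.
have [T TE cT] := dual_transpose bP.
exists Pt, T; split=> // f u uf g.
by rewrite TE uf PtE.
Qed.
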